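(* Let $F(x)\in\mathbb{Z}[x]$ be a monic polynomial of degree $m$, and let $$F(j(z))=\sum_{n=-m}^{\infty}a(n)q^n .$$ (1) If $p$ is prime and $\widetilde{S}_p(x)^2$ divides $F(x)$ in $\mathbb{F}_p[x]$, then $$F(j(z))\mid U(p)\equiv G_p(j(z))\pmod p$$ for some $G_p(x)\in\mathbb{Z}[x]$ with degree $\le m/p$. (2) If $p\le 11$ is prime and $m<p$, then $$F(j(z))\mid U(p)\equiv a(0)\pmod p,$$ where $a(0)$ is the constant term in the Fourier expansion of $F(j(z))$.
   Context: $j(z)=q^{-1}+744+196884q+\cdots$ is the usual modular $j$-function for $\mathrm{SL}_2(\mathbb{Z})$, with $q=e^{2\pi i z}$; polynomials in $j(z)$ are identified with their $q$-expansions. $U(p)$ is the formal operator on Laurent series in $q$ given by $\left(\sum_n a(n)q^n\right)\mid U(p):=\sum_n a(pn)q^n$. Congruences modulo $p$ between $q$-series with integer coefficients are coefficientwise. For a prime $p$, $$\widetilde{S}_p(x):=\prod_{\substack{E/\overline{\mathbb{F}}_p\ \text{supersingular}\\ j(E)\notin\{0,1728\}}}(x-j(E))\in\mathbb{F}_p[x],$$ the product being over isomorphism classes of supersingular elliptic curves over $\overline{\mathbb{F}}_p$ with $j$-invariant different from $0$ and $1728$ in $\overline{\mathbb{F}}_p$ (an empty product is $1$). *)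

(* Defs.v *)
From HB Require Import structures.
From mathcomp Require Import all_boot all_order all_algebra all_field.
From mathcomp Require Import generic_quotient ring.
From mathcomp Require Import boolp classical_sets functions cardinality fsbigop.

Set Implicit Arguments.
Unset Strict Implicit.
Unset Printing Implicit Defensive.

Import Order.TTheory GRing.Theory Num.Theory.
Local Open Scope ring_scope.

(* A power series is the sequence of its coefficients. *)
Definition pseries := nat -> int.

Definition ps_one : pseries := fun n => (n == 0%N)%:R.

Definition ps_mul (a b : pseries) : pseries :=
  fun n => \sum_(i < n.+1) a i * b (n - i)%N.

Definition ps_exp (a : pseries) (k : nat) : pseries := iter k (ps_mul a) ps_one.

(* [ps_inv_rec a n] is [:: b n; ...; b 0], where b = 1/a and a 0 = 1. *)
Fixpoint ps_inv_rec (a : pseries) (n : nat) : seq int :=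
  if n is k.+1 then
    let s := ps_inv_rec a k in (- \sum_(i < n) a i.+1 * s`_i) :: s
  else [:: 1].

Definition ps_inv (a : pseries) : pseries := fun n => head 0 (ps_inv_rec a n).

(* [Laurent d a] is the Laurent series q^(-d) * \sum_n (a n) q^n. *)
Record laurent := Laurent { pole : nat; tail : pseries }.

Definition lcoef (f : laurent) (n : int) : int :=
  if n + (pole f)%:Z is Posz k then tail f k else 0.

Definition lexp (f : laurent) (k : nat) : laurent :=
  Laurent (k * pole f) (ps_exp (tail f) k).

(* Coefficients of F(f) = \sum_i F_i f^i. *)
Definition poly_coef (F : {poly int}) (f : laurent) (n : int) : int :=
  \sum_(i < size F) F`_i * lcoef (lexp f i) n.

Definition sigma (k n : nat) : nat := (\sum_(d <- divisors n) d ^ k)%N.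

Definition E4 : pseries := fun n => if n == 0%N then 1 else 240 * (sigma 3 n)%:R.

(* Delta / q = \prod_(k >= 1) (1 - q^k)^24; the factors with k > n do not
   contribute to the coefficient of q^n. *)
Definition Delta_over_q : pseries :=
  fun n => (\prod_(1 <= k < n.+1) (1 - 'X^k : {poly int}) ^+ 24)`_n.

(* j = E4^3 / Delta, with Delta = q * Delta_over_q. *)
Definition j_series : laurent := Laurent 1 (ps_mul (ps_exp E4 3) (ps_inv Delta_over_q)).

(* The coefficient a(n) of q^n in F(j(z)). *)
Definition j_coef (F : {poly int}) : int -> int := poly_coef F j_series.

Definition Uop (p : nat) (a : int -> int) : int -> int := fun n => a (p%:Z * n).

Definition q_const (c : int) : int -> int := fun n => if n == 0 then c else 0.

Definition q_congr (p : nat) (a b : int -> int) : Prop :=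
  forall n : int, (a n = b n %[mod p%:Z])%Z.

(* y^2 + a1 x y + a3 y = x^3 + a2 x^2 + a4 x + a6 *)
Record weierstrass (K : Type) :=
  Weierstrass { a1 : K; a2 : K; a3 : K; a4 : K; a6 : K }.

Definition w_tuple (K : Type) (E : weierstrass K) :=
  (a1 E, a2 E, a3 E, a4 E, a6 E).

Definition w_of_tuple (K : Type) (t : K * K * K * K * K) : weierstrass K :=
  let: (x1, x2, x3, x4, x6) := t in Weierstrass x1 x2 x3 x4 x6.

Lemma w_tupleK (K : Type) : cancel (@w_tuple K) (@w_of_tuple K).
Proof. by case. Qed.

HB.instance Definition _ (K : choiceType) :=
  Choice.copy (weierstrass K) (can_type (@w_tupleK K)).

Definition w_b2 (K : fieldType) (E : weierstrass K) : K := a1 E ^+ 2 + 4 * a2 E.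
Definition w_b4 (K : fieldType) (E : weierstrass K) : K := 2 * a4 E + a1 E * a3 E.
Definition w_b6 (K : fieldType) (E : weierstrass K) : K := a3 E ^+ 2 + 4 * a6 E.
Definition w_b8 (K : fieldType) (E : weierstrass K) : K :=
  a1 E ^+ 2 * a6 E + 4 * a2 E * a6 E - a1 E * a3 E * a4 E + a2 E * a3 E ^+ 2
  - a4 E ^+ 2.
Definition w_c4 (K : fieldType) (E : weierstrass K) : K :=
  w_b2 E ^+ 2 - 24 * w_b4 E.
Definition w_disc (K : fieldType) (E : weierstrass K) : K :=
  - w_b2 E ^+ 2 * w_b8 E - 8 * w_b4 E ^+ 3 - 27 * w_b6 E ^+ 2
  + 9 * w_b2 E * w_b4 E * w_b6 E.

Definition elliptic (K : fieldType) (E : weierstrass K) : bool := w_disc E != 0.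

Definition j_inv (K : fieldType) (E : weierstrass K) : K := w_c4 E ^+ 3 / w_disc E.

(* The curve obtained from E by x = u^2 x' + r, y = u^3 y' + u^2 s x' + t. *)
Definition w_change (K : fieldType) (u r s t : K) (E : weierstrass K) :=
  Weierstrass
    ((a1 E + 2 * s) / u)
    ((a2 E - s * a1 E + 3 * r - s ^+ 2) / u ^+ 2)
    ((a3 E + r * a1 E + 2 * t) / u ^+ 3)
    ((a4 E - s * a3 E + 2 * r * a2 E - (t + r * s) * a1 E + 3 * r ^+ 2
      - 2 * s * t) / u ^+ 4)
    ((a6 E + r * a4 E + r ^+ 2 * a2 E + r ^+ 3 - t * a3 E - t ^+ 2
      - r * t * a1 E) / u ^+ 6).

Definition w_iso (K : fieldType) : rel (weierstrass K) :=
  fun E E' => `[< exists u r s t : K, u != 0 /\ E' = w_change u r s t E >].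

Lemma w_change_id (K : fieldType) (E : weierstrass K) : w_change 1 0 0 0 E = E.
Proof.
case: E => x1 x2 x3 x4 x6.
by rewrite /w_change /=; congr Weierstrass; field; rewrite ?oner_neq0.
Qed.

Lemma w_iso_refl (K : fieldType) : reflexive (@w_iso K).
Proof.
move=> E; apply/asboolP; exists 1, 0, 0, 0.
by rewrite oner_neq0 w_change_id.
Qed.

Lemma w_change_comp (K : fieldType) (u r s t u' r' s' t' : K)
    (E : weierstrass K) : u != 0 -> u' != 0 ->
  w_change u' r' s' t' (w_change u r s t E) =
  w_change (u * u') (u ^+ 2 * r' + r) (u * s' + s)
           (u ^+ 3 * t' + u ^+ 2 * s * r' + t) E.
Proof.
by move=> u0 u'0; rewrite /w_change /=; congr Weierstrass; field; rewrite ?u0 ?u'0.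
Qed.

Lemma w_iso_sym (K : fieldType) : symmetric (@w_iso K).
Proof.
suff sub (E E' : weierstrass K) : w_iso E E' -> w_iso E' E.
  by move=> E E'; apply/idP/idP; apply: sub.
move=> /asboolP[u [r [s [t [u0 ->]]]]]; apply/asboolP.
exists u^-1, (- r / u ^+ 2), (- s / u), ((r * s - t) / u ^+ 3).
split; first by rewrite invr_eq0.
rewrite w_change_comp ?invr_eq0 // -[LHS]w_change_id; congr w_change.
- by rewrite divff.
- by field.
- by field.
- by field.
Qed.

Lemma w_iso_trans (K : fieldType) : transitive (@w_iso K).
Proof.
move=> E' E E'' /asboolP[u [r [s [t [u0 ->]]]]].
move=> /asboolP[u' [r' [s' [t' [u'0 ->]]]]]; apply/asboolP.
exists (u * u'), (u ^+ 2 * r' + r), (u * s' + s), (u ^+ 3 * t' + u ^+ 2 * s * r' + t).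
by rewrite mulf_neq0 // w_change_comp.
Qed.

Definition w_iso_equiv (K : fieldType) : equiv_rel (weierstrass K) :=
  EquivRel (@w_iso K) (@w_iso_refl K) (@w_iso_sym K) (@w_iso_trans K).

Definition iso_class (K : fieldType) := {eq_quot (w_iso_equiv K)}%qT.

Inductive point (K : Type) := Infinity | Affine of K & K.
Arguments Infinity {K}.

Definition on_curve (K : fieldType) (E : weierstrass K) (P : point K) : bool :=
  if P is Affine x y then
    y ^+ 2 + a1 E * x * y + a3 E * y == x ^+ 3 + a2 E * x ^+ 2 + a4 E * x + a6 E
  else true.

(* The line through the two points (the tangent if they coincide) is
   y = l x + nu. *)
Definition pt_add (K : fieldType) (E : weierstrass K) (P Q : point K) : point K :=
  match P, Q with
  | Infinity, _ => Q
  | _, Infinity => P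
  | Affine x1 y1, Affine x2 y2 =>
    if (x1 == x2) && (y1 + y2 + a1 E * x2 + a3 E == 0) then Infinity else
    let l := if x1 == x2
             then (3 * x1 ^+ 2 + 2 * a2 E * x1 + a4 E - a1 E * y1)
                  / (2 * y1 + a1 E * x1 + a3 E)
             else (y2 - y1) / (x2 - x1) in
    let nu := y1 - l * x1 in
    let x3 := l ^+ 2 + a1 E * l - a2 E - x1 - x2 in
    Affine x3 (- (l + a1 E) * x3 - nu - a3 E)
  end.

Definition pt_muln (K : fieldType) (E : weierstrass K) (n : nat) (P : point K) :=
  iter n (pt_add E P) Infinity.

(* For K algebraically closed of characteristic p: E(K) has no p-torsion. *)
Definition supersingular (K : fieldType) (p : nat) (E : weierstrass K) : Prop :=
  forall P : point K, on_curve E P -> pt_muln E p P = Infinity -> P = Infinity.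

Definition Fpbar (p : nat) : countClosedFieldType :=
  projT1 (countable_algebraic_closure 'F_p).

Definition Fp_embed (p : nat) : {rmorphism 'F_p -> Fpbar p} :=
  proj1_sig (projT2 (countable_algebraic_closure 'F_p)).

Definition ss_classes (p : nat) : set (iso_class (Fpbar p)) :=
  [set c | let E := repr c in
           [/\ elliptic E, supersingular p E, j_inv E != 0 & j_inv E != 1728%:R]]%classic.
Arguments ss_classes : clear implicits.

(* The set [ss_classes p] is finite, so this is a genuine product (the product
   indexed by an infinite set would be 1). *)
Definition ss_poly_bar (p : nat) : {poly Fpbar p} :=
  \big[*%R/1]_(c \in ss_classes p) ('X - (j_inv (repr c))%:P).

(* The element of F_p with image x, for x in the image of F_p. *)
Definition Fp_descend (p : nat) (x : Fpbar p) : 'F_p :=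
  odflt 0 [pick a : 'F_p | Fp_embed p a == x].

(* The coefficients of [ss_poly_bar p] lie in F_p, because the Frobenius
   permutes the supersingular j-invariants; this is that polynomial viewed in
   F_p[x]. *)
Definition ss_poly (p : nat) : {poly 'F_p} := map_poly (@Fp_descend p) (ss_poly_bar p).

Definition poly_mod (p : nat) (F : {poly int}) : {poly 'F_p} := map_poly intr F.

(* Main.v *)
(** Put t = 1/j and theta = q d/dq, so that theta j = - j E6/E4.  For p >= 5
    put N = (p-1)/2 and let H(t) be the Hasse invariant of
    y^2 = x^3 - 3c x + 2c^2, c = 1 - 1728 t, a curve of j-invariant 1/t.  Here
    the Hasse invariant is the function A such that the p-th iterate of the
    invariant derivation D = 2y d/dx is A D.  The Tate curve is an explicit
    point of y^2 = x^3 - 3 E4 x + 2 E6 on which D^p is a constant times D, so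
    its Hasse invariant is a constant, and by homogeneity
    (E6/E4)^(p-1) H(1/j)^2 = c(1/j)^(p-1) modulo p.

    Up to a power of c, H has simple roots, because Ramanujan's equations
    turn into a second-order differential equation for H.  These roots are the
    inverses of the supersingular j-invariants: a p-torsion point gives a
    function g with norm k (x - x0)^p (Miller's algorithm), which is an
    eigenfunction of D, and conversely an eigenfunction of D for a nonzero
    eigenvalue produces a p-torsion point.  Hence, if the square of the
    supersingular polynomial divides F, then F(j) (theta j)^(p-1) is modulo p a
    polynomial B in j.  As theta j * j^(n-1) is theta (j^n) / n when p does not
    divide n and (theta j)^p is a p-th power, applying U(p) to
    F(j) (theta j)^p = B(j) theta j shows that F(j) | U(p) is a polynomial in j
    of degree at most m/p.

    For p = 2, 3 one has E4 = E6 = 1 modulo p, and for p = 5, 7, 11 the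
    polynomial H is a constant times a power of c, so that no divisibility is
    needed; when m < p the resulting polynomial is constant. *)

Require Import Defs.
From mathcomp Require Import all_boot all_order all_algebra all_field.
From HB Require Import structures.
From mathcomp Require Import generic_quotient ring zify.
From mathcomp Require Import boolp classical_sets cardinality fsbigop.

Set Implicit Arguments.
Unset Strict Implicit.
Unset Printing Implicit Defensive.

Import Order.TTheory GRing.Theory Num.Theory.
Local Open Scope ring_scope.

(** Modular forms enter only as q-expansions: Ramanujan's equations, the discriminant and the
    Weierstrass equation of the Tate curve all come from identities between geometric series. The
    Hasse invariant of the Tate curve is constant by Fermat's theorem: u d/du multiplies u^n by n,
    and n^p = n modulo p. The square of the supersingular polynomial appears because H belongs to
    the exponent (p-1)/2 while theta j is raised to the power p-1. The variable t = 1/j is a power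
    series at the cusp; the point j = 0 then lies at t = infinity and is controlled by a degree
    bound.

    The obstacle is that supersingularity is defined through points of order p. Divisors are encoded
    in the ring L[x][y]/(y^2 - f) of functions with poles only at infinity: the norm to L[x] records
    the zeros up to the sign of y, nonvanishing at the opposite point fixes the sign, and the degree
    of the norm is the order of the pole. Genus one enters as the absence of functions whose norm
    has degree 1. *)

(** A certificate of ideal membership: the cofactor [c] is supplied by hand and [ring] checks the
    remaining identity. *)
Lemma lin_comb (R : pzRingType) (c x y l r : R) : x = y -> l - r = c * (x - y) -> l = r.
Proof. by move=> ->; rewrite subrr mulr0 => /subr0_eq. Qed.

(** * Formal power series *)

Record fps (R : Type) := Fps { fcoef : nat -> R }.

Lemma fpsP (R : Type) (s t : fps R) : (forall n, fcoef s n = fcoef t n) -> s = t.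
Proof. by case: s t => s [t] /= st; congr Fps; apply: funext. Qed.

HB.instance Definition _ (R : Type) := gen_eqMixin (fps R).
HB.instance Definition _ (R : Type) := gen_choiceMixin (fps R).

(* The ring operations and the indeterminate are locked: comparing two
   different expressions by unfolding them is exponentially slow. *)
HB.lock Definition fps_add (R : zmodType) (s t : fps R) : fps R :=
  Fps (fun n => fcoef s n + fcoef t n).
HB.lock Definition fps_opp (R : zmodType) (s : fps R) : fps R :=
  Fps (fun n => - fcoef s n).
HB.lock Definition fps_zero (R : zmodType) : fps R := Fps (fun=> 0).

Section FpsZmod.
Variable R : zmodType.
Implicit Types s t u : fps R.

Lemma fcoef_fps_add s t n : fcoef (fps_add s t) n = fcoef s n + fcoef t n.
Proof. by rewrite unlock. Qed.
Lemma fcoef_fps_opp s n : fcoef (fps_opp s) n = - fcoef s n.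
Proof. by rewrite unlock. Qed.
Lemma fcoef_fps_zero n : fcoef (fps_zero R) n = 0.
Proof. by rewrite unlock. Qed.

Lemma fps_addA : associative (@fps_add R).
Proof. by move=> s t u; apply: fpsP => n; rewrite !fcoef_fps_add addrA. Qed.
Lemma fps_addC : commutative (@fps_add R).
Proof. by move=> s t; apply: fpsP => n; rewrite !fcoef_fps_add addrC. Qed.
Lemma fps_add0 : left_id (fps_zero R) (@fps_add R).
Proof. by move=> s; apply: fpsP => n; rewrite fcoef_fps_add fcoef_fps_zero add0r. Qed.
Lemma fps_addN : left_inverse (fps_zero R) (@fps_opp R) (@fps_add R).
Proof.
by move=> s; apply: fpsP => n; rewrite fcoef_fps_add fcoef_fps_opp fcoef_fps_zero addNr.
Qed.

HB.instance Definition _ :=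
  GRing.isZmodule.Build (fps R) fps_addA fps_addC fps_add0 fps_addN.

Lemma fcoefD s t n : fcoef (s + t) n = fcoef s n + fcoef t n.
Proof. exact: fcoef_fps_add. Qed.
Lemma fcoefN s n : fcoef (- s) n = - fcoef s n.
Proof. exact: fcoef_fps_opp. Qed.
Lemma fcoefB s t n : fcoef (s - t) n = fcoef s n - fcoef t n.
Proof. by rewrite fcoefD fcoefN. Qed.
Lemma fcoef0 n : fcoef (0 : fps R) n = 0.
Proof. exact: fcoef_fps_zero. Qed.

Lemma fcoef_sum (I : Type) (r : seq I) (Pr : pred I) (F : I -> fps R) n :
  fcoef (\sum_(i <- r | Pr i) F i) n = \sum_(i <- r | Pr i) fcoef (F i) n.
Proof. by elim/big_rec2: _ => [|i a b _ <-]; rewrite ?fcoef0 ?fcoefD. Qed.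

Lemma fcoefMn s k n : fcoef (s *+ k) n = fcoef s n *+ k.
Proof. by elim: k => [|k IH]; rewrite ?fcoef0 // !mulrS fcoefD IH. Qed.

End FpsZmod.

HB.lock Definition fps_mul (R : comNzRingType) (s t : fps R) : fps R :=
  Fps (fun n => \sum_(i < n.+1) fcoef s i * fcoef t (n - i)%N).

HB.lock Definition fps_one (R : comNzRingType) : fps R := Fps (fun n => (n == 0%N)%:R).

HB.lock Definition fX (R : comNzRingType) : fps R := Fps (fun n => (n == 1%N)%:R).

Section FpsRing.
Variable R : comNzRingType.
Implicit Types s t u : fps R.

Local Notation fps_mul := (@fps_mul R).
Local Notation fps_one := (fps_one R).
Local Notation fX := (fX R).

Lemma fcoef_fps_mul s t n :
  fcoef (fps_mul s t) n = \sum_(i < n.+1) fcoef s i * fcoef t (n - i)%N.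
Proof. by rewrite unlock. Qed.

Lemma fcoef_fps_one n : fcoef fps_one n = (n == 0%N)%:R.
Proof. by rewrite unlock. Qed.

Lemma fcoef_fX n : fcoef fX n = (n == 1%N)%:R.
Proof. by rewrite unlock. Qed.

(** The n-th coefficient of a product sees only truncations, so the ring axioms are transported from
    polynomials. *)
Definition trunc n s : {poly R} := \poly_(i < n.+1) fcoef s i.

Lemma coef_trunc n s i : (i <= n)%N -> (trunc n s)`_i = fcoef s i.
Proof. by move=> le; rewrite coef_poly ltnS le. Qed.

Lemma coefM_eq n (a a' b b' : {poly R}) :
  (forall i, (i <= n)%N -> a`_i = a'`_i) ->
  (forall i, (i <= n)%N -> b`_i = b'`_i) -> (a * b)`_n = (a' * b')`_n.
Proof.
move=> ha hb; rewrite !coefM; apply: eq_bigr => i _.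
by rewrite ha ?hb ?leq_subr // -ltnS.
Qed.

Lemma fps_mul_trunc m n s t : (m <= n)%N ->
  fcoef (fps_mul s t) m = (trunc n s * trunc n t)`_m.
Proof.
move=> le; rewrite coefM fcoef_fps_mul; apply: eq_bigr => i _.
have lei : (i <= m)%N by rewrite -ltnS.
by rewrite !coef_trunc ?(leq_trans (leq_subr _ _)) // (leq_trans lei).
Qed.

Lemma fps_mulC : commutative fps_mul.
Proof. by move=> s t; apply: fpsP => n; rewrite !(@fps_mul_trunc n n) // mulrC. Qed.

Lemma fps_mulA : associative fps_mul.
Proof.
move=> s t u; apply: fpsP => n; rewrite !(@fps_mul_trunc n n) //.
have E a b c : (trunc n a * trunc n (fps_mul b c))`_n
             = (trunc n a * (trunc n b * trunc n c))`_n.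
  by apply: coefM_eq => // i le; rewrite coef_trunc // (@fps_mul_trunc i n).
by rewrite E [in RHS]mulrC E mulrA mulrC.
Qed.

Lemma fps_mul1 : left_id fps_one fps_mul.
Proof.
move=> s; apply: fpsP => n; rewrite fcoef_fps_mul big_ord_recl fcoef_fps_one mul1r subn0 big1 ?addr0 //.
by move=> i _; rewrite fcoef_fps_one mul0r.
Qed.

Lemma fps_mulDl : left_distributive fps_mul +%R.
Proof.
move=> s t u; apply: fpsP => n; rewrite fcoefD !fcoef_fps_mul -big_split /=.
by apply: eq_bigr => i _; rewrite fcoefD mulrDl.
Qed.

Lemma fps_one_neq0 : fps_one != 0.
Proof.
apply/eqP => /(congr1 (fun s => fcoef s 0)) /eqP.
by rewrite fcoef_fps_one fcoef0 oner_eq0.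
Qed.

HB.instance Definition _ := GRing.Zmodule_isComNzRing.Build (fps R)
  fps_mulA fps_mulC fps_mul1 fps_mulDl fps_one_neq0.

Lemma fcoefM s t n :
  fcoef (s * t) n = \sum_(i < n.+1) fcoef s i * fcoef t (n - i)%N.
Proof. exact: fcoef_fps_mul. Qed.

Lemma fcoef1 n : fcoef (1 : fps R) n = (n == 0%N)%:R.
Proof. exact: fcoef_fps_one. Qed.

Lemma fcoefM0 s t : fcoef (s * t) 0 = fcoef s 0 * fcoef t 0.
Proof. by rewrite fcoefM big_ord1 subn0. Qed.

Lemma fcoefX0 s k : fcoef (s ^+ k) 0 = fcoef s 0 ^+ k.
Proof. by elim: k => [|k IH]; rewrite ?expr0 ?fcoef1 // !exprS fcoefM0 IH. Qed.

Lemma fcoef_nat k n : fcoef (k%:R : fps R) n = if n == 0%N then k%:R else 0.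
Proof. by rewrite fcoefMn fcoef1; case: eqP => // _; rewrite mul0rn. Qed.

Lemma fcoef_natM k s n : fcoef (k%:R * s) n = k%:R * fcoef s n.
Proof. by rewrite !mulr_natl fcoefMn. Qed.

Lemma fcoef_intM (c : int) s n : fcoef (c%:~R * s) n = c%:~R * fcoef s n.
Proof.
case: c => k; first exact: fcoef_natM.
by rewrite NegzE !mulrNz !mulNr fcoefN; congr (- _); apply: fcoef_natM.
Qed.

Lemma fcoefX k n : fcoef (fX ^+ k) n = (n == k)%:R.
Proof.
elim: k n => [|k IH] n; first by rewrite expr0 fcoef1.
rewrite exprS fcoefM; case: n => [|n].
  by rewrite big_ord1 fcoef_fX mul0r.
rewrite 2!big_ord_recl !fcoef_fX /= mul0r add0r mul1r IH subSS subn0 eqSS.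
by rewrite big1 ?addr0 // => i _; rewrite fcoef_fX mul0r.
Qed.

Lemma fcoefXM k s n : fcoef (fX ^+ k * s) n = if (k <= n)%N then fcoef s (n - k) else 0.
Proof.
rewrite fcoefM; case: leqP => le.
  rewrite (bigD1 (Ordinal (le : (k < n.+1)%N))) //= fcoefX eqxx mul1r big1 ?addr0 //.
  by move=> i ik; rewrite fcoefX; move: ik; rewrite -val_eqE /= => /negPf->; rewrite mul0r.
rewrite big1 // => i _; rewrite fcoefX; case: eqP => [e|_]; rewrite ?mul0r //.
by move: (ltn_ord i); rewrite ltnS e leqNgt le.
Qed.

Lemma fps_mulI s t u : GRing.lreg (fcoef s 0) -> s * t = s * u -> t = u.
Proof.
move=> reg; suff Z v : s * v = 0 -> v = 0.
  by move=> e; apply/eqP; rewrite -subr_eq0; apply/eqP/Z; rewrite mulrBr e subrr.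
move=> sv0; apply: fpsP => n; elim/ltn_ind: n => n IH.
have := congr1 (fun s => fcoef s n) sv0; rewrite fcoefM big_ord_recl /= subn0.
rewrite big1 ?addr0 => [|i _].
  by rewrite fcoef0 -[RHS](mulr0 (fcoef s 0)) => /reg.
by rewrite IH ?fcoef0 ?mulr0 //= /bump /=; move: (ltn_ord i); lia.
Qed.

Lemma fps_mulI1 s t u : fcoef s 0 = 1 -> s * t = s * u -> t = u.
Proof. by move=> s0; apply: fps_mulI; rewrite s0; apply: lreg1. Qed.

(** Congruence modulo q^(M+1). It stands in for convergence: an infinite sum is replaced by its
    first M terms, and [eqm_all] removes the truncation at the end. *)
Variant eqm M s t : Prop := Eqm of forall n, (n <= M)%N -> fcoef s n = fcoef t n.

Lemma eqmE M s t n : eqm M s t -> (n <= M)%N -> fcoef s n = fcoef t n.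
Proof. by case=> st /st. Qed.
Lemma eqm_all s t : (forall M, eqm M s t) -> s = t.
Proof. by move=> st; apply: fpsP => n; apply: eqmE (st n) _. Qed.
Lemma eqmxx M s : eqm M s s. Proof. by []. Qed.
Lemma eqm_eq M s t : s = t -> eqm M s t. Proof. by move->. Qed.
Lemma eqm_sym M s t : eqm M s t -> eqm M t s.
Proof. by case=> st; split=> n /st. Qed.
Lemma eqm_trans M t s u : eqm M s t -> eqm M t u -> eqm M s u.
Proof. by case=> st [tu]; split=> n le; rewrite st ?tu. Qed.
Lemma eqmD M s s' t t' : eqm M s s' -> eqm M t t' -> eqm M (s + t) (s' + t').
Proof. by case=> ss [tt]; split=> n le; rewrite !fcoefD ss ?tt. Qed.
Lemma eqmN M s s' : eqm M s s' -> eqm M (- s) (- s').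
Proof. by case=> ss; split=> n le; rewrite !fcoefN ss. Qed.
Lemma eqmB M s s' t t' : eqm M s s' -> eqm M t t' -> eqm M (s - t) (s' - t').
Proof. by move=> ss tt; apply: eqmD => //; apply: eqmN. Qed.
Lemma eqmM M s s' t t' : eqm M s s' -> eqm M t t' -> eqm M (s * t) (s' * t').
Proof.
case=> ss [tt]; split=> n le; rewrite !fcoefM; apply: eq_bigr => i _.
by rewrite ss ?tt ?(leq_trans (leq_subr _ _)) // (leq_trans _ le) // -ltnS.
Qed.
Lemma eqm_sum M (I : eqType) (r : seq I) (Pr : pred I) (F G : I -> fps R) :
  (forall i, i \in r -> Pr i -> eqm M (F i) (G i)) ->
  eqm M (\sum_(i <- r | Pr i) F i) (\sum_(i <- r | Pr i) G i).
Proof.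
move=> FG; rewrite big_seq_cond [X in eqm _ _ X]big_seq_cond.
elim/big_ind2: _ => // [? ? ? ?|i /andP[]]; [exact: eqmD | exact: FG].
Qed.

Definition theta s := Fps (fun n => n%:R * fcoef s n).

Lemma fcoef_theta s n : fcoef (theta s) n = n%:R * fcoef s n. Proof. by []. Qed.

Lemma theta_is_zmod_morphism : zmod_morphism theta.
Proof. by move=> s t; apply: fpsP => n; rewrite fcoefB /= fcoefB mulrBr. Qed.
HB.instance Definition _ :=
  GRing.isZmodMorphism.Build (fps R) (fps R) theta theta_is_zmod_morphism.

Lemma thetaM s t : theta (s * t) = theta s * t + s * theta t.
Proof.
apply: fpsP => n; rewrite fcoef_theta fcoefD !fcoefM big_distrr -big_split /=.
apply: eq_bigr => i _.
have -> : n%:R = i%:R + (n - i)%:R :> R by rewrite -natrD subnKC // -ltnS.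
by move: (_ - _)%:R => a; move: (fcoef t _) => b; rewrite mulrDl mulrA mulrCA.
Qed.

Lemma theta_nat k : theta k%:R = 0.
Proof.
by apply: fpsP => n; rewrite fcoef_theta fcoef_nat fcoef0; case: eqP => [->|]; rewrite ?mul0r ?mulr0.
Qed.

Lemma thetaX s k : theta (s ^+ k) = k%:R * s ^+ k.-1 * theta s.
Proof.
elim: k => [|k IH]; first by rewrite expr0 !mul0r; apply: (theta_nat 1).
rewrite exprS thetaM IH; case: k {IH} => [|k] /=; first by rewrite !expr0; ring.
by rewrite !exprS; ring.
Qed.

Lemma theta_fX : theta fX = fX.
Proof. by apply: fpsP => -[|[|n]]; rewrite fcoef_theta fcoef_fX ?mul0r ?mulr1 ?mulr0. Qed.

Lemma theta_fXn k : theta (fX ^+ k) = k%:R * fX ^+ k.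
Proof.
by apply: fpsP => n; rewrite fcoef_natM fcoef_theta !fcoefX; case: eqP => [->//|_]; rewrite !mulr0.
Qed.

End FpsRing.
Arguments fX {R}.
Arguments eqmxx {R} M s.
Arguments eqm_eq {R} M {s t}.

Definition fps_map (R S : Type) (f : R -> S) (s : fps R) : fps S :=
  Fps (fun n => f (fcoef s n)).

Section FpsMap.
Variables (R S : comNzRingType) (f : {rmorphism R -> S}).

Lemma fps_map_is_zmod_morphism : zmod_morphism (fps_map f).
Proof. by move=> s t; apply: fpsP => n; rewrite fcoefB /= fcoefB rmorphB. Qed.
HB.instance Definition _ :=
  GRing.isZmodMorphism.Build (fps R) (fps S) (fps_map f) fps_map_is_zmod_morphism.

Lemma fps_map_is_monoid_morphism : monoid_morphism (fps_map f).
Proof.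
split; first by apply: fpsP => n; rewrite /= !fcoef1 rmorph_nat.
move=> s t; apply: fpsP => n; rewrite fcoefM /= fcoefM rmorph_sum; apply: eq_bigr => i _.
by rewrite rmorphM.
Qed.
HB.instance Definition _ :=
  GRing.isMonoidMorphism.Build (fps R) (fps S) (fps_map f) fps_map_is_monoid_morphism.

Lemma fps_map_fX : fps_map f fX = fX.
Proof. by apply: fpsP => n; rewrite /= !fcoef_fX rmorph_nat. Qed.

Lemma fps_map_theta s : fps_map f (theta s) = theta (fps_map f s).
Proof. by apply: fpsP => n; rewrite /= rmorphM rmorph_nat. Qed.

End FpsMap.

(** * Ramanujan's identities for Eisenstein series *)

Section Eisenstein.
Local Notation A := (fps int).

(** The expansion of q^a / (1 - q^a) for positive a. *)
Definition geo (a : nat) : A := Fps (fun m => ((0 < m) && (a %| m))%N%:R).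

Lemma geoE a : (0 < a)%N -> (1 - fX ^+ a) * geo a = fX ^+ a.
Proof.
move=> a0; apply: fpsP => m.
rewrite mulrBl mul1r fcoefB fcoefXM fcoefX /=.
case: (leqP a m) => am /=; last first.
  rewrite subr0 (_ : (m == a) = false); last by apply/eqP; lia.
  by case: posnP => //= m0; rewrite gtnNdvd.
rewrite (leq_trans a0 am) subn_gt0 ltn_neqAle am andbT eq_sym /=.
have -> : (a %| m - a)%N = (a %| m)%N by rewrite -{2}(subnK am) dvdn_addl.
by case: eqP => [->|_] /=; rewrite ?dvdnn ?subr0 ?subrr.
Qed.

Lemma geo_reg a (x y : A) : (0 < a)%N -> (1 - fX ^+ a) * x = (1 - fX ^+ a) * y -> x = y.
Proof.
move=> a0; apply: fps_mulI1.
by rewrite fcoefB fcoef1 fcoefX; case: a a0.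
Qed.

(** The addition formula of the hyperbolic cotangent: [1 + 2 * geo a] is (1 + q^a) / (1 - q^a). *)
Lemma geo_geo a b : (0 < a)%N -> (0 < b)%N ->
  geo a * geo b = geo (a + b) * (1 + geo a + geo b).
Proof.
move=> a0 b0; have ab0 : (0 < a + b)%N by rewrite addn_gt0 a0.
apply: (geo_reg a0); apply: (geo_reg b0); apply: (geo_reg ab0).
have := geoE a0; have := geoE b0; have := geoE ab0; rewrite exprD.
move: (fX ^+ a) (fX ^+ b) (geo a) (geo b) (geo (a + b)) => x y f g h eh eg ef.
transitivity ((1 - x * y) * ((1 - x) * f) * ((1 - y) * g)); first by ring.
transitivity (((1 - x * y) * h) *
    ((1 - x) * (1 - y) + ((1 - x) * f) * (1 - y) + (1 - x) * ((1 - y) * g))); last by ring.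
by rewrite eh eg ef; ring.
Qed.

Lemma theta_geo a : (0 < a)%N -> theta (geo a) = a%:R * (geo a + geo a ^+ 2).
Proof.
move=> a0; apply: (geo_reg a0).
have := congr1 (@theta int) (geoE a0).
rewrite thetaM raddfB /= (theta_nat _ 1) theta_fXn sub0r => E.
have {E} -> : (1 - fX ^+ a) * theta (geo a) = a%:R * fX ^+ a * (1 + geo a).
  by move: E => /(canRL (addKr _)) ->; ring.
by rewrite -{1}(geoE a0); ring.
Qed.

Lemma geo_big M a : (M < a)%N -> eqm M (geo a) 0.
Proof.
move=> Ma; split=> n nM; rewrite fcoef0 /=; case: posnP => //= n0.
by rewrite gtnNdvd // (leq_ltn_trans nM).
Qed.

Lemma sum_shift M a (G : nat -> A) : (a <= M)%N ->
  (forall n, (M < n)%N -> eqm M (G n) 0) ->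
  eqm M (\sum_(1 <= b < M.+1) G (a + b)%N) (\sum_(1 <= n < M.+1 | (a < n)%N) G n).
Proof.
move=> aM G0.
have -> : \sum_(1 <= b < M.+1) G (a + b)%N = \sum_(a.+1 <= n < M.+1 + a) G n.
  by rewrite -[a.+1]add1n big_addn addnK; apply: eq_bigr => i _; rewrite addnC.
rewrite (big_cat_nat (n := M.+1)) ?ltnS ?leq_addr //=.
have -> : \sum_(1 <= n < M.+1 | (a < n)%N) G n = \sum_(a.+1 <= n < M.+1) G n.
  rewrite (big_cat_nat (n := a.+1)) //= big_nat_cond big1 ?add0r => [|i]; last by lia.
  by rewrite big_nat_cond [RHS]big_nat; apply: eq_bigl => i; lia.
rewrite -[X in eqm _ _ X]addr0; apply: eqmD => //.
rewrite big_nat; elim/big_ind: _ => // [x y x0 y0|i /andP[iM _]]; last exact: G0.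
by rewrite -[0]addr0; apply: eqmD.
Qed.

(* Expand the sum of [k a b * (geo a * geo b)] by [geo_geo] with [n = a + b]:
   as [k a b = h a n], all products cancel except the squares. *)
Lemma geo_sum_sym M (h k : nat -> nat -> int) :
  (forall x y, h x y = h y x) -> (forall a b, k a b = k b a) ->
  (forall a b, k a b = h a (a + b)%N) ->
  eqm M (\sum_(1 <= a < M.+1) \sum_(1 <= b < M.+1) (k a b - h a b)%:~R * (geo a * geo b))
        (\sum_(1 <= n < M.+1) (\sum_(1 <= a < n) k a (n - a)%N)%:~R * geo n
         - \sum_(1 <= a < M.+1) (h a a)%:~R * geo a ^+ 2).
Proof.
move=> hC kC kh.
pose I := index_iota 1 M.+1.
have inI a : (a \in I) = (0 < a <= M)%N by rewrite mem_index_iota.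
pose Dn : A := \sum_(n <- I) (\sum_(1 <= a < n) k a (n - a)%N)%:~R * geo n.
pose T : A := \sum_(a <- I) \sum_(n <- I | (a < n)%N) (h a n)%:~R * (geo a * geo n).
have tri (X : nat -> nat -> A) : (forall a n, (M < n)%N -> eqm M (X a n) 0) ->
    eqm M (\sum_(a <- I) \sum_(b <- I) (k a b)%:~R * X a (a + b)%N)
          (\sum_(a <- I) \sum_(n <- I | (a < n)%N) (h a n)%:~R * X a n).
  move=> X0; apply: eqm_sum => a; rewrite inI => /andP[a0 aM] _.
  have : eqm M (\sum_(1 <= b < M.+1) (h a (a + b)%N)%:~R * X a (a + b)%N)
     (\sum_(1 <= n < M.+1 | (a < n)%N) (h a n)%:~R * X a n).
    apply: (@sum_shift M a (fun n => (h a n)%:~R * X a n)) => // n Mn.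
    by rewrite -(mulr0 (h a n)%:~R); apply: eqmM => //; apply: X0.
  by under eq_bigr => b _ do rewrite -kh.
have K1 : eqm M (\sum_(a <- I) \sum_(b <- I) (k a b)%:~R * geo (a + b)) Dn.
  apply: (eqm_trans (tri (fun=> geo) _)) => [a n /geo_big //|].
  rewrite /Dn (exchange_big_dep predT) //=.
  apply: eqm_eq; apply: eq_big_seq => n; rewrite inI => /andP[n0 nM].
  rewrite -mulr_suml; congr (_ * _); rewrite raddf_sum /=.
  rewrite /I (big_cat_nat (n := n)) //=; last by rewrite ltnW.
  rewrite [X in _ + X]big_nat_cond [X in _ + X]big1 ?addr0 => [|i]; last by lia.
  rewrite big_nat_cond [RHS]big_nat_cond; apply: eq_big => [i|i /andP[/andP[_ lt] _]].
    by lia.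
  by rewrite kh subnKC // ltnW.
have K2 : eqm M (\sum_(a <- I) \sum_(b <- I) (k a b)%:~R * (geo a * geo (a + b))) T.
  apply: (tri (fun a n => geo a * geo n)) => a n /geo_big E.
  by rewrite -(mulr0 (geo a)); apply: eqmM.
have K3 : \sum_(a <- I) \sum_(b <- I) (h a b)%:~R * (geo a * geo b)
        = T + T + \sum_(a <- I) (h a a)%:~R * geo a ^+ 2.
  have -> : T + T = T + \sum_(a <- I) \sum_(n <- I | (n < a)%N) (h a n)%:~R * (geo a * geo n).
    congr (_ + _); rewrite (exchange_big_dep predT) //=; apply: eq_bigr => n _.
    by apply: eq_bigr => a _; rewrite hC (mulrC (geo a)).
  rewrite -!big_split /=; apply: eq_big_seq => a aI.
  rewrite (bigID (fun n => (a < n)%N)) /= -addrA; congr (_ + _).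
  rewrite (bigID (fun n => (n < a)%N)) /=; congr (_ + _).
    by apply: eq_bigl => n; lia.
  rewrite (eq_bigl (pred1 a)) => [|n]; last by rewrite /=; lia.
  by rewrite -big_filter filter_pred1_uniq ?iota_uniq // big_seq1.
have K4 : \sum_(a <- I) \sum_(b <- I) (k a b)%:~R * (geo a * geo b)
   = \sum_(a <- I) \sum_(b <- I) (k a b)%:~R * geo (a + b)
   + (\sum_(a <- I) \sum_(b <- I) (k a b)%:~R * (geo a * geo (a + b))
   + \sum_(a <- I) \sum_(b <- I) (k a b)%:~R * (geo a * geo (a + b))).
  rewrite [X in _ = _ + (_ + X)]exchange_big /= -!big_split /=.
  apply: eq_big_seq => a; rewrite inI => /andP[a0 _].
  rewrite -!big_split /=; apply: eq_big_seq => b; rewrite inI => /andP[b0 _].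
  by rewrite geo_geo // (kC b a) (addnC b a); ring.
have -> : \sum_(a <- I) \sum_(b <- I) (k a b - h a b)%:~R * (geo a * geo b) =
   \sum_(a <- I) \sum_(b <- I) (k a b)%:~R * (geo a * geo b)
  - \sum_(a <- I) \sum_(b <- I) (h a b)%:~R * (geo a * geo b).
  rewrite -sumrB; apply: eq_bigr => a _; rewrite -sumrB; apply: eq_bigr => b _.
  by rewrite rmorphB /= mulrBl.
rewrite K3 K4.
apply: (@eqm_trans _ _ (Dn + (T + T) - (T + T + \sum_(a <- I) (h a a)%:~R * geo a ^+ 2))).
  by apply: eqmB => //; apply: eqmD => //; apply: eqmD.
by apply: eqm_eq; rewrite /Dn /I; ring.
Qed.

Definition sigser k : A := Fps (fun m => if m == 0%N then 0 else (sigma k m)%:R).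

Lemma sigser_geo M k :
  eqm M (sigser k) (\sum_(1 <= a < M.+1) (a%:R ^+ k)%:~R * geo a).
Proof.
split=> m mM; rewrite fcoef_sum.
under [RHS]eq_bigr => a _ do rewrite fcoef_intM intz /=.
rewrite /=; case: (posnP m) => [->|m0] /=; first by rewrite big1 // => i _; rewrite mulr0.
rewrite /sigma natr_sum.
rewrite [RHS](eq_bigr (fun a => if (a %| m)%N then a%:R ^+ k else 0)) => [|a _]; last first.
  by case: (a %| m)%N; rewrite ?mulr1 ?mulr0.
rewrite -big_mkcond -[RHS]big_filter.
under eq_bigr => a _ do rewrite natrX.
apply: perm_big; apply: uniq_perm; rewrite ?divisors_uniq ?filter_uniq ?iota_uniq //.
move=> d; rewrite mem_filter mem_index_iota -dvdn_divisors //.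
case dm: (d %| m)%N => //=.
by rewrite (dvdn_gt0 m0 dm) ltnS (leq_trans (dvdn_leq m0 dm)).
Qed.

End Eisenstein.

(** * Convolutions of divisor sums and Ramanujan's differential equations *)

Section Ramanujan.
Local Notation A := (fps int).

Lemma fps_int_cancel k (x y : A) : (0 < k)%N -> k%:R * x = k%:R * y -> x = y.
Proof.
move=> k0 e; apply: fpsP => n; have := congr1 (fun s => fcoef s n) e.
by rewrite !fcoef_natM => /mulfI; apply; rewrite pnatr_eq0 -lt0n.
Qed.

Lemma eqm_theta M (x y : A) : eqm M x y -> eqm M (theta x) (theta y).
Proof. by move=> [xy]; split=> n nM; rewrite !fcoef_theta xy. Qed.

Lemma theta_int (c : int) : theta (c%:~R : A) = 0.
Proof.
case: c => k; first exact: (theta_nat _ k).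
by rewrite NegzE mulrNz raddfN /= (theta_nat _ k.+1) oppr0.
Qed.

Lemma natr_int (a : nat) : (a%:R : int)%:~R = a%:R :> A.
Proof. by rewrite natz. Qed.

Lemma theta_sigser M k :
  eqm M (theta (sigser k))
    (\sum_(1 <= a < M.+1) (a%:R ^+ k.+1)%:~R * (geo a + geo a ^+ 2)).
Proof.
apply: (eqm_trans (eqm_theta (@sigser_geo M k))).
rewrite raddf_sum /= big_nat [X in eqm _ _ X]big_nat; apply: eqm_eq.
apply: eq_bigr => a /andP[a0 _].
by rewrite thetaM theta_int mul0r add0r theta_geo // (exprSr _ k) intrM natr_int mulrA.
Qed.

Definition geo_dsum M (g : nat -> nat -> int) : A :=
  \sum_(1 <= a < M.+1) \sum_(1 <= b < M.+1) (g a b)%:~R * (geo a * geo b).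

Lemma geo_dsumD M g g' :
  geo_dsum M g + geo_dsum M g' = geo_dsum M (fun a b => g a b + g' a b).
Proof.
rewrite -big_split /=; apply: eq_bigr => a _; rewrite -big_split /=.
by apply: eq_bigr => b _; rewrite intrD; ring.
Qed.

Lemma geo_dsumZ M (d : nat) g : d%:R * geo_dsum M g = geo_dsum M (fun a b => d%:R * g a b).
Proof.
rewrite big_distrr; apply: eq_bigr => a _; rewrite big_distrr /=.
by apply: eq_bigr => b _; rewrite intrM natr_int; ring.
Qed.

Lemma eq_geo_dsum M g g' : (forall a b, g a b = g' a b) -> geo_dsum M g = geo_dsum M g'.
Proof. by move=> e; apply: eq_bigr => a _; apply: eq_bigr => b _; rewrite e. Qed.

Lemma mul_sigser M (d i j : nat) :
  eqm M (d%:R * (sigser i * sigser j))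
    (geo_dsum M (fun a b => d%:R * (a%:R ^+ i * b%:R ^+ j))).
Proof.
rewrite -geo_dsumZ; apply: eqmM; first exact: eqmxx.
apply: (eqm_trans (eqmM (@sigser_geo M i) (@sigser_geo M j))).
rewrite big_distrl /=; apply: eqm_eq.
apply: eq_bigr => a _; rewrite big_distrr /=; apply: eq_bigr => b _.
by rewrite intrM; ring.
Qed.

Definition geo_sum M (c e : nat -> int) : A :=
  \sum_(1 <= a < M.+1) ((c a)%:~R * geo a + (e a)%:~R * geo a ^+ 2).

Lemma geo_sumD M c e c' e' : geo_sum M c e + geo_sum M c' e' =
  geo_sum M (fun a => c a + c' a) (fun a => e a + e' a).
Proof.
by rewrite -big_split /=; apply: eq_bigr => a _; rewrite !intrD; ring.
Qed.

Lemma geo_sumB M c e c' e' : geo_sum M c e - geo_sum M c' e' =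
  geo_sum M (fun a => c a - c' a) (fun a => e a - e' a).
Proof.
by rewrite -sumrB /=; apply: eq_bigr => a _; rewrite !intrB; ring.
Qed.

Lemma eq_geo_sum M c e c' e' : (forall a, (0 < a)%N -> c a = c' a) -> (forall a, e a = e' a) ->
  geo_sum M c e = geo_sum M c' e'.
Proof.
move=> ec ee; rewrite /geo_sum big_nat [RHS]big_nat.
by apply: eq_bigr => a /andP[a0 _]; rewrite ec // ee.
Qed.

Lemma sigserZ M (d k : nat) :
  eqm M (d%:R * sigser k) (geo_sum M (fun a => d%:R * a%:R ^+ k) (fun=> 0)).
Proof.
apply: (eqm_trans (eqmM (eqmxx M d%:R) (@sigser_geo M k))).
rewrite big_distrr /=; apply: eqm_eq; apply: eq_bigr => a _.
by rewrite intrM natr_int; ring.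
Qed.

Lemma theta_sigserZ M (d k : nat) :
  eqm M (d%:R * theta (sigser k))
    (geo_sum M (fun a => d%:R * a%:R ^+ k.+1) (fun a => d%:R * a%:R ^+ k.+1)).
Proof.
apply: (eqm_trans (eqmM (eqmxx M d%:R) (@theta_sigser M k))).
rewrite big_distrr /=; apply: eqm_eq; apply: eq_bigr => a _.
by rewrite intrM natr_int; ring.
Qed.

(** These forms satisfy k(a,b) = h(a,a+b), as [geo_sum_sym] requires, and so do the powers of [h2]
    and [k2]. The differences produce the wanted products of divisor sums: k2 - h2 = 2ab, k2^2 -
    h2^2 = 4ab(a^2 + b^2), k2^3 - h2^3 = 6a^5 b + 14a^3 b^3 + 6ab^5 and k6 - h6 = 4a^3 b^3. *)
Let h2 (a b : nat) : int := a%:R ^+ 2 - a%:R * b%:R + b%:R ^+ 2.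
Let k2 (a b : nat) : int := a%:R ^+ 2 + a%:R * b%:R + b%:R ^+ 2.
Let h6 (a b : nat) : int := a%:R ^+ 2 * b%:R ^+ 2 * (a%:R - b%:R) ^+ 2.
Let k6 (a b : nat) : int := a%:R ^+ 2 * b%:R ^+ 2 * (a%:R + b%:R) ^+ 2.

Lemma sum_k2 n : (0 < n)%N ->
  6 * (\sum_(1 <= a < n) k2 a (n - a)) = 5 * n%:R ^+ 3 - 6 * n%:R ^+ 2 + n%:R.
Proof.
case: n => // N _; rewrite (eq_big_nat _ _ (F2 := fun a => N.+1%:R ^+ 2 - N.+1%:R * a%:R + a%:R ^+ 2)) => [|a /andP[_ an]]; last first.
  by rewrite /k2 natrB; [ring | exact: ltnW].
(* The occurrence of n in the summand is freed as y, so that the induction moves only the upper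
   bound; the factor 6 clears the denominators of the power sums. The next three lemmas proceed in
   the same way. *)
suff E (y : int) : 6 * \sum_(1 <= a < N.+1) (y ^+ 2 - y * a%:R + a%:R ^+ 2) =
   6 * y ^+ 2 * N%:R - 3 * y * (N%:R ^+ 2 + N%:R) + (2 * N%:R ^+ 3 + 3 * N%:R ^+ 2 + N%:R).
  by rewrite E -natr1; ring.
elim: N => [|N IH]; first by rewrite big_geq //; ring.
by rewrite big_nat_recr //= mulrDr IH -natr1; ring.
Qed.

Lemma sum_k4 n : (0 < n)%N ->
  30 * (\sum_(1 <= a < n) k2 a (n - a) ^+ 2) =
  21 * n%:R ^+ 5 - 30 * n%:R ^+ 4 + 10 * n%:R ^+ 3 - n%:R.
Proof.
case: n => // N _; rewrite (eq_big_nat _ _ (F2 := fun a => (N.+1%:R ^+ 2 - N.+1%:R * a%:R + a%:R ^+ 2) ^+ 2)) => [|a /andP[_ an]]; last first.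
  by rewrite /k2 natrB; [ring | exact: ltnW].
suff E (y : int) : 30 * \sum_(1 <= a < N.+1) (y ^+ 2 - y * a%:R + a%:R ^+ 2) ^+ 2 =
   30 * y ^+ 4 * N%:R - 30 * y ^+ 3 * (N%:R ^+ 2 + N%:R)
   + 15 * y ^+ 2 * (2 * N%:R ^+ 3 + 3 * N%:R ^+ 2 + N%:R)
   - 15 * y * (N%:R ^+ 4 + 2 * N%:R ^+ 3 + N%:R ^+ 2)
   + (6 * N%:R ^+ 5 + 15 * N%:R ^+ 4 + 10 * N%:R ^+ 3 - N%:R).
  by rewrite E -natr1; ring.
elim: N => [|N IH]; first by rewrite big_geq //; ring.
by rewrite big_nat_recr //= mulrDr IH -natr1; ring.
Qed.

Lemma sum_k6 n : (0 < n)%N ->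
  420 * (\sum_(1 <= a < n) k2 a (n - a) ^+ 3) =
  249 * n%:R ^+ 7 - 420 * n%:R ^+ 6 + 210 * n%:R ^+ 5 - 49 * n%:R ^+ 3 + 10 * n%:R.
Proof.
case: n => // N _; rewrite (eq_big_nat _ _ (F2 := fun a => (N.+1%:R ^+ 2 - N.+1%:R * a%:R + a%:R ^+ 2) ^+ 3)) => [|a /andP[_ an]]; last first.
  by rewrite /k2 natrB; [ring | exact: ltnW].
suff E (y : int) : 420 * \sum_(1 <= a < N.+1) (y ^+ 2 - y * a%:R + a%:R ^+ 2) ^+ 3 =
   420 * y ^+ 6 * N%:R - 630 * y ^+ 5 * (N%:R ^+ 2 + N%:R)
   + 420 * y ^+ 4 * (2 * N%:R ^+ 3 + 3 * N%:R ^+ 2 + N%:R)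
   - 735 * y ^+ 3 * (N%:R ^+ 4 + 2 * N%:R ^+ 3 + N%:R ^+ 2)
   + 84 * y ^+ 2 * (6 * N%:R ^+ 5 + 15 * N%:R ^+ 4 + 10 * N%:R ^+ 3 - N%:R)
   - 105 * y * (2 * N%:R ^+ 6 + 6 * N%:R ^+ 5 + 5 * N%:R ^+ 4 - N%:R ^+ 2)
   + 10 * (6 * N%:R ^+ 7 + 21 * N%:R ^+ 6 + 21 * N%:R ^+ 5 - 7 * N%:R ^+ 3 + N%:R).
  by rewrite E -natr1; ring.
elim: N => [|N IH]; first by rewrite big_geq //; ring.
by rewrite big_nat_recr //= mulrDr IH -natr1; ring.
Qed.

Lemma sum_l6 n : (0 < n)%N ->
  30 * (\sum_(1 <= a < n) k6 a (n - a)) = n%:R ^+ 7 - n%:R ^+ 3.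
Proof.
case: n => // N _; rewrite (eq_big_nat _ _ (F2 := fun a => N.+1%:R ^+ 2 * (a%:R ^+ 2 * (N.+1%:R - a%:R) ^+ 2))) => [|a /andP[_ an]]; last first.
  by rewrite /k6 natrB; [ring | exact: ltnW].
suff E (y : int) : 30 * \sum_(1 <= a < N.+1) y ^+ 2 * (a%:R ^+ 2 * (y - a%:R) ^+ 2) =
   y ^+ 2 * (5 * y ^+ 2 * (2 * N%:R ^+ 3 + 3 * N%:R ^+ 2 + N%:R)
   - 15 * y * (N%:R ^+ 4 + 2 * N%:R ^+ 3 + N%:R ^+ 2)
   + (6 * N%:R ^+ 5 + 15 * N%:R ^+ 4 + 10 * N%:R ^+ 3 - N%:R)).
  by rewrite E -natr1; ring.
elim: N => [|N IH]; first by rewrite big_geq //; ring.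
by rewrite big_nat_recr //= mulrDr IH -natr1; ring.
Qed.

(** Once the inner sum of k is a polynomial in n, a double sum of products collapses to single sums
    of [geo] and its square. By [sigser_geo] and [theta_sigser] these are divisor series and their
    theta-derivatives. *)
Lemma geo_sum_closed M d (h k : nat -> nat -> int) (c : nat -> int) :
  (forall x y, h x y = h y x) -> (forall a b, k a b = k b a) ->
  (forall a b, k a b = h a (a + b)%N) ->
  (forall n, (0 < n)%N -> d%:R * (\sum_(1 <= a < n) k a (n - a)%N) = c n) ->
  eqm M (geo_dsum M (fun a b => d%:R * (k a b - h a b)))
        (geo_sum M c (fun n => - (d%:R * h n n))).
Proof.
move=> hC kC kh kc.
have E := @geo_sum_sym M _ _ hC kC kh.
rewrite -geo_dsumZ; apply: (eqm_trans (eqmM (eqmxx M d%:R) E)).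
rewrite -sumrB big_distrr /=; apply: eqm_eq.
rewrite big_nat [RHS]big_nat; apply: eq_bigr => n /andP[n0 _].
by rewrite -kc // mulrNz !intrM natr_int; ring.
Qed.

Lemma convolution_1_1 :
  12 * sigser 1 ^+ 2 = 5 * sigser 3 + sigser 1 - 6 * theta (sigser 1).
Proof.
apply: eqm_all => M.
have K := @geo_sum_closed M 6 h2 k2 _ _ _ _ sum_k2.
have {}K := K ltac:(by move=> x y; rewrite /h2; ring) ltac:(by move=> x y; rewrite /k2; ring)
  ltac:(by move=> x y; rewrite /h2 /k2 natrD; ring).
have e : 12 * sigser 1 ^+ 2 = 12%:R * (sigser 1 * sigser 1) by ring.
apply: (eqm_trans (eqm_eq M e)); apply: (eqm_trans (@mul_sigser M 12 1 1)).
rewrite (eq_geo_dsum M (g' := fun a b => 6%:R * (k2 a b - h2 a b))); last first.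
  by move=> a b; rewrite /h2 /k2; ring.
apply: (eqm_trans K); apply: eqm_sym.
rewrite -[sigser 1 in X in eqm _ (_ + X - _)]mul1r.
apply: (eqm_trans (eqmB (eqmD (@sigserZ M 5 3) (@sigserZ M 1 1)) (@theta_sigserZ M 6 1))).
rewrite geo_sumD geo_sumB; apply: eqm_eq.
by apply: eq_geo_sum => a *; rewrite /h2; ring.
Qed.

Lemma convolution_1_3 :
  240 * (sigser 1 * sigser 3) =
  21 * sigser 5 + 10 * sigser 3 - sigser 1 - 30 * theta (sigser 3).
Proof.
apply: eqm_all => M.
have K := @geo_sum_closed M 30 (fun a b => h2 a b ^+ 2) (fun a b => k2 a b ^+ 2) _ _ _ _ sum_k4.
have {}K := K ltac:(by move=> x y; rewrite /h2; ring) ltac:(by move=> x y; rewrite /k2; ring)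
  ltac:(by move=> x y; rewrite /h2 /k2 natrD; ring).
have e : 240 * (sigser 1 * sigser 3) =
  120%:R * (sigser 1 * sigser 3) + 120%:R * (sigser 3 * sigser 1) by ring.
apply: (eqm_trans (eqm_eq M e)).
apply: (eqm_trans (eqmD (@mul_sigser M 120 1 3) (@mul_sigser M 120 3 1))).
rewrite geo_dsumD (eq_geo_dsum M (g' := fun a b => 30%:R * (k2 a b ^+ 2 - h2 a b ^+ 2))); last first.
  by move=> a b; rewrite /h2 /k2; ring.
apply: (eqm_trans K); apply: eqm_sym.
rewrite -[sigser 1 in X in eqm _ (_ - X - _)]mul1r.
apply: (eqm_trans (eqmB (eqmB (eqmD (@sigserZ M 21 5) (@sigserZ M 10 3))
  (@sigserZ M 1 1)) (@theta_sigserZ M 30 3))).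
rewrite geo_sumD 2!geo_sumB; apply: eqm_eq.
by apply: eq_geo_sum => a *; rewrite /h2; ring.
Qed.

(** Equivalent to E4^2 = E8. *)
Lemma convolution_3_3 : 120 * sigser 3 ^+ 2 = sigser 7 - sigser 3.
Proof.
apply: eqm_all => M.
have K := @geo_sum_closed M 30 h6 k6 _ _ _ _ sum_l6.
have {}K := K ltac:(by move=> x y; rewrite /h6; ring) ltac:(by move=> x y; rewrite /k6; ring)
  ltac:(by move=> x y; rewrite /h6 /k6 natrD; ring).
have e : 120 * sigser 3 ^+ 2 = 120%:R * (sigser 3 * sigser 3) by ring.
apply: (eqm_trans (eqm_eq M e)); apply: (eqm_trans (@mul_sigser M 120 3 3)).
rewrite (eq_geo_dsum M (g' := fun a b => 30%:R * (k6 a b - h6 a b))); last first.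
  by move=> a b; rewrite /h6 /k6; ring.
apply: (eqm_trans K); apply: eqm_sym.
rewrite -[sigser 7]mul1r -[sigser 3]mul1r.
apply: (eqm_trans (eqmB (@sigserZ M 1 7) (@sigserZ M 1 3))).
rewrite geo_sumB; apply: eqm_eq.
by apply: eq_geo_sum => a *; rewrite /h6; ring.
Qed.

Lemma convolution_1_5 :
  5040 * (sigser 1 * sigser 5) + 5880 * sigser 3 ^+ 2 =
  249 * sigser 7 + 210 * sigser 5 - 49 * sigser 3 + 10 * sigser 1
  - 420 * theta (sigser 5).
Proof.
apply: eqm_all => M.
have K := @geo_sum_closed M 420 (fun a b => h2 a b ^+ 3) (fun a b => k2 a b ^+ 3) _ _ _ _ sum_k6.
have {}K := K ltac:(by move=> x y; rewrite /h2; ring) ltac:(by move=> x y; rewrite /k2; ring)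
  ltac:(by move=> x y; rewrite /h2 /k2 natrD; ring).
have e : 5040 * (sigser 1 * sigser 5) + 5880 * sigser 3 ^+ 2 =
  2520%:R * (sigser 1 * sigser 5) + 2520%:R * (sigser 5 * sigser 1)
  + 5880%:R * (sigser 3 * sigser 3) by ring.
apply: (eqm_trans (eqm_eq M e)).
apply: (eqm_trans (eqmD (eqmD (@mul_sigser M 2520 1 5) (@mul_sigser M 2520 5 1))
   (@mul_sigser M 5880 3 3))).
rewrite 2!geo_dsumD (eq_geo_dsum M (g' := fun a b => 420%:R * (k2 a b ^+ 3 - h2 a b ^+ 3))); last first.
  by move=> a b; rewrite /h2 /k2; ring.
apply: (eqm_trans K); apply: eqm_sym.
apply: (eqm_trans (eqmB (eqmD (eqmB (eqmD (@sigserZ M 249 7) (@sigserZ M 210 5))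
  (@sigserZ M 49 3)) (@sigserZ M 10 1)) (@theta_sigserZ M 420 5))).
rewrite geo_sumD geo_sumB geo_sumD geo_sumB; apply: eqm_eq.
by apply: eq_geo_sum => a *; rewrite /h2; ring.
Qed.

Definition eisP : A := 1 - 24 * sigser 1.
Definition eisQ : A := 1 + 240 * sigser 3.
Definition eisR : A := 1 - 504 * sigser 5.

Lemma theta_eisP : 12 * theta eisP = eisP ^+ 2 - eisQ.
Proof.
have := convolution_1_1; rewrite /eisP /eisQ raddfB /= thetaM (theta_nat _ 1) (theta_nat _ 24).
move: (theta _) => t; move: (sigser 1) (sigser 3) => s1 s3 E.
by apply: (lin_comb (c := - 48) E); ring.
Qed.

Lemma theta_eisQ : 3 * theta eisQ = eisP * eisQ - eisR.
Proof.
have := convolution_1_3; rewrite /eisP /eisQ /eisR raddfD /= thetaM (theta_nat _ 1) (theta_nat _ 240).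
move: (theta _) => t; move: (sigser 1) (sigser 3) (sigser 5) => s1 s3 s5 E.
by apply: (lin_comb (c := 24) E); ring.
Qed.

Lemma theta_eisR : 2 * theta eisR = eisP * eisR - eisQ ^+ 2.
Proof.
(* After multiplication by 5 the coefficient of [theta (sigser 5)] is -5040 = -12 * 420, which makes
   the cofactor 12 of [convolution_1_5] integral. The square of [sigser 3] in that identity is then
   matched through [convolution_3_3]. *)
apply: (@fps_int_cancel 5) => //.
have := convolution_1_5; have := convolution_3_3.
rewrite /eisP /eisQ /eisR raddfB /= thetaM (theta_nat _ 1) (theta_nat _ 504).
move: (theta _) => t; move: (sigser 1) (sigser 3) (sigser 5) (sigser 7) => s1 s3 s5 s7 E F.
have {}F := esym F; apply: (lin_comb (c := 12) F).
have -> : s7 = 120 * s3 ^+ 2 + s3 by rewrite E; ring.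
ring.
Qed.

End Ramanujan.

(** * The product formula for Delta and E4^3 - E6^2 = 1728 Delta *)

Section Discriminant.
Local Notation A := (fps int).

Definition fps_of_poly (R : nzRingType) (f : {poly R}) : fps R := Fps (fun n => f`_n).

Lemma fps_of_polyM (R : comNzRingType) (f g : {poly R}) :
  fps_of_poly (f * g) = fps_of_poly f * fps_of_poly g.
Proof. by apply: fpsP => n; rewrite /= coefM fcoefM. Qed.

Definition delta_unit : A := Fps Delta_over_q.

Definition delta_part M : A := \prod_(1 <= k < M.+1) (1 - fX ^+ k) ^+ 24.

Lemma fps_of_poly_delta M :
  fps_of_poly (\prod_(1 <= k < M.+1) (1 - 'X^k : {poly int}) ^+ 24) = delta_part M.
Proof.
have f1 : fps_of_poly (1 : {poly int}) = 1 by apply: fpsP => n; rewrite fcoef1 /= coef1.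
have fE k : fps_of_poly (1 - 'X^k : {poly int}) = 1 - fX ^+ k.
  by apply: fpsP => n; rewrite fcoefB fcoef1 fcoefX /= coefB coef1 coefXn.
have fpow (f : {poly int}) n : fps_of_poly (f ^+ n) = fps_of_poly f ^+ n.
  by elim: n => [|n IH]; rewrite ?expr0 // !exprS fps_of_polyM IH.
rewrite /delta_part; elim/big_rec2: _ => // k x y _ <-.
by rewrite fps_of_polyM fpow fE.
Qed.

Lemma delta_unit_part M : eqm M delta_unit (delta_part M).
Proof.
split=> n nM; rewrite /= /Delta_over_q.
have -> : (\prod_(1 <= k < n.+1) (1 - 'X^k : {poly int}) ^+ 24)`_n = fcoef (delta_part n) n.
  by rewrite -fps_of_poly_delta.
rewrite /delta_part (big_cat_nat (n := n.+1) (p := M.+1)) //=.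
set a := \prod_(1 <= k < n.+1) _.
suff E : eqm n 1 (\prod_(n.+1 <= k < M.+1) (1 - fX ^+ k) ^+ 24 : A).
  by rewrite -[in LHS](mulr1 a); apply: (eqmE (eqmM (eqmxx n a) E)).
rewrite big_nat; elim/big_ind: _ => // [x y x1 y1|k /andP[nk _]].
  by rewrite -[1]mulr1; apply: eqmM.
have E : eqm n 1 (1 - fX ^+ k : A).
  split=> i ile; rewrite fcoefB fcoefX (_ : (i == k) = false) ?subr0 //.
  by apply/eqP; lia.
by elim: 24%N => // j /(eqmM E); rewrite mulr1 exprS.
Qed.

Lemma theta_delta_part M :
  theta (delta_part M) = - 24 * (\sum_(1 <= a < M.+1) a%:R * geo a) * delta_part M.
Proof.
elim: M => [|M IH].
  by rewrite /delta_part !big_geq // mulr0 mul0r; apply: (theta_nat _ 1).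
rewrite /delta_part big_nat_recr //= -/(delta_part M) [in RHS]big_nat_recr //=.
rewrite thetaM IH thetaX raddfB /= (theta_nat _ 1) theta_fXn /=.
have := @geoE M.+1 isT; move: (fX ^+ M.+1) (geo M.+1) (\sum_(1 <= i < M.+1) _) => x g s E.
move: (delta_part M) => d.
by apply: (lin_comb (c := 24 * M.+1%:R * d * (1 - x) ^+ 23) E); ring.
Qed.

(** The logarithmic derivative of the product is -24 times the first divisor series; P - 1 replaces
    the usual P because the factor q of Delta has been removed. *)
Lemma theta_delta_unit : theta delta_unit = (eisP - 1) * delta_unit.
Proof.
apply: eqm_all => M; apply: (eqm_trans (eqm_theta (delta_unit_part M))).
rewrite theta_delta_part; apply: eqm_sym.
rewrite (_ : eisP - 1 = - 24 * sigser 1); last by rewrite /eisP; ring.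
apply: eqmM (delta_unit_part M); apply: eqmM; first exact: eqmxx.
apply: (eqm_trans (@sigser_geo M 1)); apply: eqm_eq.
by apply: eq_bigr => a _; rewrite expr1 natr_int.
Qed.

Lemma delta_unit0 : fcoef delta_unit 0 = 1.
Proof. by rewrite (eqmE (delta_unit_part 0)) // /delta_part big_geq // fcoef1. Qed.

Lemma eisP0 : fcoef eisP 0 = 1.
Proof. by rewrite /eisP fcoefB fcoef1 fcoef_natM /= mulr0 subr0. Qed.
Lemma eisQ0 : fcoef eisQ 0 = 1.
Proof. by rewrite /eisQ fcoefD fcoef1 fcoef_natM /= mulr0 addr0. Qed.
Lemma eisR0 : fcoef eisR 0 = 1.
Proof. by rewrite /eisR fcoefB fcoef1 fcoef_natM /= mulr0 subr0. Qed.

Lemma sigser_1 k : fcoef (sigser k) 1 = 1.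
Proof. by rewrite (eqmE (@sigser_geo 1 k)) // big_nat1 fcoef_intM intz /= expr1n. Qed.

(* The solutions of [theta y = P y] without constant term are determined by
   their coefficient of q. *)
Lemma theta_eisP_unique (y : A) :
  theta y = eisP * y -> fcoef y 0 = 0 -> fcoef y 1 = 0 -> y = 0.
Proof.
move=> ey y0 y1; apply: fpsP => n; elim/ltn_ind: n => -[|[|n]] IH; rewrite ?fcoef0 //.
have := congr1 (fun s => fcoef s n.+2) ey.
rewrite fcoef_theta fcoefM big_ord_recl [fcoef eisP _]eisP0 subn0 mul1r big1 ?addr0 => [|i _].
  rewrite -natr1 mulrDl mul1r -[RHS]add0r => /addIr /eqP.
  by rewrite mulf_eq0 pnatr_eq0 => /eqP.
rewrite IH ?fcoef0 ?mulr0 //= /bump /=; move: (ltn_ord i); lia.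
Qed.

(** By Ramanujan's equations both sides solve theta y = P y. They have no constant term, and their
    coefficients of q agree since 3 * 240 + 2 * 504 = 1728. *)
Lemma eisQ3_eisR2 : eisQ ^+ 3 - eisR ^+ 2 = 1728 * (fX * delta_unit).
Proof.
apply/eqP; rewrite -subr_eq0; apply/eqP; apply: theta_eisP_unique.
- have tQ := theta_eisQ; have tR := theta_eisR; have tD := theta_delta_unit.
  rewrite raddfB /= raddfB /= 2!thetaX thetaM (theta_nat _ 1728) thetaM theta_fX tD /=.
  transitivity (eisQ ^+ 2 * (3 * theta eisQ) - eisR * (2 * theta eisR)
     - 1728 * (fX * delta_unit + fX * ((eisP - 1) * delta_unit))); first by ring.
  by rewrite tQ tR; ring.
- rewrite !fcoefB fcoef_natM !fcoefX0 eisQ0 eisR0 fcoefM0 fcoef_fX /=; ring.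
- have Q1 : fcoef eisQ 1 = 240 by rewrite /eisQ fcoefD fcoef1 fcoef_natM sigser_1.
  have R1 : fcoef eisR 1 = - 504 by rewrite /eisR fcoefB fcoef1 fcoef_natM sigser_1.
  have M1 (s t : A) : fcoef (s * t) 1 = fcoef s 0 * fcoef t 1 + fcoef s 1 * fcoef t 0.
    by rewrite fcoefM !big_ord_recl big_ord0 addr0.
  have X2 (s : A) : fcoef (s ^+ 2) 1 = 2 * fcoef s 0 * fcoef s 1.
    by rewrite expr2 M1; ring.
  have X3 (s : A) : fcoef (s ^+ 3) 1 = 3 * fcoef s 0 ^+ 2 * fcoef s 1.
    by rewrite exprS M1 X2 fcoefX0; ring.
  rewrite !fcoefB fcoef_natM X2 X3 Q1 R1 eisQ0 eisR0 M1 delta_unit0 !fcoef_fX /=; ring.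
Qed.

End Discriminant.

(** * The Tate curve *)

HB.lock Definition fps_const (S : zmodType) (c : S) : fps S :=
  Fps (fun n => if n == 0%N then c else 0).

Lemma fcoef_const (S : zmodType) (c : S) n :
  fcoef (fps_const c) n = if n == 0%N then c else 0.
Proof. by rewrite unlock. Qed.

Section Bilateral.
Variable R : comNzRingType.
Local Notation A := (fps R).
Local Notation B := (fps (fps R)).
Implicit Types (x y : B) (s t : A).

Lemma fcoef_constM (S : comNzRingType) (c : S) (s : fps S) n :
  fcoef (fps_const c * s) n = c * fcoef s n.
Proof.
by rewrite fcoefM big_ord_recl fcoef_const subn0 big1 ?addr0 // => i _; rewrite fcoef_const mul0r.
Qed.

Lemma fcoef_const_expM (S : comNzRingType) (c : S) (s : fps S) k n :
  fcoef (fps_const c ^+ k * s) n = c ^+ k * fcoef s n.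
Proof.
elim: k s => [|k IH] s; first by rewrite !expr0 !mul1r.
by rewrite !exprSr -!mulrA IH fcoef_constM.
Qed.

(* A Laurent series in u converging for |q| < |u| < 1/|q| is a power series in
   u and v = q/u; the coefficient of u^a v^b is [bcoef x a b]. *)
Definition bcoef x a b : R := fcoef (fcoef x a) b.

Definition bU : B := fX.
Definition bV : B := fps_const fX.

(* The embedding [q = u v]. *)
Definition biota s : B := Fps (fun a => Fps (fun b => if a == b then fcoef s a else 0)).

Lemma bcoefP x y : (forall a b, bcoef x a b = bcoef y a b) -> x = y.
Proof. by move=> xy; apply: fpsP => a; apply: fpsP => b; apply: xy. Qed.

Lemma bcoefD x y a b : bcoef (x + y) a b = bcoef x a b + bcoef y a b.
Proof. by rewrite /bcoef !fcoefD. Qed.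
Lemma bcoefB x y a b : bcoef (x - y) a b = bcoef x a b - bcoef y a b.
Proof. by rewrite /bcoef !fcoefB. Qed.
Lemma bcoef0 a b : bcoef 0 a b = 0.
Proof. by rewrite /bcoef !fcoef0. Qed.

Lemma bcoefM x y a b : bcoef (x * y) a b =
  \sum_(i < a.+1) \sum_(j < b.+1) bcoef x i j * bcoef y (a - i) (b - j).
Proof.
rewrite /bcoef fcoefM fcoef_sum; apply: eq_bigr => i _.
by rewrite fcoefM.
Qed.

Lemma bcoef_sum (I : Type) (r : seq I) (Pr : pred I) (F : I -> B) a b :
  bcoef (\sum_(i <- r | Pr i) F i) a b = \sum_(i <- r | Pr i) bcoef (F i) a b.
Proof. by rewrite /bcoef !fcoef_sum. Qed.

Lemma bcoef_natM k x a b : bcoef (k%:R * x) a b = k%:R * bcoef x a b.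
Proof. by rewrite /bcoef fcoef_natM fcoef_natM. Qed.

Lemma bcoefUM k x a b : bcoef (bU ^+ k * x) a b = if (k <= a)%N then bcoef x (a - k) b else 0.
Proof. by rewrite /bcoef fcoefXM; case: ifP => _; rewrite ?fcoef0. Qed.

Lemma bcoefVM k x a b : bcoef (bV ^+ k * x) a b = if (k <= b)%N then bcoef x a (b - k) else 0.
Proof. by rewrite /bcoef fcoef_const_expM fcoefXM. Qed.

Lemma bcoef1 a b : bcoef 1 a b = ((a == 0%N) && (b == 0%N))%:R.
Proof. by rewrite /bcoef fcoef1; case: a => [|a] /=; rewrite ?fcoef1 ?fcoef0. Qed.

Lemma bcoef_UV i j a b : bcoef (bU ^+ i * bV ^+ j) a b = ((a == i) && (b == j))%:R.
Proof.
rewrite bcoefUM -[bV ^+ j]mulr1 bcoefVM bcoef1.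
case: leqP => ia; last by rewrite (_ : (a == i) = false) //; apply/eqP; lia.
case: leqP => jb; last by rewrite (_ : (b == j) = false) ?andbF //; apply/eqP; lia.
by congr (_%:R); congr (nat_of_bool (_ && _)); apply/eqP/eqP; lia.
Qed.

Lemma bcoef_iota s a b : bcoef (biota s) a b = if a == b then fcoef s a else 0.
Proof. by []. Qed.

Lemma bcoef_iotaM s x a b : bcoef (biota s * x) a b =
  \sum_(i < (minn a b).+1) fcoef s i * bcoef x (a - i) (b - i).
Proof.
rewrite bcoefM.
rewrite -(big_mkord xpredT (fun i => \sum_(j < b.+1) bcoef (biota s) i j * bcoef x (a - i) (b - j))).
rewrite -(big_mkord xpredT (fun i => fcoef s i * bcoef x (a - i) (b - i))).
rewrite (big_cat_nat (n := (minn a b).+1)) ?ltnS ?geq_minl //= [X in _ + X]big_nat.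
rewrite [X in _ + X]big1 ?addr0 => [|i /andP[mi ia]].
  rewrite big_nat [RHS]big_nat; apply: eq_bigr => i /andP[_ im].
  have ib : (i < b.+1)%N by move: im; rewrite !ltnS leq_min => /andP[].
  rewrite (bigD1 (Ordinal ib)) //= bcoef_iota eqxx big1 ?addr0 // => j.
  by rewrite -val_eqE bcoef_iota eq_sym /= => /negPf ->; rewrite mul0r.
by apply: big1 => j _; rewrite bcoef_iota; case: eqP => [e|_]; rewrite ?mul0r //;
  move: (ltn_ord j); lia.
Qed.

Lemma biota_is_zmod_morphism : zmod_morphism biota.
Proof.
by move=> s t; apply: bcoefP => a b; rewrite bcoefB !bcoef_iota fcoefB; case: eqP; rewrite ?subrr.
Qed.
HB.instance Definition _ :=
  GRing.isZmodMorphism.Build A B biota biota_is_zmod_morphism.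

Lemma biota_is_monoid_morphism : monoid_morphism biota.
Proof.
split.
  apply: bcoefP => a b; rewrite bcoef_iota bcoef1 fcoef1.
  by case: a b => [|a] [|b] //=; case: eqP.
move=> s t; apply: bcoefP => a b; rewrite bcoef_iotaM bcoef_iota.
case: eqP => [<-|ab].
  by rewrite minnn fcoefM; apply: eq_bigr => i _; rewrite bcoef_iota eqxx.
rewrite big1 // => i _; rewrite bcoef_iota; case: eqP => [e|_]; rewrite ?mulr0 //.
by move: (ltn_ord i); lia.
Qed.
HB.instance Definition _ :=
  GRing.isMonoidMorphism.Build A B biota biota_is_monoid_morphism.

Lemma biota_fX k : biota (fX ^+ k) = bU ^+ k * bV ^+ k.
Proof.
apply: bcoefP => a b; rewrite bcoef_UV bcoef_iota fcoefX.
by case: (eqVneq a b) => [<-|ab]; rewrite ?andbb //; case: andP => // -[/eqP e1 /eqP e2]; rewrite e1 e2 eqxx in ab.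
Qed.

(** The derivation u d/du with q held constant: u^a v^b is u^(a-b) q^b. *)
Definition bD x : B := Fps (fun a => Fps (fun b => (a%:R - b%:R) * bcoef x a b)).

Lemma bcoef_D x a b : bcoef (bD x) a b = (a%:R - b%:R) * bcoef x a b.
Proof. by []. Qed.

Lemma bD_is_zmod_morphism : zmod_morphism bD.
Proof. by move=> x y; apply: bcoefP => a b; rewrite bcoefB !bcoef_D bcoefB mulrBr. Qed.
HB.instance Definition _ :=
  GRing.isZmodMorphism.Build B B bD bD_is_zmod_morphism.

Lemma bDM x y : bD (x * y) = bD x * y + x * bD y.
Proof.
apply: bcoefP => a b; rewrite bcoefD bcoef_D !bcoefM mulr_sumr -big_split /=.
apply: eq_bigr => i _; rewrite mulr_sumr -big_split /=; apply: eq_bigr => j _.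
rewrite !bcoef_D.
have -> : a%:R = i%:R + (a - i)%:R :> R by rewrite -natrD subnKC // -ltnS.
have -> : b%:R = j%:R + (b - j)%:R :> R by rewrite -natrD subnKC // -ltnS.
move: (a - i)%:R (b - j)%:R (bcoef x i j) (bcoef y _ _) => m n X Y.
by ring.
Qed.

Lemma bD_iota s : bD (biota s) = 0.
Proof.
apply: bcoefP => a b; rewrite bcoef_D bcoef_iota bcoef0; case: eqP => [->|_].
  by rewrite subrr mul0r.
by rewrite mulr0.
Qed.

Lemma bD_iotaM s x : bD (biota s * x) = biota s * bD x.
Proof. by rewrite bDM bD_iota mul0r add0r. Qed.

Lemma bD_natM k x : bD (k%:R * x) = k%:R * bD x.
Proof. by rewrite !mulr_natl raddfMn. Qed.

Lemma bDX x k : bD (x ^+ k) = k%:R * x ^+ k.-1 * bD x.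
Proof.
elim: k => [|k IH].
  by rewrite expr0 !mul0r -[1](rmorph1 biota) bD_iota.
rewrite exprS bDM IH; case: k {IH} => [|k] /=; first by rewrite !expr0; ring.
by rewrite !exprS; ring.
Qed.

Lemma bD_UV i j : bD (bU ^+ i * bV ^+ j) = (i%:R - j%:R) * (bU ^+ i * bV ^+ j).
Proof.
apply: bcoefP => a b; rewrite bcoef_D [in RHS]mulrBl bcoefB !bcoef_natM bcoef_UV.
by case: andP => [[/eqP-> /eqP->]|_]; rewrite ?mulr1 ?mulr0 ?subrr.
Qed.

(** The coefficient of u^0, as a series in q. It is linear over the series in q and kills every
    derivative, which permits integration by parts. *)
Definition bdiag x : A := Fps (fun m => bcoef x m m).

Lemma bdiag_is_zmod_morphism : zmod_morphism bdiag.
Proof. by move=> x y; apply: fpsP => m; rewrite fcoefB /= bcoefB. Qed.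
HB.instance Definition _ :=
  GRing.isZmodMorphism.Build B A bdiag bdiag_is_zmod_morphism.

Lemma bdiag_iotaM s x : bdiag (biota s * x) = s * bdiag x.
Proof. by apply: fpsP => m; rewrite /= bcoef_iotaM minnn fcoefM. Qed.

Lemma bdiag_iota s : bdiag (biota s) = s.
Proof. by apply: fpsP => m; rewrite /= bcoef_iota eqxx. Qed.

Lemma bdiag_D x : bdiag (bD x) = 0.
Proof. by apply: fpsP => m; rewrite /= bcoef_D subrr mul0r fcoef0. Qed.

Lemma bdiag_UV i j : bdiag (bU ^+ i * bV ^+ j) = if i == j then fX ^+ i else 0.
Proof.
apply: fpsP => m; rewrite /= bcoef_UV.
case: (eqVneq i j) => [->|ij]; first by rewrite fcoefX andbb.
rewrite fcoef0; case: andP => // -[/eqP e1 /eqP e2].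
by rewrite -e1 -e2 eqxx in ij.
Qed.

Variant beq M x y : Prop :=
  Beq of forall a b, (a <= M)%N -> (b <= M)%N -> bcoef x a b = bcoef y a b.

Lemma beqE M x y a b : beq M x y -> (a <= M)%N -> (b <= M)%N -> bcoef x a b = bcoef y a b.
Proof. by case=> xy; apply: xy. Qed.
Lemma beq_all x y : (forall M, beq M x y) -> x = y.
Proof.
by move=> xy; apply: bcoefP => a b; apply: beqE (xy (maxn a b)) _ _; rewrite ?leq_maxl ?leq_maxr.
Qed.
Lemma beq_eq M x y : x = y -> beq M x y. Proof. by move->. Qed.
Lemma beqxx M x : beq M x x. Proof. exact: beq_eq. Qed.
Lemma beq_sym M x y : beq M x y -> beq M y x.
Proof. by case=> xy; split=> a b aM bM; rewrite xy. Qed.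
Lemma beq_trans M y x z : beq M x y -> beq M y z -> beq M x z.
Proof. by case=> xy [yz]; split=> a b aM bM; rewrite xy ?yz. Qed.
Lemma beqD M x x' y y' : beq M x x' -> beq M y y' -> beq M (x + y) (x' + y').
Proof. by case=> xx [yy]; split=> a b aM bM; rewrite !bcoefD xx ?yy. Qed.
Lemma beqB M x x' y y' : beq M x x' -> beq M y y' -> beq M (x - y) (x' - y').
Proof. by case=> xx [yy]; split=> a b aM bM; rewrite !bcoefB xx ?yy. Qed.
Lemma beqM M x x' y y' : beq M x x' -> beq M y y' -> beq M (x * y) (x' * y').
Proof.
case=> xx [yy]; split=> a b aM bM; rewrite !bcoefM; apply: eq_bigr => i _.
apply: eq_bigr => j _; have := ltn_ord i; have := ltn_ord j => jb ia.
by rewrite xx ?yy //; lia.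
Qed.
Lemma beq_sum M (I : eqType) (r : seq I) (Pr : pred I) (F G : I -> B) :
  (forall i, i \in r -> Pr i -> beq M (F i) (G i)) ->
  beq M (\sum_(i <- r | Pr i) F i) (\sum_(i <- r | Pr i) G i).
Proof.
move=> FG; rewrite big_seq_cond [X in beq _ _ X]big_seq_cond.
elim/big_ind2: _ => [|? ? ? ?|i /andP[]]; [exact: beqxx | exact: beqD | exact: FG].
Qed.
Lemma beq_iota M s t : eqm M s t -> beq M (biota s) (biota t).
Proof. by case=> st; split=> a b aM bM; rewrite !bcoef_iota; case: eqP => // _; rewrite st. Qed.
Lemma beq_bD M x y : beq M x y -> beq M (bD x) (bD y).
Proof. by case=> xy; split=> a b aM bM; rewrite !bcoef_D xy. Qed.
Lemma eqm_bdiag M x y : beq M x y -> eqm M (bdiag x) (bdiag y).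
Proof. by case=> xy; split=> n nM; rewrite /= xy. Qed.
Lemma beqU0 M n x : (M < n)%N -> beq M (bU ^+ n * x) 0.
Proof. by move=> Mn; split=> a b aM bM; rewrite bcoefUM bcoef0 leqNgt (leq_ltn_trans aM). Qed.
Lemma beqV0 M n x : (M < n)%N -> beq M (bV ^+ n * x) 0.
Proof. by move=> Mn; split=> a b aM bM; rewrite bcoefVM bcoef0 leqNgt (leq_ltn_trans bM). Qed.

End Bilateral.
Arguments bU {R}.
Arguments bV {R}.

Lemma sum_nat_shift (V : zmodType) M a (G : nat -> V) : (a <= M)%N ->
  \sum_(1 <= b < M.+1) G (a + b)%N =
  \sum_(1 <= n < M.+1 | (a < n)%N) G n + \sum_(M.+1 <= n < M.+1 + a) G n.
Proof.
move=> aM.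
have -> : \sum_(1 <= b < M.+1) G (a + b)%N = \sum_(a.+1 <= n < M.+1 + a) G n.
  by rewrite -[a.+1]add1n big_addn addnK; apply: eq_bigr => i _; rewrite addnC.
rewrite (big_cat_nat (n := M.+1)) ?ltnS ?leq_addr //=; congr (_ + _).
rewrite [RHS](big_cat_nat (n := a.+1)) //= [X in _ = X + _]big_nat_cond.
rewrite [X in _ = X + _]big1 ?add0r => [|i]; last by lia.
by rewrite big_nat [RHS]big_nat_cond; apply: eq_bigl => i; lia.
Qed.

Lemma sum_nat_tri (V : zmodType) M (F : nat -> nat -> V) :
  \sum_(1 <= a < M.+1) \sum_(1 <= n < M.+1 | (a < n)%N) F a n =
  \sum_(1 <= n < M.+1) \sum_(1 <= a < n) F a n.
Proof.
rewrite (exchange_big_dep predT) //= big_nat [RHS]big_nat.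
apply: eq_bigr => n /andP[n0 nM].
rewrite (big_cat_nat (n := n)) //=; last by rewrite ltnW.
rewrite [X in _ + X]big_nat_cond [X in _ + X]big1 ?addr0 => [|i]; last by lia.
by rewrite big_nat_cond [RHS]big_nat; apply: eq_bigl => i; lia.
Qed.

Lemma sum_nat_sym (V : zmodType) M (F : nat -> nat -> V) :
  (forall a b, F a b = F b a) ->
  \sum_(1 <= a < M.+1) \sum_(1 <= b < M.+1) F a b =
  (\sum_(1 <= a < M.+1) \sum_(1 <= n < M.+1 | (a < n)%N) F a n) *+ 2
  + \sum_(1 <= a < M.+1) F a a.
Proof.
move=> FC; set T := (X in X *+ 2).
have -> : T *+ 2 = T + \sum_(1 <= a < M.+1) \sum_(1 <= n < M.+1 | (n < a)%N) F a n.
  rewrite mulr2n; congr (_ + _); rewrite /T (exchange_big_dep predT) //=.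
  by apply: eq_bigr => n _; apply: eq_bigr => a _; rewrite FC.
rewrite -!big_split /=; apply: eq_big_seq => a aI.
rewrite (bigID (fun n => (a < n)%N)) /= -addrA; congr (_ + _).
rewrite (bigID (fun n => (n < a)%N)) /=; congr (_ + _).
  by apply: eq_bigl => n; lia.
rewrite (eq_bigl (pred1 a)) => [|n]; last by rewrite /=; lia.
by rewrite -big_filter filter_pred1_uniq ?iota_uniq // big_seq1.
Qed.

(** * Squares of symmetric Laurent series in u *)

Section BilateralSquare.
Variable R : comNzRingType.
Local Notation A := (fps R).
Local Notation B := (fps (fps R)).
Local Notation U k := (bU ^+ k + bV ^+ k : B).

Lemma bcoef_U_iota n (s : A) a b :
  bcoef (U n * biota s) a b =
  (if (n <= a)%N && ((a - n)%N == b) then fcoef s b else 0) +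
  (if (n <= b)%N && ((b - n)%N == a) then fcoef s a else 0).
Proof.
rewrite mulrDl bcoefD bcoefUM bcoefVM !bcoef_iota.
congr (_ + _); first by case: leqP => // _ /=; case: eqP => // ->.
by case: leqP => // _ /=; rewrite eq_sym.
Qed.

Lemma beq_lambert_sum (w : B) (s : A) (c : nat -> A) M :
  (forall a b, bcoef w a b = if a == b then fcoef s a
    else 12 * (((a - b) + (b - a))%N%:R * ((a - b) + (b - a) %| b)%N%:R)) ->
  (forall n m, (0 < n)%N -> fcoef (c n) m = n%:R * (n %| m)%N%:R) ->
  beq M w (biota s + 12 * \sum_(1 <= n < M.+1) U n * biota (c n)).
Proof.
move=> wE cE; split=> a b aM bM; rewrite wE bcoefD bcoef_natM bcoef_sum bcoef_iota.
case: eqP => [<-|/eqP ab].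
  rewrite big_nat big1 ?mulr0 ?addr0 // => n /andP[n0 _].
  rewrite bcoef_U_iota.
  by rewrite (_ : (n <= a)%N && ((a - n)%N == a) = false) ?addr0 //; lia.
set d := (a - b + (b - a))%N; rewrite add0r; congr (_ * _).
have d0 : (0 < d)%N by rewrite /d; lia.
rewrite (bigD1_seq d) ?iota_uniq //=; last by rewrite mem_index_iota /d; lia.
rewrite bcoef_U_iota big_nat_cond [X in _ = _ + X]big1 => [|n].
  rewrite !cE // addr0; case: (ltngtP a b) => ba.
  - rewrite (_ : (d <= a)%N && ((a - d)%N == b) = false); last by rewrite /d; lia.
    rewrite (_ : (d <= b)%N && ((b - d)%N == a) = true); last by rewrite /d; lia.
    rewrite add0r; congr (_ * (nat_of_bool _)%:R).
    by rewrite -(@dvdn_addr d d a) ?dvdnn //; congr (_ %| _)%N; rewrite /d; lia.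
  - rewrite (_ : (d <= a)%N && ((a - d)%N == b) = true); last by rewrite /d; lia.
    by rewrite (_ : (d <= b)%N && ((b - d)%N == a) = false) ?addr0 // /d; lia.
  - by rewrite ba eqxx in ab.
move=> /andP[/andP[n0 _] nd]; rewrite bcoef_U_iota.
rewrite (_ : (n <= a)%N && ((a - n)%N == b) = false); last by apply/negP; rewrite /d in nd; lia.
rewrite (_ : (n <= b)%N && ((b - n)%N == a) = false) ?addr0 //; apply/negP; rewrite /d in nd; lia.
Qed.

(** The products u^n u^m and v^n v^m give the finite convolution. In a mixed product u^n v^m the
    smaller exponent turns into a power of q, since u v = q; this gives the tail, counted twice by
    symmetry, and for n = m the constant term in u. *)
Lemma sum_U_sqr M (c : nat -> A) :
  beq M ((\sum_(1 <= n < M.+1) U n * biota (c n)) ^+ 2)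
    (\sum_(1 <= k < M.+1) U k * biota (\sum_(1 <= i < k) c i * c (k - i)%N
        + 2 * \sum_(1 <= m < M.+1) fX ^+ m * (c m * c (m + k)%N))
     + biota (2 * \sum_(1 <= n < M.+1) fX ^+ n * c n ^+ 2)).
Proof.
pose Z n m : B := bU ^+ n * bV ^+ m + bU ^+ m * bV ^+ n.
pose H n m : B := biota (c n * c m).
have -> : (\sum_(1 <= n < M.+1) U n * biota (c n)) ^+ 2 =
    \sum_(1 <= n < M.+1) \sum_(1 <= m < M.+1) U (n + m) * H n m
  + \sum_(1 <= n < M.+1) \sum_(1 <= m < M.+1) Z n m * H n m.
  rewrite expr2 big_distrl -big_split /=; apply: eq_bigr => n _.
  rewrite big_distrr -big_split /=; apply: eq_bigr => m _.
  by rewrite /H /Z rmorphM /= !exprD; ring.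
have P1 : beq M (\sum_(1 <= n < M.+1) \sum_(1 <= m < M.+1) U (n + m) * H n m)
   (\sum_(1 <= k < M.+1) U k * biota (\sum_(1 <= i < k) c i * c (k - i)%N)).
  apply: (@beq_trans _ _ (\sum_(1 <= n < M.+1) \sum_(1 <= k < M.+1 | (n < k)%N) U k * H n (k - n)%N)).
    apply: beq_sum => n; rewrite mem_index_iota => /andP[n0 nM] _.
    have := @sum_nat_shift _ M n (fun k => U k * H n (k - n)%N) nM.
    under eq_bigr => b _ do rewrite addKn.
    move=> ->; rewrite -[X in beq _ _ X]addr0; apply: beqD; first exact: beqxx.
    rewrite big_nat; elim/big_ind: _ => [|x y x0 y0|k /andP[Mk _]]; first exact: beqxx.
      by rewrite -[0]addr0; apply: beqD.
    rewrite mulrDl -[0]addr0; apply: beqD; [exact: beqU0 | exact: beqV0].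
  rewrite sum_nat_tri; apply: beq_eq; apply: eq_bigr => k _.
  by rewrite -mulr_sumr raddf_sum.
have P2 : beq M (\sum_(1 <= m < M.+1) \sum_(1 <= n < M.+1 | (m < n)%N) Z n m * H n m)
   (\sum_(1 <= k < M.+1) U k * biota (\sum_(1 <= m < M.+1) fX ^+ m * (c m * c (m + k)%N))).
  apply: beq_sym.
  apply: (@beq_trans _ _ (\sum_(1 <= m < M.+1) \sum_(1 <= k < M.+1) Z (m + k)%N m * H (m + k)%N m)).
    apply: beq_eq; rewrite exchange_big /=; apply: eq_bigr => k _.
    rewrite raddf_sum big_distrr /=; apply: eq_bigr => m _.
    by rewrite rmorphM /= biota_fX /Z /H (mulrC (c m)) !exprD; ring.
  apply: beq_sum => m; rewrite mem_index_iota => /andP[m0 mM] _.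
  rewrite (@sum_nat_shift _ M m (fun n => Z n m * H n m) mM).
  rewrite -[X in beq _ _ X]addr0; apply: beqD; first exact: beqxx.
  rewrite big_nat; elim/big_ind: _ => [|x y x0 y0|k /andP[Mk _]]; first exact: beqxx.
    by rewrite -[0]addr0; apply: beqD.
  rewrite /Z mulrDl -[0]addr0; apply: beqD.
    by rewrite -mulrA; apply: beqU0.
  by rewrite (mulrC (bU ^+ m)) -mulrA; apply: beqV0.
rewrite [X in beq _ (_ + X)]sum_nat_sym; last first.
  by move=> a b; rewrite /Z /H addrC (mulrC (c a)).
under [X in beq _ _ (X + _)]eq_bigr => k _ do rewrite rmorphD mulrDr.
rewrite big_split /= -[X in beq _ _ X]addrA; apply: beqD; first exact: P1.
apply: beqD.
  rewrite mulr2n; apply: (beq_trans (y := (\sum_(1 <= k < M.+1) U k *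
    biota (\sum_(1 <= m < M.+1) fX ^+ m * (c m * c (m + k)%N))) *+ 2)).
    have P2' : beq M (\sum_(1 <= a < M.+1) \sum_(1 <= n < M.+1 | (a < n)%N) Z a n * H a n)
      (\sum_(1 <= k < M.+1) U k * biota (\sum_(1 <= m < M.+1) fX ^+ m * (c m * c (m + k)%N))).
      apply: (beq_trans _ P2); apply: beq_eq; apply: eq_bigr => a _; apply: eq_bigr => n _.
      by rewrite /Z /H addrC (mulrC (c a)).
    by rewrite mulr2n; apply: beqD.
  apply: beq_eq; rewrite -mulr_natl big_distrr /=; apply: eq_bigr => k _.
  by rewrite rmorphM rmorph_nat; ring.
apply: beq_eq; rewrite rmorphM rmorph_nat raddf_sum big_distrr /=; apply: eq_bigr => n _.
by rewrite rmorphM /= biota_fX /Z /H expr2; ring.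
Qed.

End BilateralSquare.

Section Tate.
Local Notation A := (fps int).
Local Notation B := (fps (fps int)).
Local Notation U k := (bU ^+ k + bV ^+ k : B).

(* n / (1 - q^n) *)
Definition lambert (n : nat) : A := n%:R * (1 + geo n).

(** Truncated subtraction makes [(a - b) + (b - a)] the distance |a - b|. Testing whether it divides
    b is symmetric in a and b, because a and b differ by exactly that distance. *)
Definition tate_coef (s : A) a b : int :=
  if a == b then fcoef s a
  else 12 * (((a - b) + (b - a))%N%:R * ((a - b) + (b - a) %| b)%N%:R).

(* 12 (2 pi i)^-2 times the Weierstrass function: its coefficient of u^n is
   12 n / (1 - q^n) for nonzero n, and E2 for n = 0. *)
Definition tate_w : B := Fps (fun a => Fps (tate_coef eisP a)).

Lemma fcoef_lambert n m : (0 < n)%N -> fcoef (lambert n) m = n%:R * (n %| m)%N%:R.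
Proof.
move=> n0; rewrite fcoef_natM fcoefD fcoef1 /=; congr (_ * _).
by case: m => [|m]; rewrite ?dvdn0 ?addr0 // add0r.
Qed.

Lemma tate_w_sum M :
  beq M tate_w (biota eisP + 12 * \sum_(1 <= n < M.+1) U n * biota (lambert n)).
Proof. by apply: beq_lambert_sum => [a b|n m]; [exact: erefl | exact: fcoef_lambert]. Qed.

End Tate.

(** * The second-order Weierstrass equation of the Tate curve *)

Section TateEquation.
Local Notation A := (fps int).
Local Notation B := (fps (fps int)).
Local Notation U k := (bU ^+ k + bV ^+ k : B).

Lemma fX_geo a : (0 < a)%N -> fX ^+ a * (1 + geo a) = geo a.
Proof. by move=> a0; apply: (lin_comb (c := - 1) (geoE a0)); ring. Qed.

Lemma geo1_geo1 a b : (0 < a)%N -> (0 < b)%N ->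
  (1 + geo a) * (1 + geo b) = (1 + geo (a + b)) * (1 + geo a + geo b).
Proof.
by move=> a0 b0; apply: (lin_comb (c := 1) (geo_geo a0 b0)); ring.
Qed.

Lemma geo_geo1 a b : (0 < a)%N -> (0 < b)%N ->
  geo a * (1 + geo (a + b)) = (1 + geo b) * (geo a - geo (a + b)).
Proof.
by move=> a0 b0; apply: (lin_comb (c := - 1) (geo_geo a0 b0)); ring.
Qed.

Lemma sum_i_kmi k : (0 < k)%N ->
  6 * (\sum_(1 <= i < k) i%:R * (k - i)%N%:R : A) = k%:R ^+ 3 - k%:R.
Proof.
case: k => // N _; rewrite (eq_big_nat _ _ (F2 := fun a => a%:R * (N.+1%:R - a%:R) : A)) => [|a /andP[_ an]]; last first.
  by rewrite natrB //; exact: ltnW.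
suff E (y : A) : 6 * \sum_(1 <= a < N.+1) a%:R * (y - a%:R) =
   3 * y * (N%:R ^+ 2 + N%:R) - (2 * N%:R ^+ 3 + 3 * N%:R ^+ 2 + N%:R).
  by rewrite E -natr1; ring.
elim: N => [|N IH]; first by rewrite big_geq //; ring.
by rewrite big_nat_recr //= mulrDr IH -natr1; ring.
Qed.

(** Reindexing the second half by k leaves the coefficients m(m+k) - (m-k)m = 2km, that is, a
    multiple of [sigser 1]; the terms of index below k are left over as the correction. *)
Lemma lambert_shift M k : (0 < k <= M)%N ->
  eqm M (\sum_(1 <= m < M.+1) (m%:R * (m + k)%N%:R) * (geo m - geo (m + k)))
    (2 * k%:R * sigser 1 - \sum_(1 <= i < k) i%:R * (k - i)%N%:R * geo i).
Proof.
move=> /andP[k0 kM].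
pose G n : A := (n%:R - k%:R) * n%:R * geo n.
have S1 : eqm M (sigser 1) (\sum_(1 <= m < M.+1) m%:R * geo m).
  apply: (eqm_trans (@sigser_geo M 1)); apply: eqm_eq; apply: eq_bigr => m _.
  by rewrite expr1 natr_int.
have -> : \sum_(1 <= m < M.+1) (m%:R * (m + k)%N%:R) * (geo m - geo (m + k)) =
   \sum_(1 <= m < M.+1) (m%:R * (m + k)%N%:R) * geo m - \sum_(1 <= m < M.+1) G (k + m)%N.
  rewrite -sumrB; apply: eq_bigr => m _; rewrite /G (addnC k) natrD; ring.
rewrite (@sum_nat_shift _ M k G kM).
have tail : eqm M (\sum_(M.+1 <= n < M.+1 + k) G n) 0.
  rewrite big_nat; elim/big_ind: _ => [|x y x0 y0|n /andP[Mn _]]; first exact: eqmxx.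
    by rewrite -[0]addr0; apply: eqmD.
  by rewrite -(mulr0 ((n%:R - k%:R) * n%:R : A)); apply: eqmM; [exact: eqmxx | exact: geo_big].
have split : \sum_(1 <= n < M.+1 | (k < n)%N) G n =
    \sum_(1 <= n < M.+1) G n + \sum_(1 <= i < k) i%:R * (k - i)%N%:R * geo i.
  rewrite [X in _ = X + _](bigID (fun n => (k < n)%N)) /= -addrA -[LHS]addr0; congr (_ + _).
  rewrite (big_cat_nat (n := k.+1)) //= [X in _ + X + _]big_nat_cond.
  rewrite [X in _ + X + _]big1 ?addr0; last by move=> i; lia.
  rewrite big_nat_cond (eq_bigl (fun i => (1 <= i < k.+1)%N)); last by move=> i; lia.
  rewrite -big_nat big_nat_recr //= /G subrr !mul0r addr0 -big_split /= big_nat big1 //.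
  by move=> i /andP[_ ik]; rewrite natrB ?(ltnW ik) //; ring.
rewrite split; set S := \sum_(1 <= i < k) _.
apply: (eqm_trans (t := \sum_(1 <= m < M.+1) (m%:R * (m + k)%N%:R) * geo m
    - (\sum_(1 <= n < M.+1) G n + S))).
  apply: eqmB; first exact: eqmxx.
  by rewrite -[X in eqm _ _ X]addr0; apply: eqmD; first exact: eqmxx.
rewrite opprD addrA; apply: eqmB; last exact: eqmxx.
apply: (eqm_trans _ (eqmM (eqmxx M (2 * k%:R)) (eqm_sym S1))).
rewrite -sumrB big_distrr /=; apply: eqm_eq; apply: eq_bigr => m _.
by rewrite /G natrD; ring.
Qed.

(** This is the coefficient of u^k in [tate_w_D2], divided by 24. The multiple of [sigser 1]
    produced by the infinite tail cancels the one contained in [eisP]. *)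
Lemma lambert_conv M k : (0 < k <= M)%N ->
  eqm M (eisP * lambert k + 6 * (\sum_(1 <= i < k) lambert i * lambert (k - i)
      + 2 * \sum_(1 <= m < M.+1) fX ^+ m * (lambert m * lambert (m + k))))
    (k%:R ^+ 2 * lambert k).
Proof.
move=> kM; have k0 : (0 < k)%N by case/andP: kM.
pose a : A := \sum_(1 <= i < k) i%:R * (k - i)%N%:R.
pose b : A := \sum_(1 <= i < k) i%:R * (k - i)%N%:R * geo i.
have E1 : \sum_(1 <= i < k) lambert i * lambert (k - i) = (1 + geo k) * (a + 2 * b).
  have -> : a + 2 * b = a + b + \sum_(1 <= i < k) i%:R * (k - i)%N%:R * geo (k - i).
    rewrite mulr_natl mulr2n addrA; congr (_ + _); rewrite /b big_nat_rev /=.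
    rewrite big_nat [RHS]big_nat; apply: eq_bigr => i /andP[i0 ik].
    rewrite add1n subSS subKn ?(ltnW ik) //; ring.
  rewrite -!big_split /= big_distrr /= big_nat [RHS]big_nat.
  apply: eq_bigr => i /andP[i0 ik].
  have ki0 : (0 < k - i)%N by rewrite subn_gt0.
  have := geo1_geo1 i0 ki0; rewrite subnKC ?(ltnW ik) // => E.
  by rewrite /lambert; apply: (lin_comb (c := i%:R * (k - i)%N%:R) E); ring.
have E2 : \sum_(1 <= m < M.+1) fX ^+ m * (lambert m * lambert (m + k)) =
   (1 + geo k) * \sum_(1 <= m < M.+1) (m%:R * (m + k)%N%:R) * (geo m - geo (m + k)).
  rewrite big_distrr /= big_nat [RHS]big_nat; apply: eq_bigr => m /andP[m0 _].
  rewrite /lambert; have := geo_geo1 m0 k0; rewrite -{1}(fX_geo m0) => E.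
  by apply: (lin_comb (c := m%:R * (m + k)%N%:R) E); ring.
rewrite E1 E2; have L := lambert_shift kM.
have K := sum_i_kmi k0; rewrite -/a in K; rewrite -/b in L.
move: L; set x := \sum_(1 <= m < M.+1) _ => L.
apply: (eqm_trans (t := eisP * lambert k + 6 * ((1 + geo k) * (a + 2 * b)
   + 2 * ((1 + geo k) * (2 * k%:R * sigser 1 - b))))).
  apply: eqmD; first exact: eqmxx.
  apply: eqmM; first exact: eqmxx.
  apply: eqmD; first exact: eqmxx.
  apply: eqmM; first exact: eqmxx.
  by apply: eqmM; first exact: eqmxx.
apply: eqm_eq; rewrite /eisP /lambert.
by apply: (lin_comb (c := 1 + geo k) K); ring.
Qed.

Lemma fX_lambert_sqr n : (0 < n)%N ->
  fX ^+ n * lambert n ^+ 2 = n%:R ^+ 2 * (geo n + geo n ^+ 2).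
Proof.
by move=> n0; rewrite /lambert; apply: (lin_comb (c := n%:R ^+ 2 * (1 + geo n)) (fX_geo n0)); ring.
Qed.

Lemma bD_bU k : bD (bU ^+ k : B) = k%:R * bU ^+ k.
Proof. by have := bD_UV int k 0; rewrite expr0 mulr1 subr0. Qed.

Lemma bD_bV k : bD (bV ^+ k : B) = - (k%:R * bV ^+ k).
Proof. by have := bD_UV int 0 k; rewrite expr0 mul1r sub0r mulNr. Qed.

Lemma bD_U_iota k (s : A) :
  bD (U k * biota s) = k%:R * ((bU ^+ k - bV ^+ k) * biota s).
Proof. by rewrite bDM bD_iota mulr0 addr0 raddfD /= bD_bU bD_bV; ring. Qed.

Lemma bD2_U_iota k (s : A) :
  bD (bD (U k * biota s)) = k%:R ^+ 2 * (U k * biota s).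
Proof.
by rewrite bD_U_iota bD_natM bDM bD_iota mulr0 addr0 raddfB /= bD_bU bD_bV; ring.
Qed.

Lemma biota_nat2M k (s : A) : biota (k%:R ^+ 2 * s) = k%:R ^+ 2 * biota s.
Proof. by rewrite rmorphM /= rmorphXn /= rmorph_nat. Qed.

Lemma expand_sqr (p q : A) (X : B) :
  (biota p + 12 * X) * (biota p + 12 * X) - biota q =
   24 * (biota p * X) + 144 * X ^+ 2 + biota (p ^+ 2 - q).
Proof. by rewrite rmorphB /= rmorphXn /=; ring. Qed.

Lemma expand_conv (p l c : A) (y : B) :
  24 * (biota p * (y * biota l)) + 144 * (y * biota c) =
  24 * (y * biota (p * l + 6 * c)).
Proof. by rewrite rmorphD !rmorphM rmorph_nat /=; ring. Qed.

Lemma regroup (a s n d : B) : a + 144 * (s + n) + d = (a + 144 * s) + (144 * n + d).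
Proof. by ring. Qed.

Lemma sum_expand_conv (r : seq nat) (p : A) (l c : nat -> A) (y : nat -> B) :
  24 * (biota p * \sum_(k <- r) y k * biota (l k)) + 144 * \sum_(k <- r) y k * biota (c k) =
  24 * \sum_(k <- r) y k * biota (p * l k + 6 * c k).
Proof.
elim: r => [|k r IH]; first by rewrite !big_nil !mulr0 addr0.
rewrite !big_cons [RHS]mulrDr -IH -expand_conv.
by move: (\sum_(j <- r) _) (\sum_(j <- r) _) (biota (l k)) => a b d; ring.
Qed.

Lemma biota_144D (x y : A) : biota (144 * x + y) = 144 * biota x + biota y.
Proof. by rewrite rmorphD /= rmorphM /= rmorph_nat. Qed.

(** In this normalisation, Weierstrass's equation expressing the second derivative as a quadratic
    polynomial in the function. It is compared coefficient by coefficient in u, the nonzero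
    exponents being covered by [lambert_conv]. *)
Lemma tate_w_D2 : 2 * bD (bD tate_w) = tate_w ^+ 2 - biota eisQ.
Proof.
apply: beq_all => M.
have W := tate_w_sum M; move: (tate_w) W => w.
set X := \sum_(1 <= n < M.+1) _ => W.
have D2 : bD (bD (biota eisP + 12 * X)) =
    12 * \sum_(1 <= k < M.+1) U k * biota (k%:R ^+ 2 * lambert k).
  rewrite raddfD /= bD_iota add0r 2!bD_natM; congr (_ * _).
  rewrite !raddf_sum; apply: eq_bigr => k _ /=.
  by rewrite bD2_U_iota biota_nat2M; ring.
apply: (beq_trans (beqM (beqxx M 2) (beq_bD (beq_bD W)))); rewrite D2.
apply: beq_sym; rewrite expr2.
apply: (beq_trans (beqB (beqM W W) (beqxx M _))).
have XX := sum_U_sqr M lambert; rewrite -/X in XX.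
pose Sk k : A := \sum_(1 <= i < k) lambert i * lambert (k - i)
      + 2 * \sum_(1 <= m < M.+1) fX ^+ m * (lambert m * lambert (m + k)).
pose S1 : B := \sum_(1 <= k < M.+1) U k * biota (Sk k).
pose N2 : A := 2 * \sum_(1 <= n < M.+1) fX ^+ n * lambert n ^+ 2.
have {}XX : beq M (X ^+ 2) (S1 + biota N2) := XX.
apply: (beq_trans (beq_eq M (expand_sqr _ _ _))).
apply: (beq_trans (beqD (beqD (beqxx M _) (beqM (beqxx M 144) XX)) (beqxx M _))).
(* The coefficient of u^0: the diagonal terms add up to a multiple of [theta (sigser 1)], and the
   equation reduces to [convolution_1_1]. *)
have Q0 : eqm M (144 * N2 + (eisP ^+ 2 - eisQ)) 0.
  have T : eqm M (theta (sigser 1)) (\sum_(1 <= n < M.+1) fX ^+ n * lambert n ^+ 2).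
    apply: (eqm_trans (@theta_sigser M 1)); apply: eqm_eq.
    rewrite big_nat [RHS]big_nat; apply: eq_bigr => n /andP[n0 _].
    by rewrite fX_lambert_sqr // expr2 intrM natr_int expr2.
  apply: (eqm_trans (t := 288 * theta (sigser 1) + (eisP ^+ 2 - eisQ))).
    apply: eqmD; last exact: eqmxx.
    apply: (eqm_trans (t := 144 * (2 * theta (sigser 1)))); last by apply: eqm_eq; ring.
    by do 2!(apply: eqmM; first exact: eqmxx); apply: eqm_sym.
  apply: eqm_eq; apply: (lin_comb (c := 48) convolution_1_1).
  by rewrite /eisP /eisQ; ring.
have E24 : 24 * (biota eisP * X) + 144 * S1 =
    24 * \sum_(1 <= k < M.+1) U k * biota (eisP * lambert k + 6 * Sk k).
  exact: sum_expand_conv.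
apply: (beq_trans (beq_eq M (regroup _ _ _ _))); rewrite E24 -biota_144D.
rewrite -[X in beq _ _ X]addr0; apply: beqD; last first.
  by rewrite -(raddf0 (@biota int)); apply: beq_iota.
apply: (beq_trans (y := 24 * \sum_(1 <= k < M.+1) U k * biota (k%:R ^+ 2 * lambert k))).
  2: by apply: beq_eq; move: (\sum_(1 <= k < M.+1) _) => y; ring.
apply: beqM; first exact: beqxx.
apply: beq_sum => k; rewrite mem_index_iota ltnS => kM _.
by apply: beqM; [exact: beqxx | apply: beq_iota; exact: lambert_conv].
Qed.

End TateEquation.

(** * The cubic equation of the Tate curve *)

Section TateCubic.
Local Notation A := (fps int).
Local Notation B := (fps (fps int)).

(** Over the integers the kernel of u d/du consists of the series in q alone, and [bdiag] detects
    these. *)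
Lemma bD_bdiag_eq0 (x : B) : bD x = 0 -> bdiag x = 0 -> x = 0.
Proof.
move=> Dx dx; apply: bcoefP => a b; rewrite bcoef0.
case: (eqVneq a b) => [<-|ab].
  by have := congr1 (fun s => fcoef s a) dx; rewrite fcoef0.
have := congr1 (fun y => bcoef y a b) Dx; rewrite bcoef_D bcoef0 => /eqP.
by rewrite mulf_eq0 subr_eq0 eqr_nat (negPf ab) /= => /eqP.
Qed.

Lemma bdiag_tate_w : bdiag tate_w = eisP.
Proof.
by apply: fpsP => m; rewrite /= /bcoef /= /tate_coef eqxx.
Qed.

Lemma bdiag_natM k (x : B) : bdiag (k%:R * x) = k%:R * bdiag x.
Proof. by rewrite !mulr_natl raddfMn. Qed.

Lemma bdiag_VV n m (s : A) : (0 < n)%N -> (0 < m)%N ->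
  bdiag ((bU ^+ n - bV ^+ n) * (bU ^+ m - bV ^+ m) * biota s) =
  if n == m then - (2 * fX ^+ n * s) else 0.
Proof.
move=> n0 m0; rewrite mulrC bdiag_iotaM.
have -> : (bU ^+ n - bV ^+ n) * (bU ^+ m - bV ^+ m) =
   bU ^+ (n + m) * bV ^+ 0 + bU ^+ 0 * bV ^+ (n + m)
   - bU ^+ n * bV ^+ m - bU ^+ m * bV ^+ n :> B.
  by rewrite !exprD !expr0; ring.
rewrite !raddfB /= raddfD /= !bdiag_UV eq_sym (eq_sym 0%N) addn_eq0 eqn0Ngt n0 /= (eq_sym m n).
by case: eqP => [->|_]; ring.
Qed.

(** Only a product of u^n with v^n contributes to u^0; the minus sign arises because D multiplies
    u^n and v^n by opposite numbers. *)
Lemma bdiag_DD : bdiag (bD tate_w ^+ 2) = - (288 * theta (sigser 3)).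
Proof.
apply: eqm_all => M.
have W := beq_bD (tate_w_sum M); move: (tate_w) W => w.
pose Y : B := \sum_(1 <= n < M.+1) (bU ^+ n - bV ^+ n) * biota (n%:R * lambert n).
rewrite raddfD /= bD_iota add0r bD_natM.
have -> : bD (\sum_(1 <= n < M.+1) (bU ^+ n + bV ^+ n) * biota (lambert n)) = Y.
  rewrite raddf_sum; apply: eq_bigr => n _ /=.
  by rewrite bD_U_iota [in RHS]rmorphM rmorph_nat /=; ring.
move=> W; have WW := eqm_bdiag (beqM W W).
rewrite expr2; apply: (eqm_trans WW).
have -> : 12 * Y * (12 * Y) = 144 * (Y * Y) by ring.
rewrite bdiag_natM.
have -> : bdiag (Y * Y) = - (2 * \sum_(1 <= n < M.+1) n%:R ^+ 2 * (fX ^+ n * lambert n ^+ 2)).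
  rewrite {1}/Y big_distrl raddf_sum big_distrr -sumrN /= big_nat [RHS]big_nat.
  apply: eq_bigr => n /andP[n0 nM].
  rewrite /Y big_distrr raddf_sum /= big_nat.
  rewrite (eq_bigr (fun m => if n == m then
     - (2 * fX ^+ n * (n%:R * lambert n * (n%:R * lambert n))) else 0)); last first.
    move=> m /andP[m0 _].
    transitivity (bdiag ((bU ^+ n - bV ^+ n) * (bU ^+ m - bV ^+ m)
       * biota (n%:R * lambert n * (m%:R * lambert m)))).
      by rewrite [in RHS]rmorphM /=; congr bdiag; move: (biota _) (biota _) => x y; ring.
    by rewrite bdiag_VV //; case: eqP => [->|].
  rewrite -big_nat -big_mkcond (eq_bigl (pred1 n)) => [|m]; last by rewrite /= eq_sym.
  rewrite -big_filter filter_pred1_uniq ?iota_uniq ?mem_index_iota ?n0 // big_seq1.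
  by move: (lambert n) => l; ring.
apply: eqm_sym.
apply: (eqm_trans (t := 144 * - (2 * \sum_(1 <= n < M.+1) (n%:R ^+ 4)%:~R * (geo n + geo n ^+ 2)))).
  apply: (eqm_trans (t := 144 * - (2 * theta (sigser 3)))); first by apply: eqm_eq; ring.
  apply: eqmM; first exact: eqmxx.
  by apply: eqmN; apply: eqmM; [exact: eqmxx | exact: theta_sigser].
apply: eqm_eq; congr (_ * - (_ * _)); rewrite big_nat [RHS]big_nat.
apply: eq_bigr => n /andP[n0 _]; rewrite fX_lambert_sqr //.
by rewrite rmorphXn /= natr_int; ring.
Qed.

(** The difference of the two sides has derivative zero by [tate_w_D2], so only its constant term in
    u has to vanish. The constant terms of w^2 and w^3 follow by applying [bdiag] to [tate_w_D2] and
    to w times it and integrating by parts; [theta_eisQ] closes the computation. *)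
Lemma tate_w_cubic :
  3 * bD tate_w ^+ 2 = tate_w ^+ 3 - 3 * biota eisQ * tate_w + 2 * biota eisR.
Proof.
apply/eqP; rewrite -subr_eq0; apply/eqP.
have D2 := tate_w_D2; have dw := bdiag_tate_w; have dd := bdiag_DD.
have tQ := theta_eisQ.
have {}tQ : 720 * theta (sigser 3) = eisP * eisQ - eisR.
  by rewrite -tQ /eisQ raddfD /= thetaM (theta_nat _ 1) (theta_nat _ 240); ring.
move: (tate_w) (theta (sigser 3)) eisP eisQ eisR D2 dw dd tQ => w t p q r D2 dw dd tQ.
have -> : 3 * bD w ^+ 2 - (w ^+ 3 - 3 * biota q * w + 2 * biota r) =
   3 * bD w ^+ 2 - w ^+ 3 + 3 * (biota q * w) - 2 * biota r by ring.
apply: bD_bdiag_eq0.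
  rewrite raddfB raddfD raddfB /= !bD_natM bD_iotaM bD_iota !bDX /=.
  by apply: (lin_comb (c := 3 * bD w) D2); ring.
have sq : bdiag (w ^+ 2) = q.
  have := congr1 (@bdiag int) D2; rewrite bdiag_natM bdiag_D mulr0 raddfB /= bdiag_iota.
  by move/esym/subr0_eq.
have wD2 : bdiag (w * bD (bD w)) = - bdiag (bD w ^+ 2).
  have := bdiag_D (w * bD w); rewrite bDM raddfD /= -expr2 addrC => /eqP.
  by rewrite addr_eq0 => /eqP.
have cu : bdiag (w ^+ 3) = q * p - 2 * bdiag (bD w ^+ 2).
  have := congr1 (fun y => bdiag (w * y)) D2.
  have -> : w * (2 * bD (bD w)) = 2 * (w * bD (bD w)) by ring.
  have -> : w * (w ^+ 2 - biota q) = w ^+ 3 - biota q * w by ring.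
  rewrite bdiag_natM wD2 raddfB /= bdiag_iotaM dw => /eqP.
  by rewrite eq_sym subr_eq => /eqP ->; ring.
rewrite raddfB raddfD raddfB /= !bdiag_natM cu bdiag_iotaM bdiag_iota dw dd.
by apply: (lin_comb (c := - 2) tQ); ring.
Qed.

End TateCubic.

(** * Quadratic extensions and derivations *)

(* [quad f] is the quadratic extension S[y] / (y^2 - f). *)
Definition quad (S : comNzRingType) (f : S) : Type := (S * S)%type.

Section Quad.
Variables (S : comNzRingType) (f : S).
Local Notation K := (quad f).
Implicit Types x y z : K.

HB.instance Definition _ := GRing.Zmodule.copy K (S * S)%type.

Lemma quadP x y : x.1 = y.1 -> x.2 = y.2 -> x = y.
Proof. by case: x y => [a b] [c d] /= -> ->. Qed.

Definition quad_mul x y : K := (x.1 * y.1 + x.2 * y.2 * f, x.1 * y.2 + x.2 * y.1).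
Definition quad_one : K := (1, 0).

Lemma quad_mulA : associative quad_mul.
Proof. by move=> x y z; apply: quadP => /=; ring. Qed.
Lemma quad_mulC : commutative quad_mul.
Proof. by move=> x y; apply: quadP => /=; ring. Qed.
Lemma quad_mul1 : left_id quad_one quad_mul.
Proof. by move=> x; apply: quadP => /=; ring. Qed.
Lemma quad_mulDl : left_distributive quad_mul +%R.
Proof. by move=> x y z; apply: quadP => /=; ring. Qed.
Lemma quad_one_neq0 : quad_one != 0.
Proof. by apply/eqP => /(congr1 fst) /= /eqP; rewrite oner_eq0. Qed.

HB.instance Definition _ := GRing.Zmodule_isComNzRing.Build K
  quad_mulA quad_mulC quad_mul1 quad_mulDl quad_one_neq0.

Definition qc (a : S) : K := (a, 0).
Definition qy : K := (0, 1).
Definition qconj x : K := (x.1, - x.2).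
Definition qnorm x : S := x.1 ^+ 2 - x.2 ^+ 2 * f.

Lemma qmul1 x y : (x * y).1 = x.1 * y.1 + x.2 * y.2 * f. Proof. by []. Qed.
Lemma qmul2 x y : (x * y).2 = x.1 * y.2 + x.2 * y.1. Proof. by []. Qed.
Lemma qadd1 x y : (x + y).1 = x.1 + y.1. Proof. by []. Qed.
Lemma qadd2 x y : (x + y).2 = x.2 + y.2. Proof. by []. Qed.
Lemma qopp1 x : (- x).1 = - x.1. Proof. by []. Qed.
Lemma qopp2 x : (- x).2 = - x.2. Proof. by []. Qed.
Definition quadE := (qmul1, qmul2, qadd1, qadd2, qopp1, qopp2).

Lemma qc_is_zmod_morphism : zmod_morphism qc.
Proof. by move=> a b; apply: quadP => //=; rewrite subrr. Qed.
HB.instance Definition _ := GRing.isZmodMorphism.Build S K qc qc_is_zmod_morphism.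
Lemma qc_is_monoid_morphism : monoid_morphism qc.
Proof. by split=> // a b; apply: quadP; rewrite quadE /=; ring. Qed.
HB.instance Definition _ := GRing.isMonoidMorphism.Build S K qc qc_is_monoid_morphism.

Lemma quad_eq x : x = qc x.1 + qc x.2 * qy.
Proof. by apply: quadP; rewrite !quadE /=; ring. Qed.

Lemma qy_sqr : qy ^+ 2 = qc f.
Proof. by rewrite expr2; apply: quadP; rewrite quadE /=; ring. Qed.

Lemma mul_qconj x : x * qconj x = qc (qnorm x).
Proof. by apply: quadP; rewrite quadE /qnorm /=; ring. Qed.

Lemma qnormM x y : qnorm (x * y) = qnorm x * qnorm y.
Proof. by rewrite /qnorm !quadE; ring. Qed.

Lemma qnorm_conj x : qnorm (qconj x) = qnorm x.
Proof. by rewrite /qnorm /=; ring. Qed.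

Lemma qnorm_c a : qnorm (qc a) = a ^+ 2.
Proof. by rewrite /qnorm /=; ring. Qed.

Lemma qconjM x y : qconj (x * y) = qconj x * qconj y.
Proof. by apply: quadP; rewrite /qconj !quadE /=; ring. Qed.

Lemma qconjK x : qconj (qconj x) = x.
Proof. by apply: quadP; rewrite /= ?opprK. Qed.

End Quad.

(** * Iterated derivations in characteristic p *)

Section DerivationPow.
Variables (K : comNzRingType) (D : {additive K -> K}).
Hypothesis DM : forall x y, D (x * y) = D x * y + x * D y.

Lemma iter_derivation n x y : iter n D (x * y) =
  \sum_(i < n.+1) (iter i D x * iter (n - i) D y) *+ 'C(n, i).
Proof.
elim: n => [|n IH]; first by rewrite big_ord1 /= mulr1n.
rewrite iterS IH raddf_sum /=.
under eq_bigr => i _ do rewrite raddfMn DM /= mulrnDl.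
rewrite big_split /= [X in X + _]big_ord_recr /= subnn binn [X in _ + X]big_ord_recl /=.
rewrite [RHS]big_ord_recl [X in _ = _ + X]big_ord_recr /= subnn bin0 !subn0 binn bin0.
rewrite [LHS]addrC -[LHS]addrA; congr (_ + _); rewrite addrA; congr (_ + _).
rewrite -big_split /=; apply: eq_bigr => i _.
by rewrite /bump /= add1n subSS binS mulrnDr -!iterS subnSK // addrC.
Qed.

Lemma iter_derivation_prime p x y : prime p -> (forall z : K, z *+ p = 0) ->
  iter p D (x * y) = iter p D x * y + x * iter p D y.
Proof.
move=> pp p0; have : (0 < p)%N by exact: prime_gt0.
case: p pp p0 => // p pp p0 _.
rewrite iter_derivation big_ord_recl big_ord_recr /= bin0 subnn binn !mulr1n.
rewrite big1 ?add0r 1?addrC // => i _.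
have := prime_dvd_bin (k := bump 0 i) pp; rewrite /bump /= add1n !ltnS.
move=> /(_ _)/dvdnP; case; first by case: i.
by move=> k ->; rewrite mulnC mulrnA p0 mul0rn.
Qed.

End DerivationPow.

Section QuadDerivation.
Variables (R : comNzRingType) (f : {poly R}).

(* The derivation 2y d/dx of the curve y^2 = f(x). *)
Definition qder (x : quad f) : quad f :=
  (2 * x.2^`() * f + x.2 * f^`(), 2 * x.1^`()).

(** The square of D = 2y d/dx on functions of x alone. *)
Definition qder2 (g : {poly R}) : {poly R} :=
  4 * f * g^`()^`() + 2 * f^`() * g^`().

Lemma qder_is_zmod_morphism : zmod_morphism qder.
Proof. by move=> x y; apply: quadP; rewrite /= !derivB; ring. Qed.
HB.instance Definition _ :=
  GRing.isZmodMorphism.Build (quad f) (quad f) qder qder_is_zmod_morphism.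

Lemma qderM x y : qder (x * y) = qder x * y + x * qder y.
Proof. by apply: quadP; rewrite /= !derivD !derivM; ring. Qed.

Lemma qder_c c : qder (qc f c%:P) = 0.
Proof. by apply: quadP; rewrite /= ?deriv0 ?derivC; ring. Qed.

Lemma qder_qc g : qder (qc f g) = qc f (2 * g^`()) * qy f.
Proof. by apply: quadP; rewrite /= ?deriv0; ring. Qed.

Lemma qder_qy : qder (qy f) = qc f f^`().
Proof. by apply: quadP; rewrite /= -?[1]/(1%:P) ?derivC ?deriv0; ring. Qed.

Lemma qder2_is_zmod_morphism : zmod_morphism qder2.
Proof. by move=> g h; rewrite /qder2 !derivB; ring. Qed.
HB.instance Definition _ :=
  GRing.isZmodMorphism.Build {poly R} {poly R} qder2 qder2_is_zmod_morphism.

Lemma qder2C c : qder2 c%:P = 0.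
Proof. by rewrite /qder2 derivC deriv0; ring. Qed.

Lemma qder2Z c g : qder2 (c%:P * g) = c%:P * qder2 g.
Proof. by rewrite /qder2 !derivM derivC mul0r add0r derivM derivC; ring. Qed.

Lemma qder_qder_c g : qder (qder (qc f g)) = qc f (qder2 g).
Proof.
by rewrite qder_qc qderM qder_qc qder_qy; apply: quadP => /=;
  rewrite ?derivM -?[2]polyC_natr ?derivC /qder2; ring.
Qed.

End QuadDerivation.

(** * The operator D^2 on polynomials and the Hasse invariant *)

Section CubicOperator.
Variables (R : comNzRingType) (al be : R).

Definition cubic : {poly R} := 'X^3 + al%:P * 'X + be%:P.

Definition cop : {poly R} -> {poly R} := qder2 cubic.

(* In characteristic p = 2 N + 1, the derivation [qder] satisfies
   [D ^ p = hasse N * D]; see [iter_qder_pchar]. *)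
Definition hasse N : R := (iter N cop 'X)`_1.

Lemma cubic_deriv : cubic^`() = 3 * 'X^2 + al%:P.
Proof. by rewrite /cubic !derivD derivXn derivM !derivC derivX /=; ring. Qed.

Lemma size_cubic : size cubic = 4.
Proof.
have -> : cubic = ('X^2 + al%:P) * 'X + be%:P by rewrite /cubic; ring.
have sz : size ('X^2 + al%:P) = 3%N by rewrite size_XnaddC.
rewrite size_MXaddC sz; case: eqP => // e.
by rewrite e size_poly0 in sz.
Qed.

Lemma cubic_monic : cubic \is monic.
Proof.
rewrite monicE lead_coefE size_cubic /= /cubic !coefD coefXn coefC mulrC coefXM coefC /=.
by rewrite !addr0.
Qed.

Lemma coef_cop g k : (cop g)`_k =
  (if k is k'.+1 then (2 * k'%:R * (2 * k'%:R + 1)) * g`_k' else 0)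
  + al * (2 * k.+1%:R * (2 * k%:R + 1)) * g`_k.+1
  + be * (4 * k.+1%:R * k.+2%:R) * g`_k.+2.
Proof.
have -> : cop g = 'X^2 * ('X * (4%:P * g^`()^`()) + 6%:P * g^`())
     + al%:P * ('X * (4%:P * g^`()^`()) + 2%:P * g^`()) + be%:P * (4%:P * g^`()^`()).
  by rewrite /cop /qder2 cubic_deriv /cubic; ring.
rewrite !coefD !coefCM coefXnM !coefD !coefCM !coefXM !coefCM !coef_deriv.
case: k => [|[|k]] /=; first by ring.
  by ring.
rewrite ?subn2 /=; case: k => [|k] /=; rewrite ?coef_deriv ?coefCM ?coefXM ?coef_deriv /=.
  by ring.
by ring.
Qed.

Lemma size_cop (g : {poly R}) n : (size g <= n)%N -> (size (cop g) <= n.+1)%N.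
Proof.
move=> gn; apply/leq_sizeP => k nk; rewrite coef_cop.
have g0 i : (n <= i)%N -> g`_i = 0 by move=> ni; rewrite nth_default // (leq_trans gn).
rewrite (g0 k.+1) ?(g0 k.+2) ?mulr0 ?addr0; do 1?[lia].
by case: k nk => // k nk; rewrite g0 ?mulr0.
Qed.

Lemma size_iter_cop n (g : {poly R}) N : (size g <= n)%N -> (size (iter N cop g) <= n + N)%N.
Proof.
by move=> gn; elim: N => [|N IH]; rewrite ?addn0 // addnS; apply: size_cop.
Qed.

End CubicOperator.

Lemma hasse_map (R S : comNzRingType) (f : {rmorphism R -> S}) al be N :
  hasse (f al) (f be) N = f (hasse al be N).
Proof.
rewrite /hasse -coef_map.
suff -> : iter N (cop (f al) (f be)) 'X = map_poly f (iter N (cop al be) 'X) by [].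
have fE : cubic (f al) (f be) = map_poly f (cubic al be).
  by rewrite /cubic !rmorphD rmorphM /= map_polyXn map_polyX !map_polyC.
elim: N => [|N IH]; first by rewrite /= map_polyX.
rewrite !iterS IH /cop fE; move: (cubic al be) (iter _ _ _) => c g.
by rewrite /qder2 rmorphD !rmorphM !rmorph_nat /= !deriv_map.
Qed.

Section CubicOperatorChar.
Variables (R : comNzRingType) (p N : nat).
Hypotheses (pR : p \in [pchar R]) (pN : p = N.*2.+1).
Variables al be : R.

Let p_prime : prime p. Proof. exact: pcharf_prime pR. Qed.
Let N_gt0 : (0 < N)%N. Proof. by move: p_prime; rewrite pN; case: N. Qed.

(** The coefficient ring will be a ring of power series, so integers prime to p are inverted by a
    Bezout relation. *)
Lemma natr_lreg k : (0 < k < p)%N -> GRing.lreg (k%:R : R).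
Proof.
move=> /andP[k0 kp]; have ck : coprime k p.
  by rewrite coprime_sym prime_coprime // gtnNdvd.
case: (egcdnP p k0) => u v e _; rewrite (eqP ck) in e.
have uk : u%:R * k%:R = 1 :> R.
  by rewrite -natrM e natrD natrM (pcharf0 pR) mulr0 add0r.
by move=> x y e2; rewrite -[x]mul1r -[y]mul1r -uk -!mulrA e2.
Qed.

Lemma poly_pchar_mulrn (g : {poly R}) : g *+ p = 0.
Proof. by apply/polyP => i; rewrite coefMn coef0 -mulr_natr (pcharf0 pR) mulr0. Qed.

Local Notation f := (cubic al be).

Lemma quad_pchar_mulrn (z : quad f) : z *+ p = 0.
Proof.
have E n : z *+ n = (z.1 *+ n, z.2 *+ n) :> quad f.
  by elim: n => [|n IH]; [rewrite !mulr0n | rewrite !mulrS IH].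
by rewrite E !poly_pchar_mulrn.
Qed.

Lemma iter_qderM (x y : quad f) :
  iter p (@qder R f) (x * y) = iter p (@qder R f) x * y + x * iter p (@qder R f) y.
Proof. by apply: (iter_derivation_prime (@qderM R f) x y p_prime); exact: quad_pchar_mulrn. Qed.

Lemma iter_qderD (x y : quad f) :
  iter p (@qder R f) (x + y) = iter p (@qder R f) x + iter p (@qder R f) y.
Proof. by elim: p => // n IH; rewrite !iterS IH raddfD. Qed.

Lemma iter_qder_c c : iter p (@qder R f) (qc f c%:P) = 0.
Proof.
rewrite pN iterSr qder_c; elim: N.*2 => // n IH.
by rewrite iterS IH raddf0.
Qed.

Lemma iter_qder_double n (g : {poly R}) :
  iter n.*2 (@qder R f) (qc f g) = qc f (iter n (cop al be) g).
Proof. by elim: n => // n IH; rewrite doubleS !iterS IH qder_qder_c. Qed.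

Lemma cubic_lreg : GRing.lreg f.
Proof. exact: monic_lreg (cubic_monic al be). Qed.

Lemma nat_poly_lreg k : (0 < k < p)%N -> GRing.lreg (k%:R : {poly R}).
Proof.
move=> kp g h e; apply/polyP => i; apply: (natr_lreg kp).
have := congr1 (fun q : {poly R} => q`_i) e.
by rewrite /= !mulr_natl !coefMn.
Qed.

Local Notation t := (iter N (cop al be) 'X).

Lemma iter_qder_X : iter p (@qder R f) (qc f 'X) = qc f (2 * t^`()) * qy f.
Proof. by rewrite pN iterS iter_qder_double qder_qc. Qed.

(** D^p is again a derivation, so applying it to y^2 = f gives 2y D^p y in terms of D^p x; 2 and f
    are then cancelled. *)
Lemma iter_qder_y : iter p (@qder R f) (qy f) = qc f (t^`() * f^`()).
Proof.
have two : GRing.lreg (2%:R : {poly R}) by apply: nat_poly_lreg; move: N_gt0; rewrite pN; lia.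
have Dy2 := iter_qderM (qy f) (qy f).
have Df : iter p (@qder R f) (qc f f) = qc f (2 * t^`() * f^`()) * qy f.
  have -> : qc f f = qc f 'X * (qc f 'X * qc f 'X) + qc f al%:P * qc f 'X + qc f be%:P.
    by apply: quadP => /=; rewrite /cubic; ring.
  rewrite !iter_qderD !iter_qderM !iter_qder_c iter_qder_X cubic_deriv.
  by apply: quadP => /=; ring.
rewrite -expr2 qy_sqr Df in Dy2.
case E : (iter p (@qder R f) (qy f)) Dy2 => [a b] Dy2.
have := congr1 fst Dy2; have := congr1 snd Dy2; rewrite !quadE /= => e2 e1.
have b0 : b = 0.
  apply: cubic_lreg; apply: two.
  have : 0 = b * f + b * f by move: e1; rewrite !(mul0r, mulr0, mul1r, mulr1, add0r, addr0).
  by rewrite mulr0 mulr0 => ->; ring.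
apply: quadP => //=; apply: two.
by move: e2; rewrite !(mul0r, mulr0, mul1r, mulr1, add0r, addr0) => e2; rewrite mulrA e2; ring.
Qed.

(** D^p commutes with D. Applied to x, this gives D^p(2y) = D(2t'y); the first side is 2t'f' and the
    second is 2t'f' + 4t''f, which forces t'' = 0. *)
Lemma iter_cop_deriv2 : t^`()^`() = 0.
Proof.
have four : GRing.lreg (2%:R : {poly R}) by apply: nat_poly_lreg; move: N_gt0; rewrite pN; lia.
have : iter p (@qder R f) (qder (qc f 'X)) = qder (iter p (@qder R f) (qc f 'X)).
  by rewrite -iterSr -iterS.
rewrite iter_qder_X {1}qder_qc derivX mulr1.
have -> : qc f 2 = qc f (2%:R : R)%:P by rewrite polyC_natr.
rewrite iter_qderM iter_qder_c mul0r add0r iter_qder_y qderM qder_qc qder_qy polyC_natr.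
move=> /(congr1 fst); rewrite !quadE /= derivM -[2%:R as X in X^`()]polyC_natr derivC => e.
apply: cubic_lreg; apply: (four); apply: (four); rewrite !mulr0.
move: e; rewrite !(mul0r, mulr0, mul1r, mulr1, add0r, addr0) => /eqP.
by rewrite -subr_eq0 => /eqP e; rewrite -[RHS]oppr0 -[in RHS]e; ring.
Qed.

(** The degree of t is at most N + 1, below p, so the factors (i+1)(i+2) in t'' are invertible and
    t'' = 0 forces degree at most 1. *)
Lemma iter_cop_X : exists e, t = (hasse al be N)%:P * 'X + e%:P.
Proof.
exists t`_0; apply/polyP => -[|[|i]].
- by rewrite coefD coefCM coefX coefC mulr0 add0r.
- by rewrite coefD coefCM coefX coefC mulr1 addr0.
rewrite coefD coefCM coefX coefC mulr0 addr0.
case: (leqP i.+2 N.+1) => iN.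
  have := congr1 (fun g : {poly R} => g`_i) iter_cop_deriv2.
  rewrite !coef_deriv coef0 -mulrnA -mulr_natl => e.
  rewrite mulnC natrM -mulrA in e.
  have i1 : (0 < i.+1 < p)%N by rewrite pN; lia.
  have i2 : (0 < i.+2 < p)%N by rewrite pN; lia.
  by apply: (natr_lreg i2); apply: (natr_lreg i1); rewrite !mulr0.
apply: nth_default; apply: leq_trans iN.
by have := @size_iter_cop R al be 2 'X N; rewrite size_polyX => /(_ isT); rewrite add2n.
Qed.

(** Both sides are derivations killing constants, so it suffices that they agree on x and y. *)
Lemma iter_qder_pchar (x : quad f) :
  iter p (@qder R f) x = qc f (hasse al be N)%:P * qder x.
Proof.
have [e te] := iter_cop_X.
have t1 : t^`() = (hasse al be N)%:P by rewrite te derivD derivM !derivC derivX; ring.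
have DC (g : {poly R}) : iter p (@qder R f) (qc f g) = qc f (hasse al be N)%:P * qder (qc f g).
  elim/poly_ind: g => [|g c IH].
    by rewrite -[0]/(0%:P) iter_qder_c qder_c mulr0.
  rewrite rmorphD rmorphM /= iter_qderD iter_qderM IH iter_qder_c iter_qder_X t1.
  rewrite raddfD /= qderM qder_c !qder_qc derivX; apply: quadP => /=; ring.
rewrite [in LHS](quad_eq x) iter_qderD iter_qderM !DC iter_qder_y t1.
by apply: quadP => /=; rewrite ?deriv0; ring.
Qed.

End CubicOperatorChar.

(** * The Hasse invariant of the Tate curve *)

Section TateHasse.
Variables (R : comNzRingType) (p N : nat).
Hypotheses (pR : p \in [pchar R]) (pN : p = N.*2.+1) (p3 : (3 < p)%N).
Local Notation A := (fps R).
Local Notation B := (fps (fps R)).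

Definition eisPR : A := fps_map intr eisP.
Definition eisQR : A := fps_map intr eisQ.
Definition eisRR : A := fps_map intr eisR.
Let w : B := fps_map (fps_map intr) tate_w.

Lemma fps_pchar : p \in [pchar A].
Proof.
rewrite inE (pcharf_prime pR) /=; apply/eqP; apply: fpsP => n.
by rewrite fcoef_nat (pcharf0 pR) if_same fcoef0.
Qed.

Lemma bcoef_map (x : fps (fps int)) a b :
  bcoef (fps_map (fps_map intr) x : B) a b = (bcoef x a b)%:~R.
Proof. by []. Qed.

Lemma fps_map_bD (x : fps (fps int)) :
  fps_map (fps_map intr) (bD x) = bD (fps_map (fps_map intr) x) :> B.
Proof.
apply: bcoefP => a b; rewrite bcoef_map !bcoef_D bcoef_map intrM intrB.
by rewrite !mulrz_nat.
Qed.

Lemma fps_map_biota (s : fps int) :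
  fps_map (fps_map intr) (biota s) = biota (fps_map intr s) :> B.
Proof. by apply: bcoefP => a b; rewrite bcoef_map !bcoef_iota; case: eqP. Qed.

Lemma tate_D2 : 2 * bD (bD w) = w ^+ 2 - biota eisQR.
Proof.
rewrite /w -!fps_map_bD -fps_map_biota -rmorphXn -rmorphB -tate_w_D2.
by rewrite rmorphM /= rmorph_nat.
Qed.

Lemma tate_cubic : 3 * bD w ^+ 2 = w ^+ 3 - 3 * biota eisQR * w + 2 * biota eisRR.
Proof.
have := congr1 (fps_map (fps_map intr) : _ -> B) tate_w_cubic.
have gen (S T : comNzRingType) (phi : {rmorphism S -> T}) (x q r : S) :
    phi (x ^+ 3 - 3 * q * x + 2 * r) = phi x ^+ 3 - 3 * phi q * phi x + 2 * phi r.
  by rewrite rmorphD rmorphB rmorphXn !rmorphM !rmorph_nat.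
rewrite gen rmorphM rmorphXn rmorph_nat /= fps_map_bD => ->.
by rewrite !fps_map_biota.
Qed.

Let al : A := - 3 * eisQR.
Let be : A := 2 * eisRR.

Let ev (g : {poly A}) : B := (map_poly (@biota R) g).[w].

Lemma evD g h : ev (g + h) = ev g + ev h.
Proof. by rewrite /ev rmorphD hornerD. Qed.
Lemma evM g h : ev (g * h) = ev g * ev h.
Proof. by rewrite /ev rmorphM hornerM. Qed.
Lemma evC c : ev c%:P = biota c.
Proof. by rewrite /ev map_polyC hornerC. Qed.
Lemma evX : ev 'X = w.
Proof. by rewrite /ev map_polyX hornerX. Qed.
Lemma ev_nat n : ev n%:R = n%:R.
Proof. by rewrite -polyC_natr evC rmorph_nat. Qed.

Lemma bD_ev g : bD (ev g) = ev g^`() * bD w.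
Proof.
elim/poly_ind: g => [|g c IH].
  by rewrite deriv0 -[0]/(0%:P) evC bD_iota rmorph0 mul0r.
rewrite derivD derivM derivX derivC mulr1 addr0 !evD !evM evC evX raddfD /= bDM IH.
by rewrite bD_iota; ring.
Qed.

(** At w the cubic takes the value 3 (D w)^2 and its derivative the value 6 D^2 w; the chain rule
    for D^2 g(w), multiplied by 12 = 4 * 3 = 2 * 6, is therefore [cop]. *)
Lemma bD2_ev g : 12 * bD (bD (ev g)) = ev (cop al be g).
Proof.
have f1 : ev (cubic al be) = 3 * bD w ^+ 2.
  rewrite tate_cubic /cubic !evD !evM !evC !evX /al /be.
  by rewrite !rmorphM rmorphN !rmorph_nat /=; ring.
have f2 : ev (cubic al be)^`() = 6 * bD (bD w).
  have -> : 6 * bD (bD w) = 3 * (2 * bD (bD w)) by ring.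
  rewrite tate_D2 cubic_deriv evD !evM ev_nat evC !evX /al.
  by rewrite !rmorphM rmorphN !rmorph_nat /=; ring.
rewrite /cop /qder2 evD !evM !ev_nat f1 f2 !bD_ev bDM !bD_ev; ring.
Qed.

Lemma bcoef_iter_bD n (x : B) a b :
  bcoef (iter n (@bD R) x) a b = (a%:R - b%:R) ^+ n * bcoef x a b.
Proof.
elim: n => [|n IH]; first by rewrite expr0 mul1r.
by rewrite iterS bcoef_D IH exprS mulrA.
Qed.

Lemma iter_bD_pchar (x : B) : iter p (@bD R) x = bD x.
Proof.
apply: bcoefP => a b; rewrite bcoef_iter_bD bcoef_D.
by rewrite -(pFrobenius_autE pR) rmorphB !rmorph_nat.
Qed.

(** Iterating [bD2_ev] identifies the N-th iterate of [cop] on 'X, evaluated at w, with 12^N D^(2N)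
    w. One more D gives D^p w = D w on one side, by Fermat, and the Hasse invariant times D w on the
    other. *)
Lemma tate_hasse : hasse al be N = 12 ^+ N.
Proof.
have XM n (x : B) : bD (12 ^+ n * x) = 12 ^+ n * bD x by rewrite -!natrX bD_natM.
have E n : 12 ^+ n * iter n.*2 (@bD R) w = ev (iter n (cop al be) 'X).
  elim: n => [|n IH]; first by rewrite evX expr0 mul1r.
  by rewrite doubleS !iterS -bD2_ev -IH !XM exprS mulrA.
have [e te] := iter_cop_X fps_pchar pN al be.
have := congr1 (@bD R) (E N); rewrite te evD evM !evC evX raddfD /= bD_iotaM bD_iota addr0.
rewrite XM -iterS -pN iter_bD_pchar.
have -> : 12 ^+ N = biota (12 ^+ N) :> B by rewrite rmorphXn /= rmorph_nat.
move=> H; apply/eqP; rewrite -subr_eq0; apply/eqP.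
move: (hasse al be N) (12 ^+ N) H => h c H.
have {}H : biota (h - c) * bD w = 0.
  by rewrite rmorphB mulrBl /= H subrr.
have e10 : bcoef tate_w 1 0 = 12 by rewrite /bcoef /= /tate_coef.
move: (h - c) H => s H; apply: fpsP => m; rewrite fcoef0.
(* Cancellation of D w: the coefficient of u^(m+1) v^m isolates the m-th coefficient of s times that
   of u in D w, which is 12 and regular since p > 3. *)
elim/ltn_ind: m => m IH.
have := congr1 (fun x => bcoef x m.+1 m) H.
rewrite bcoef0 bcoef_iotaM (minn_idPr (leqnSn m)) big_ord_recr /= big1 ?add0r => [|i _].
  rewrite subnn subSnn bcoef_D subr0 mul1r bcoef_map e10.
  have r := @natr_lreg R p pR.
  move=> e12; have r2 : (0 < 2 < p)%N by lia.
  have r3 : (0 < 3 < p)%N by lia.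
  apply: (r _ r2); apply: (r _ r2); apply: (r _ r3); rewrite !mulr0 -e12.
  by rewrite mulrz_nat; ring.
by rewrite IH // mul0r.
Qed.

End TateHasse.

(** * The Hasse invariant on the j-line *)

Section Inverse.

Lemma ps_inv_rec_nth (a : pseries) n i : (i <= n)%N ->
  (ps_inv_rec a n)`_i = ps_inv a (n - i)%N.
Proof.
elim: n i => [|n IH] [|i] //= le.
by rewrite subSS IH.
Qed.

Lemma ps_invS (a : pseries) n :
  ps_inv a n.+1 = - \sum_(i < n.+1) a i.+1 * ps_inv a (n - i)%N.
Proof.
rewrite {1}/ps_inv /=; congr (- _); apply: eq_bigr => i _.
by rewrite -/(ps_inv_rec a n) ps_inv_rec_nth // -ltnS.
Qed.

Definition fps_inv (s : fps int) : fps int := Fps (ps_inv (fcoef s)).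

Lemma fps_mulV s : fcoef s 0 = 1 -> s * fps_inv s = 1.
Proof.
move=> s0; apply: fpsP => -[|n]; first by rewrite fcoefM0 s0 fcoef1 mul1r.
rewrite fcoefM big_ord_recl /= s0 mul1r subn0 ps_invS fcoef1 /= addrC.
by apply/eqP; rewrite subr_eq0; apply/eqP; apply: eq_bigr => i _; rewrite subSS.
Qed.

Lemma fps_inv0 s : fcoef (fps_inv s) 0 = 1.
Proof. by []. Qed.

End Inverse.

(** * The q-expansions of j and 1/j *)

Section JSeries.
Local Notation A := (fps int).

(* q times the q-expansion of j. *)
Definition jtail : A := eisQ ^+ 3 * fps_inv delta_unit.

(* The q-expansion of 1 / j. *)
Definition tser : A := fX * delta_unit * fps_inv eisQ ^+ 3.

Lemma fps_exp (a : pseries) k : Fps (ps_exp a k) = Fps a ^+ k :> A.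
Proof.
elim: k => [|k IH]; first by apply: fpsP => n; rewrite expr0 fcoef1.
by rewrite exprS -IH; apply: fpsP => n; rewrite fcoefM.
Qed.

Lemma fps_tail_j : Fps (tail j_series) = jtail.
Proof.
have Q : Fps E4 = eisQ.
  apply: fpsP => n; rewrite /eisQ fcoefD fcoef1 fcoef_natM /= /E4.
  by case: eqP => //= _; rewrite add0r.
by rewrite /jtail -Q -fps_exp; apply: fpsP => n; rewrite fcoefM.
Qed.

Lemma jtail_tser : jtail * tser = fX.
Proof.
have Qi := fps_mulV eisQ0; have Di := fps_mulV delta_unit0.
rewrite /jtail /tser; move: (fps_inv _) (fps_inv _) Qi Di => di qi Qi Di.
transitivity (fX * (delta_unit * di) * (eisQ * qi) ^+ 3); first by ring.
by rewrite Qi Di; ring.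
Qed.

Lemma jtail0 : fcoef jtail 0 = 1.
Proof. by rewrite /jtail fcoefM0 fcoefX0 eisQ0 fps_inv0 expr1n mulr1. Qed.

Lemma theta_jtail : theta jtail = jtail - jtail * eisR * fps_inv eisQ.
Proof.
have Qi := fps_mulV eisQ0; have Di := fps_mulV delta_unit0.
have DJ : delta_unit * jtail = eisQ ^+ 3.
  by rewrite /jtail mulrCA Di mulr1.
apply: (fps_mulI1 delta_unit0).
have := congr1 (@theta int) DJ; rewrite thetaM theta_delta_unit thetaX /= => E.
have TQ := theta_eisQ.
move: E DJ TQ Qi; move: (theta jtail) (theta eisQ) (fps_inv eisQ) => tj tq i E DJ TQ Qi.
have -> : delta_unit * tj = 3 * eisQ ^+ 2 * tq - (eisP - 1) * (delta_unit * jtail).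
  by rewrite -E; ring.
have -> : delta_unit * (jtail - jtail * eisR * i) = (delta_unit * jtail) * (1 - eisR * i) by ring.
rewrite DJ; move: Qi TQ; move: eisP eisQ eisR => P q r Qi TQ.
transitivity (q ^+ 2 * (3 * tq) - (P - 1) * q ^+ 3); first by ring.
by rewrite TQ; apply: (lin_comb (c := q ^+ 2 * r) Qi); ring.
Qed.

Lemma theta_tser : theta tser = tser * eisR * fps_inv eisQ.
Proof.
have := congr1 (@theta int) jtail_tser; rewrite thetaM theta_jtail theta_fX -jtail_tser => E.
apply: (fps_mulI1 jtail0).
by move: (jtail) (tser) (theta tser) (fps_inv _) eisR E => j t tt i r E;
  apply: (lin_comb (c := 1) E); ring.
Qed.

Lemma one_sub_tser : 1 - 1728 * tser = eisR ^+ 2 * fps_inv eisQ ^+ 3.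
Proof.
have Qi := fps_mulV eisQ0; have E := eisQ3_eisR2.
rewrite /tser; move: Qi E; move: (fX * delta_unit) (fps_inv eisQ) => d i.
move: eisQ eisR => q r Qi E.
have {}Qi : q ^+ 3 * i ^+ 3 = 1 by rewrite -exprMn Qi expr1n.
transitivity (q ^+ 3 * i ^+ 3 - 1728 * (d * i ^+ 3)); first by rewrite Qi.
by apply: (lin_comb (c := i ^+ 3) E); ring.
Qed.

End JSeries.

Section HasseScale.
Variable R : comNzRingType.

(** With x, al and be of weights 1, 2 and 3, the coefficient of X^k in the n-th iterate is isobaric
    of weight n + 1 - k. *)
Lemma hasse_scale (mu al be : R) N :
  mu * hasse (mu ^+ 2 * al) (mu ^+ 3 * be) N = mu ^+ N.+1 * hasse al be N.
Proof.
suff E n k : (iter n (cop (mu ^+ 2 * al) (mu ^+ 3 * be)) 'X)`_k * mu ^+ k =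
    mu ^+ n.+1 * (iter n (cop al be) 'X)`_k.
  by rewrite -(E N 1%N) expr1 mulrC.
elim: n k => [|n IH] k.
  by rewrite /= coefX; case: eqP => [->|_]; rewrite ?mul0r ?mulr0 // mulrC.
rewrite !iterS !coef_cop [RHS]mulrDr [in RHS]mulrDr !mulrDl.
have e1 := IH k.+1; have e2 := IH k.+2.
congr (_ + _ + _).
- case: k {e1 e2} => [|k]; first by rewrite mul0r mulr0.
  have := IH k; move: (2 * _ * _) (_`_k) (_`_k) => m c d e.
  by apply: (lin_comb (c := m * mu) e); rewrite !exprS; ring.
- by apply: (lin_comb (c := al * (2 * k.+1%:R * (2 * k%:R + 1)) * mu) e1); rewrite !exprS; ring.
- by apply: (lin_comb (c := be * (4 * k.+1%:R * k.+2%:R) * mu) e2); rewrite !exprS; ring.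
Qed.

End HasseScale.

(** The weight count of [hasse_scale] again: the coefficients al and be have degree less than their
    weights 2 and 3, so the degree in t of the k-th coefficient stays within its weight n + 1 -
    k. *)
Lemma size_hasse (R : idomainType) (al be : {poly R}) N :
  (size al <= 2)%N -> (size be <= 3)%N -> (size (hasse al be N) <= N.+1)%N.
Proof.
move=> sa sb; suff E n k : (size ((iter n (cop al be) 'X)`_k)%R <= n.+2 - k)%N.
  by have := E N 1%N; rewrite subSS subn0.
have sM (a b : {poly R}) m : (0 < m)%N -> (size a <= m.+1)%N -> forall l, (size b <= l - m)%N -> (size (a * b)%R <= l)%N.
  move=> m0 am l bl; case: (eqVneq b 0) => [->|b0]; first by rewrite mulr0 size_poly0.
  have := size_polyMleq a b; have : (0 < size b)%N by rewrite size_poly_gt0.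
  by move: (size _) (size _) (size _) am bl => x y z; lia.
have sN (a : {poly R}) (m : nat) : (size (a * m%:R)%R <= size a)%N.
  by rewrite mulr_natr -scaler_nat size_scale_leq.
have sN2 (a : {poly R}) (m : nat) : (size (m%:R * a)%R <= size a)%N by rewrite mulrC.
elim: n k => [|n IH] k.
  by rewrite /= coefX; case: eqP => [->|_] /=; rewrite ?size_poly1 ?size_poly0.
rewrite iterS coef_cop.
apply: (leq_trans (size_polyD _ _)); rewrite geq_max; apply/andP; split.
  apply: (leq_trans (size_polyD _ _)); rewrite geq_max; apply/andP; split.
    case: k => [|k]; first by rewrite size_poly0.
    have -> : 2 * k%:R * (2 * k%:R + 1) = (2 * k * (2 * k + 1))%N%:R :> {poly R}.
      by rewrite natrM natrD !natrM.
    rewrite subSS.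
    exact: leq_trans (sN2 _ _) (IH k).
  apply: (sM _ _ 1%N) => //; last by apply: leq_trans (IH k.+1) _; lia.
  have -> : 2 * k.+1%:R * (2 * k%:R + 1) = (2 * k.+1 * (2 * k + 1))%N%:R :> {poly R}.
    by rewrite natrM natrD !natrM.
  exact: leq_trans (sN _ _) sa.
apply: (sM _ _ 2%N) => //; last by apply: leq_trans (IH k.+2) _; lia.
rewrite -!natrM; exact: leq_trans (sN _ _) sb.
Qed.

Section EvalT.
Variable R : comNzRingType.
Local Notation A := (fps R).

Lemma fps_const_is_zmod_morphism : zmod_morphism (@fps_const R).
Proof.
move=> a b; apply: fpsP => n; rewrite fcoefB !fcoef_const.
by case: eqP => // _; rewrite subrr.
Qed.
HB.instance Definition _ :=
  GRing.isZmodMorphism.Build R A (@fps_const R) fps_const_is_zmod_morphism.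

Lemma fps_const_is_monoid_morphism : monoid_morphism (@fps_const R).
Proof.
split; first by apply: fpsP => n; rewrite fcoef1 fcoef_const; case: eqP.
move=> a b; apply: fpsP => n; rewrite fcoef_constM !fcoef_const.
by case: eqP => // _; rewrite mulr0.
Qed.
HB.instance Definition _ :=
  GRing.isMonoidMorphism.Build R A (@fps_const R) fps_const_is_monoid_morphism.

Lemma theta_const (c : R) : theta (fps_const c) = 0.
Proof.
apply: fpsP => n; rewrite fcoef_theta fcoef_const fcoef0.
by case: eqP => [->|_]; rewrite ?mul0r ?mulr0.
Qed.

Definition fps_eval (t : A) (g : {poly R}) : A := (map_poly (@fps_const R) g).[t].

Variable t : A.

Lemma fps_eval_is_zmod_morphism : zmod_morphism (fps_eval t).
Proof. by move=> g h; rewrite /fps_eval rmorphB hornerD hornerN. Qed.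
HB.instance Definition _ :=
  GRing.isZmodMorphism.Build {poly R} A (fps_eval t) fps_eval_is_zmod_morphism.

Lemma fps_eval_is_monoid_morphism : monoid_morphism (fps_eval t).
Proof.
by split=> [|g h]; rewrite /fps_eval ?rmorph1 ?hornerC // rmorphM hornerM.
Qed.
HB.instance Definition _ :=
  GRing.isMonoidMorphism.Build {poly R} A (fps_eval t) fps_eval_is_monoid_morphism.

Lemma fps_evalC c : fps_eval t c%:P = fps_const c.
Proof. by rewrite /fps_eval map_polyC hornerC. Qed.

Lemma fps_evalX : fps_eval t 'X = t.
Proof. by rewrite /fps_eval map_polyX hornerX. Qed.

Lemma fps_evalMXaddC g c : fps_eval t (g * 'X + c%:P) = fps_eval t g * t + fps_const c.
Proof. by rewrite rmorphD rmorphM /= fps_evalC fps_evalX. Qed.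

Lemma theta_fps_eval g : theta (fps_eval t g) = fps_eval t g^`() * theta t.
Proof.
elim/poly_ind: g => [|g c IH]; first by rewrite deriv0 !raddf0 mul0r.
rewrite derivD derivM derivX derivC mulr1 addr0.
rewrite fps_evalMXaddC rmorphD rmorphM /= fps_evalX raddfD /= thetaM IH theta_const addr0.
by move: (fps_eval t g) (fps_eval t _) => a b; ring.
Qed.

Lemma fps_eval_inj g : fcoef t 0 = 0 -> (forall s, t * s = 0 -> s = 0) ->
  fps_eval t g = 0 -> g = 0.
Proof.
move=> t0 treg; elim/poly_ind: g => [|g c IH] // e.
move: e; rewrite fps_evalMXaddC => e.
have c0 : c = 0.
  have := congr1 (fun s => fcoef s 0) e.
  by rewrite fcoefD fcoefM0 t0 mulr0 add0r fcoef_const fcoef0.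
have g0 : g = 0.
  by apply: IH; apply: treg; move: e; rewrite c0 rmorph0 addr0 mulrC.
by rewrite c0 g0 mul0r addr0.
Qed.

Lemma fps_eval_coef (g : {poly R}) n : (size g <= n)%N ->
  fps_eval t g = \sum_(i < n) fps_const g`_i * t ^+ i.
Proof.
move=> gn; rewrite /fps_eval (@horner_coef_wide _ n).
  by apply: eq_bigr => i _; rewrite coef_map.
by apply: leq_trans gn; apply: size_poly.
Qed.

End EvalT.

(** * The polynomial H evaluated at 1/j *)

Section HassePolynomial.
Variables (R : fieldType) (p N : nat).
Hypotheses (pR : p \in [pchar R]) (pN : p = N.*2.+1) (p3 : (3 < p)%N).
Local Notation A := (fps R).

Definition cusp_poly : {poly R} := 1 - 1728 * 'X.

(* The Hasse invariant of the curve y^2 = x^3 - 3 c x + 2 c^2, where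
   c = 1 - 1728 t, whose j-invariant is 1 / t. *)
Definition hpoly : {poly R} := hasse (- 3 * cusp_poly) (2 * cusp_poly ^+ 2) N.

Definition tserR : A := fps_map intr tser.
Definition jtailR : A := fps_map intr jtail.
Definition eisQV : A := fps_map intr (fps_inv eisQ).

Local Notation t := tserR.
Local Notation Q := (eisQR R).
Local Notation S := (eisRR R).
Local Notation P := (eisPR R).
Local Notation i := eisQV.

Lemma eisQRV : Q * i = 1.
Proof. by rewrite /eisQR /i -rmorphM (fps_mulV eisQ0) rmorph1. Qed.

Lemma eisQR0 : fcoef Q 0 = 1. Proof. by rewrite /= eisQ0. Qed.
Lemma eisRR0 : fcoef S 0 = 1. Proof. by rewrite /= eisR0. Qed.
Lemma eisQV0 : fcoef i 0 = 1. Proof. by []. Qed.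

Lemma jtR : jtailR * t = fX.
Proof. by rewrite -rmorphM jtail_tser; apply: (fps_map_fX intr). Qed.

Lemma jtailR0 : fcoef jtailR 0 = 1. Proof. by rewrite /= jtail0. Qed.

Lemma tserR0 : fcoef t 0 = 0.
Proof.
by have := congr1 (fun s => fcoef s 0) jtR; rewrite fcoefM0 jtailR0 mul1r fcoef_fX.
Qed.

Lemma tserR_reg (s : A) : t * s = 0 -> s = 0.
Proof.
move=> ts; have : fX * s = 0 by rewrite -jtR -mulrA ts mulr0.
move=> e; apply: fpsP => n; have := congr1 (fun s => fcoef s n.+1) e.
by rewrite -[fX]expr1 fcoefXM /= subn1 /= => ->; rewrite !fcoef0.
Qed.

Lemma one_sub_tserR : 1 - 1728 * t = S ^+ 2 * i ^+ 3.
Proof.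
have := congr1 (fps_map intr : _ -> A) one_sub_tser.
by rewrite rmorphB rmorph1 (rmorphM _ 1728) rmorph_nat (rmorphM _ (eisR ^+ 2)) !rmorphXn.
Qed.

Lemma thetaP : 12 * theta P = P ^+ 2 - Q.
Proof.
have := congr1 (fps_map intr : _ -> A) theta_eisP.
by rewrite rmorphB (rmorphM _ 12) rmorph_nat rmorphXn /= fps_map_theta.
Qed.

Lemma thetaQ : 3 * theta Q = P * Q - S.
Proof.
have := congr1 (fps_map intr : _ -> A) theta_eisQ.
by rewrite rmorphB (rmorphM _ 3) (rmorphM _ eisP) rmorph_nat /= fps_map_theta.
Qed.

Lemma thetaR : 2 * theta S = P * S - Q ^+ 2.
Proof.
have := congr1 (fps_map intr : _ -> A) theta_eisR.
by rewrite rmorphB (rmorphM _ 2) (rmorphM _ eisP) rmorphXn rmorph_nat /= fps_map_theta.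
Qed.

Lemma theta_t : theta t = t * S * i.
Proof. by rewrite /t -fps_map_theta theta_tser !rmorphM. Qed.

Lemma cusp_poly_eval : fps_eval t cusp_poly = S ^+ 2 * i ^+ 3.
Proof. by rewrite /cusp_poly rmorphB rmorphM rmorph1 rmorph_nat /= fps_evalX one_sub_tserR. Qed.

(** At t = 1/j one has c = E6^2 / E4^3, so the twist by mu = E6 / E4^2 carries -3 E4 and 2 E6 to -3c
    and 2c^2; [hasse_scale] and [tate_hasse] then give the value. *)
Lemma hpoly_eval : fps_eval t hpoly = 12 ^+ N * (S * i ^+ 2) ^+ N.
Proof.
rewrite /hpoly -hasse_map /=.
have -> : fps_eval t (- 3 * cusp_poly) = (S * i ^+ 2) ^+ 2 * (- 3 * Q).
  rewrite rmorphM rmorphN rmorph_nat /= cusp_poly_eval.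
  by apply: (lin_comb (c := 3 * S ^+ 2 * i ^+ 3) eisQRV); ring.
have -> : fps_eval t (2 * cusp_poly ^+ 2) = (S * i ^+ 2) ^+ 3 * (2 * S).
  by rewrite rmorphM rmorphXn rmorph_nat /= cusp_poly_eval; ring.
have m0 : fcoef (S * i ^+ 2) 0 = 1.
  by rewrite fcoefM0 fcoefX0 eisRR0 eisQV0 expr1n mulr1.
apply: (fps_mulI1 m0); rewrite hasse_scale (tate_hasse pR pN p3) exprS; ring.
Qed.

Let pA : p%:R = 0 :> A.
Proof. exact: pcharf0 (fps_pchar pR). Qed.

(** Modulo p the exponent N acts as -1/2, so under theta the series h0 behaves like E4 / sqrt(E6).
    Ramanujan's equations turn its logarithmic derivative into a first-order relation containing P;
    differentiating once more allows P to be eliminated, which leaves an equation of the same shape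
    for every p. *)
Lemma hpoly_ode_series (h0 h1 h2 : A) :
  h0 = fps_eval t hpoly -> theta h0 = h1 * theta t -> theta h1 = h2 * theta t ->
  144 * t ^+ 2 * S ^+ 4 * h2 + t * (288 * S ^+ 4 - 144 * S ^+ 2 * Q ^+ 3) * h1 =
  h0 * (9 * Q ^+ 6 + 23 * S ^+ 2 * Q ^+ 3 - 32 * S ^+ 4).
Proof.
move=> h0E th0 th1.
have tt : Q * theta t = t * S.
  by rewrite theta_t; apply: (lin_comb (c := t * S) eisQRV); ring.
have h0Q : h0 * Q ^+ N.*2 = 12 ^+ N * S ^+ N.
  rewrite h0E hpoly_eval -mul2n exprM.
  have e : (i ^+ 2) ^+ N * (Q ^+ 2) ^+ N = 1.
    by rewrite -exprMn -exprMn [i * Q]mulrC eisQRV !expr1n.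
  by rewrite exprMn; apply: (lin_comb (c := 12 ^+ N * S ^+ N) e); ring.
have N0 : (0 < N)%N by move: p3; rewrite pN; case: N.
have pN1 : N.*2%:R + 1 = 0 :> A by rewrite natr1 -pN pA.
have thQ : 2 * Q * S * theta h0 = 2 * h0 * S * theta Q - h0 * Q * theta S.
  have q1 : fcoef (Q ^+ N.*2) 0 = 1 by rewrite fcoefX0 eisQR0 expr1n.
  have := congr1 (@theta R) h0Q.
  rewrite thetaM -(natrX _ 12 N) thetaM theta_nat mul0r add0r !thetaX natrX => E.
  (* From p = 2N + 1 = 0 in characteristic p. *)
  have hN2 : N.*2%:R = - 1 :> A by apply/eqP; rewrite -addr_eq0 pN1.
  have hN : 2 * N%:R = - 1 :> A by rewrite -hN2 -mul2n natrM.
  have hy : Q ^+ N.*2 = Q * Q ^+ N.*2.-1.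
    by rewrite -exprS prednK // double_gt0.
  have hx : S ^+ N = S * S ^+ N.-1 by rewrite -exprS prednK.
  apply: (fps_mulI1 q1); move: E h0Q; rewrite hN2 hy hx.
  move: (Q ^+ _) (S ^+ _) (12 ^+ N) (theta h0) (theta Q) (theta S) => y x C th tq ts E h.
  have E' : th * (Q * y) = C * (N%:R * x * ts) - h0 * (- 1 * y * tq) by rewrite -E; ring.
  transitivity (2 * Q * S * (th * (Q * y))); first by ring.
  rewrite E'.
  transitivity (Q * (2 * N%:R) * (C * (S * x)) * ts + 2 * Q * S * h0 * y * tq); first by ring.
  by rewrite hN -h; ring.
have E1 : 12 * t * S ^+ 2 * h1 = h0 * (P * S * Q + 3 * Q ^+ 3 - 4 * S ^+ 2).
  transitivity (12 * S * (t * S) * h1); first by ring.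
  rewrite -tt.
  transitivity (6 * (2 * Q * S * theta h0)); first by rewrite th0; ring.
  rewrite thQ.
  transitivity (h0 * (4 * S * (3 * theta Q) - 3 * Q * (2 * theta S))); first by ring.
  by rewrite thetaQ thetaR; ring.
have thL : theta (12 * t * S ^+ 2 * h1) =
    12 * (theta t * S ^+ 2 * h1 + t * (2 * S * theta S) * h1 + t * S ^+ 2 * theta h1).
  by rewrite !thetaM (theta_nat _ 12); ring.
have thM : theta (h0 * (P * S * Q + 3 * Q ^+ 3 - 4 * S ^+ 2)) =
    theta h0 * (P * S * Q + 3 * Q ^+ 3 - 4 * S ^+ 2) + h0 * (theta P * S * Q
      + P * theta S * Q + P * S * theta Q + 9 * Q ^+ 2 * theta Q - 8 * S * theta S).
  by rewrite thetaM raddfB raddfD /= !thetaM (theta_nat _ 3) (theta_nat _ 4); ring.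
have := congr1 (@theta R) E1; rewrite thL thM th0 th1 {thL thM}.
have tP := thetaP; have tQ := thetaQ; have tR := thetaR.
move: tt tP tQ tR E1; move: (theta t) (theta P) (theta Q) (theta S) => T tP tq ts; move: t => u.
move: P Q S => P' q a hT hP hq ha E1 E2.
have E2q : 144 * ((q * T) * a ^+ 2 * h1 + q * u * a * (2 * ts) * h1 + u * a ^+ 2 * h2 * (q * T))
  = 12 * h1 * (q * T) * (P' * a * q + 3 * q ^+ 3 - 4 * a ^+ 2)
  + q * h0 * ((12 * tP) * a * q + 6 * P' * (2 * ts) * q
      + 4 * (P' * a + 9 * q ^+ 2) * (3 * tq) - 48 * a * (2 * ts)).
  by apply: (lin_comb (c := 12 * q) E2); ring.
rewrite hT hP hq ha in E2q.
(* E6 times the differentiated relation plus the multiple of E1 chosen so that all occurrences of P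
   cancel. *)
have E3 : a * (144 * (u * a * a ^+ 2 * h1 + q * u * a * (P' * a - q ^+ 2) * h1 + u * a ^+ 2 * h2 * (u * a)))
   - (11 * P' * a * q) * (12 * u * a ^+ 2 * h1) + (3 * q ^+ 3 + 8 * a ^+ 2) * (12 * u * a ^+ 2 * h1)
   = a * (12 * h1 * (u * a) * (P' * a * q + 3 * q ^+ 3 - 4 * a ^+ 2)
  + q * h0 * ((P' ^+ 2 - q) * a * q + 6 * P' * (P' * a - q ^+ 2) * q
      + 4 * (P' * a + 9 * q ^+ 2) * (P' * q - a) - 48 * a * (P' * a - q ^+ 2)))
   + (3 * q ^+ 3 + 8 * a ^+ 2 - 11 * P' * a * q) * (h0 * (P' * a * q + 3 * q ^+ 3 - 4 * a ^+ 2)).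
  by rewrite E2q E1; ring.
by apply: (lin_comb (c := 1) E3); ring.
Qed.

End HassePolynomial.

(** * The differential equation of H and its simple roots *)

Section HassePolynomialRoots.
Variables (R : fieldType) (p N : nat).
Hypotheses (pR : p \in [pchar R]) (pN : p = N.*2.+1) (p3 : (3 < p)%N).
Local Notation A := (fps R).
Local Notation c := (cusp_poly R).
Local Notation H := (hpoly R N).
Local Notation t := (tserR R).

Lemma nat12_reg (S : comNzRingType) : p \in [pchar S] -> GRing.lreg (12%:R : S).
Proof.
move=> pS x y e; have r := @natr_lreg S p pS.
have r2 : (0 < 2 < p)%N by lia.
have r3 : (0 < 3 < p)%N by lia.
by apply: (r _ r2); apply: (r _ r2); apply: (r _ r3); rewrite !mulrA -!natrM.
Qed.

Lemma size_hpoly : (size H <= N.+1)%N.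
Proof.
have sc : (size c <= 2)%N.
  have -> : c = (- 1728%:R)%:P * 'X + 1%:P.
    by rewrite /cusp_poly polyCN polyC_natr; ring.
  rewrite size_MXaddC; case: ifP => //= _.
  by rewrite ltnS size_polyC_leq1.
apply: size_hasse.
  by rewrite mulNr size_polyN mulr_natl -scaler_nat (leq_trans (size_scale_leq _ _)).
rewrite mulr_natl -scaler_nat (leq_trans (size_scale_leq _ _)) //.
rewrite expr2 (leq_trans (size_polyMleq _ _)) //.
by case: (size _) sc => [|[|[|]]].
Qed.

(** Division by E4^6 turns the series identity into one of weight 0, where E6^2 / E4^3 is the value
    of c. After cancelling 144 and t it is a polynomial relation in t, and evaluation at t is
    injective. *)
Lemma hpoly_ode :
  'X * c ^+ 2 * H^`()^`() + c * (1 - 3456 * 'X) * H^`() - 12 * (32 * c + 9) * H = 0.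
Proof.
have th g := theta_fps_eval t g.
have := hpoly_ode_series pR pN p3 (erefl _) (th _) (th _).
have := cusp_poly_eval R; have := one_sub_tserR R; have := eisQRV R.
set h0 := fps_eval t H; set h1 := fps_eval t H^`(); set h2 := fps_eval t H^`()^`().
move: (eisQR R) (eisRR R) (eisQV R) => q a i qi ct cE E.
have {}E : 144 * (t * (t * fps_eval t c ^+ 2 * h2
     + fps_eval t c * (1 - 3456 * t) * h1 - 12 * (32 * fps_eval t c + 9) * h0)) = 0.
  rewrite cE; have q3 : q ^+ 3 * i ^+ 3 = 1 by rewrite -exprMn qi expr1n.
  have E6 : 144 * t ^+ 2 * (a ^+ 2 * i ^+ 3) ^+ 2 * h2
    + t * (288 * (a ^+ 2 * i ^+ 3) ^+ 2 - 144 * (a ^+ 2 * i ^+ 3) * (q ^+ 3 * i ^+ 3)) * h1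
    = h0 * (9 * (q ^+ 3 * i ^+ 3) ^+ 2 + 23 * (a ^+ 2 * i ^+ 3) * (q ^+ 3 * i ^+ 3)
            - 32 * (a ^+ 2 * i ^+ 3) ^+ 2).
    by apply: (lin_comb (c := i ^+ 6) E); ring.
  rewrite q3 in E6; move: E6; rewrite -ct => E6.
  by apply: (lin_comb (c := 1) E6); ring.
have r12 := nat12_reg (fps_pchar pR).
have {}E : t * (t * fps_eval t c ^+ 2 * h2
     + fps_eval t c * (1 - 3456 * t) * h1 - 12 * (32 * fps_eval t c + 9) * h0) = 0.
  by apply: (r12); apply: (r12); rewrite !mulr0 -E; ring.
have {}E := tserR_reg E.
apply: (fps_eval_inj (tserR0 R) (@tserR_reg R)); rewrite -[RHS]E.
have gen (phi : {rmorphism {poly R} -> A}) (x d g0 g1 g2 : {poly R}) :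
   phi (x * d ^+ 2 * g2 + d * (1 - 3456 * x) * g1 - 12 * (32 * d + 9) * g0) =
   phi x * phi d ^+ 2 * phi g2 + phi d * (1 - 3456 * phi x) * phi g1
   - 12 * (32 * phi d + 9) * phi g0.
  rewrite !expr2 rmorphB rmorphD !rmorphM !rmorph_nat rmorphB rmorphD !rmorphM.
  by rewrite !rmorph_nat rmorph1.
by rewrite gen /= fps_evalX.
Qed.

Lemma fps_eval0 g : fcoef (fps_eval t g) 0 = g.[0].
Proof.
elim/poly_ind: g => [|g d _]; first by rewrite raddf0 fcoef0 horner0.
by rewrite fps_evalMXaddC fcoefD fcoefM0 (tserR0 R) mulr0 add0r fcoef_const hornerMXaddC mulr0 add0r.
Qed.

Lemma hpoly0 : H.[0] != 0.
Proof.
have r12 := nat12_reg pR.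
rewrite -fps_eval0 (hpoly_eval pR pN p3) fcoefM0 !fcoefX0 fcoefM0 fcoefX0 eisRR0 eisQV0.
rewrite fcoef_nat /= expr1n mulr1 expr1n mulr1 expf_neq0 //; apply/eqP => e.
by have := oner_neq0 R; rewrite (r12 1 0) ?eqxx // mulr0 mulr1.
Qed.

Lemma hpoly_sqr :
  (eisRR R * eisQV R) ^+ p.-1 * fps_eval t H ^+ 2 = fps_eval t c ^+ p.-1.
Proof.
have p12 : 12 ^+ p.-1 = 1 :> A.
  have r12 := nat12_reg (fps_pchar pR); apply: r12.
  by rewrite mulr1 -exprS pN -pN -(pFrobenius_autE (fps_pchar pR)) rmorph_nat.
rewrite (hpoly_eval pR pN p3) cusp_poly_eval.
move: p12; have -> : p.-1 = (N * 2)%N by rewrite pN muln2.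
rewrite exprM => p12; rewrite [(12 ^+ N * _) ^+ 2]exprMn p12 mul1r -(exprM _ N 2) -exprMn.
by congr (_ ^+ _); ring.
Qed.

End HassePolynomialRoots.

Lemma deriv2_mul_exp (R : comNzRingType) (q y : {poly R}) m : y^`() = 1 ->
  (q * y ^+ m.+2)^`() = q^`() * y ^+ m.+2 + m.+2%:R * q * y ^+ m.+1 /\
  (q * y ^+ m.+2)^`()^`() =
    y ^+ m * (q^`()^`() * y ^+ 2 + 2 * m.+2%:R * q^`() * y + m.+2%:R * m.+1%:R * q).
Proof.
move=> dy; have H1 : (q * y ^+ m.+2)^`() = q^`() * y ^+ m.+2 + m.+2%:R * q * y ^+ m.+1.
  by rewrite derivM deriv_exp dy mul1r /=; ring.
split=> //; have dn : (m.+2%:R : {poly R})^`() = 0 by rewrite -polyC_natr derivC.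
rewrite H1 derivD (derivM q^`()) (derivM (m.+2%:R * q)) (derivM m.+2%:R) dn.
by rewrite !deriv_exp dy /= !exprS; ring.
Qed.

(** At a root of multiplicity m + 2 the lowest-order term of the equation is t0 c(t0)^2 (m+2)(m+1)
    q(t0). It does not vanish, because the multiplicity is at most N < p. *)
Lemma ode_simple_root (L : fieldType) p N (H c B C : {poly L}) (t0 : L) :
  p \in [pchar L] -> (N < p)%N -> (size H <= N.+1)%N -> H != 0 -> t0 != 0 ->
  'X * c ^+ 2 * H^`()^`() + B * H^`() - C * H = 0 ->
  ~~ root c t0 -> ~~ (('X - t0%:P) ^+ 2 %| H).
Proof.
move=> pL Np sH H0 t00 ode ct0; apply/negP => d2.
have [n [q]] := multiplicity_XsubC H t0; rewrite H0 /= => qt0 HE.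
have n2 : (2 <= n)%N.
  rewrite leqNgt; apply/negP => n1; case/negP: qt0.
  rewrite -dvdp_XsubCl; case: n n1 HE => [|[|//]] _ HE.
    by rewrite -[q]mulr1 -[1](expr0 ('X - t0%:P)) -HE; apply: dvdp_trans d2; rewrite expr2 dvdp_mulr.
  by move: d2; rewrite HE expr1 expr2 dvdp_mul2r // polyXsubC_eq0.
have nN : (n <= N)%N.
  have := sH; rewrite HE size_Mmonic ?monic_exp ?monicXsubC //; last first.
    by apply: contraNneq qt0 => ->; rewrite root0.
  rewrite size_exp_XsubC; have : (0 < size q)%N.
    by rewrite size_poly_gt0; apply: contraNneq qt0 => ->; rewrite root0.
  by move: (size q) => s; lia.
case: n n2 nN HE => [|[|m]] // _ nN HE.
set y := 'X - t0%:P in HE; have y0 : y ^+ m != 0 by rewrite expf_neq0 // polyXsubC_eq0.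
have dy : y^`() = 1 by rewrite /y derivB derivX derivC subr0.
have [H1 H2] := deriv2_mul_exp q m dy; rewrite -HE in H1 H2.
have : y ^+ m * ('X * c ^+ 2 * (q^`()^`() * y ^+ 2 + 2 * m.+2%:R * q^`() * y + m.+2%:R * m.+1%:R * q)
   + B * (q^`() * y ^+ 2 + m.+2%:R * q * y) - C * (q * y ^+ 2)) = 0.
  by rewrite -[RHS]ode H2 H1 HE !exprS; ring.
move/eqP; rewrite mulf_eq0 (negPf y0) /= => /eqP/(congr1 (horner^~ t0)).
have yt : y.[t0] = 0 by rewrite /y hornerXsubC subrr.
clearbody y.
have hn k : (k%:R : {poly L}).[t0] = k%:R by rewrite -polyC_natr hornerC.
rewrite /= hornerD hornerN hornerD !hornerM !hornerD !hornerM !hornerX !hn yt horner0 => e.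
have {}e : t0 * c.[t0] ^+ 2 * (m.+2%:R * m.+1%:R * q.[t0]) = 0 by rewrite -[RHS]e; ring.
rewrite rootE in ct0; rewrite rootE in qt0.
move/eqP: e; rewrite !mulf_eq0 (negPf t00) (negPf ct0) /=.
have nz k : (0 < k < p)%N -> (k%:R : L) == 0 = false.
  move=> kp; apply/negP => /eqP e; have r := @natr_lreg L p pL _ kp.
  by have := oner_neq0 L; rewrite (r 1 0) ?eqxx // mulr0 mulr1.
by rewrite !nz ?(negPf qt0) //; lia.
Qed.

(** * The operator U(p) *)

Section UOperator.
Variables (p : nat) (pp : prime p).
Local Notation R := ('F_p).
Local Notation A := (fps R).

Let pR : p \in [pchar R]. Proof. exact: pchar_Fp. Qed.
Let pA : p \in [pchar A]. Proof. exact: fps_pchar pR. Qed.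
Let p0 : (0 < p)%N. Proof. exact: prime_gt0. Qed.

Definition fU (s : A) : A := Fps (fun n => fcoef s (p * n)%N).

Lemma fU_is_zmod_morphism : zmod_morphism fU.
Proof. by move=> s t; apply: fpsP => n; rewrite fcoefB /= fcoefB. Qed.
HB.instance Definition _ := GRing.isZmodMorphism.Build A A fU fU_is_zmod_morphism.

Lemma Fp_expp (a : R) : a ^+ p = a.
Proof. by have := expf_card a; rewrite card_Fp. Qed.

Lemma const_expp (a : R) : fps_const a ^+ p = fps_const a :> A.
Proof. by rewrite -(rmorphXn (@fps_const R)) Fp_expp. Qed.

Definition fps_trunc M (s : A) : A := \sum_(i < M.+1) fps_const (fcoef s i) * fX ^+ i.

Lemma fcoef_const_fX (a : R) k n : fcoef (fps_const a * fX ^+ k) n = if n == k then a else 0.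
Proof. by rewrite fcoef_constM fcoefX; case: eqP; rewrite ?mulr1 ?mulr0. Qed.

Lemma eqm_fps_trunc M (s : A) : eqm M s (fps_trunc M s).
Proof.
split=> n nM; rewrite fcoef_sum (bigD1 (Ordinal (nM : (n < M.+1)%N))) //=.
rewrite fcoef_const_fX eqxx big1 ?addr0 // => i.
by rewrite -val_eqE fcoef_const_fX eq_sym /= => /negPf ->.
Qed.

Lemma eqm_exp M (s t : A) k : eqm M s t -> eqm M (s ^+ k) (t ^+ k).
Proof. by move=> st; elim: k => [|k IH]; rewrite ?expr0 // !exprS; apply: eqmM. Qed.

(** Over F_p one has s(q)^p = s(q^p). Frobenius is additive on finite sums, hence the passage to a
    truncation. *)
Lemma fcoef_expp (s : A) n :
  fcoef (s ^+ p) n = if (p %| n)%N then fcoef s (n %/ p) else 0.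
Proof.
rewrite (eqmE (eqm_exp p (@eqm_fps_trunc n s))) //.
rewrite -(pFrobenius_autE pA) /fps_trunc rmorph_sum fcoef_sum.
under eq_bigr => i _ do rewrite /= pFrobenius_autE exprMn const_expp -exprM fcoef_const_fX.
case: ifP => [pn|/negP pn]; last first.
  by rewrite big1 // => i _; case: eqP => // e; case: pn; rewrite e dvdn_mull.
have le : (n %/ p < n.+1)%N by rewrite ltnS leq_div.
rewrite (bigD1 (Ordinal le)) //= divnK // eqxx big1 ?addr0 // => i.
rewrite -val_eqE /= => /negP ne; case: eqP => // e; case: ne.
by have := mulnK i p0; rewrite -e => ->.
Qed.

Lemma fUM (s g : A) : fU (s ^+ p * g) = s * fU g.
Proof.
apply: fpsP => n; rewrite /= !fcoefM.
rewrite (eq_bigr (fun i : 'I_(p * n).+1 => \sum_(j < n.+1 | i == (p * j)%N :> nat)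
    fcoef s j * fcoef (fU g) (n - j))); last first.
  case=> i ilt _ /=; rewrite fcoef_expp; case: ifP => [pi|/negP pi].
    have ip : (p * (i %/ p))%N = i by rewrite mulnC divnK.
    have le : (i %/ p < n.+1)%N by rewrite ltnS -(leq_pmul2l p0) ip -ltnS.
    rewrite (bigD1 (Ordinal le)) /= ?ip // big1 ?addr0 => [|j /andP[/eqP ij]]; last first.
      by rewrite -val_eqE /= ij mulKn ?eqxx.
    by rewrite mulnBr ip.
  rewrite mul0r big1 // => j /eqP ij; case: pi; rewrite ij dvdn_mulr //.
rewrite (exchange_big_dep predT) //=; apply: eq_bigr => j _.
have le : (p * j < (p * n).+1)%N by rewrite ltnS leq_pmul2l // -ltnS.
by rewrite (big_pred1 (Ordinal le)) // => i; rewrite -val_eqE.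
Qed.

Lemma fU_theta (g : A) : fU (theta g) = 0.
Proof.
by apply: fpsP => n; rewrite /= natrM (pcharf0 pR) !mul0r fcoef0.
Qed.

(* Over the integers, theta (s^p) = p s^(p-1) theta s, and p can be cancelled
   in the coefficients of q^(pn). *)
Lemma fU_exp_theta (s : fps int) (sR := fps_map intr s : A) :
  fU (sR ^+ p.-1 * theta sR) = theta sR.
Proof.
apply: fpsP => n.
have e : fcoef (s ^+ p.-1 * theta s) (p * n) = n%:R * fcoef (s ^+ p) (p * n).
  have := congr1 (fun x => fcoef x (p * n)) (thetaX s p).
  rewrite fcoef_theta -mulrA fcoef_natM natrM -mulrA => /mulfI.
  by rewrite pnatr_eq0 -lt0n => /(_ p0) ->.
have -> : sR ^+ p.-1 * theta sR = fps_map intr (s ^+ p.-1 * theta s).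
  by rewrite rmorphM rmorphXn /= fps_map_theta.
rewrite /= e intrM mulrz_nat; congr (_ * _).
transitivity (fcoef (sR ^+ p) (p * n)); first by rewrite -rmorphXn.
by rewrite fcoef_expp dvdn_mulr // mulKn.
Qed.

Local Notation J := (jtailR R).
Local Notation t := (tserR R).
Local Notation S := (eisRR R).
Local Notation i := (eisQV R).

(* q times the q-expansion of theta j *)
Definition jder : A := theta J - J.

Lemma jderE : jder = - (J * S * i).
Proof.
rewrite /jder /J -fps_map_theta theta_jtail rmorphB !rmorphM /=.
by rewrite addrC addKr.
Qed.

Lemma jder0 : fcoef jder 0 = -1.
Proof.
by rewrite jderE fcoefN !fcoefM0 (jtailR0 R) eisRR0 eisQV0 !mulr1.
Qed.

Lemma fU_jder : fU (J ^+ p.-1 * jder) = jder.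
Proof.
rewrite /jder mulrBr raddfB /= fU_exp_theta; congr (_ - _).
have -> : J ^+ p.-1 * J = J ^+ p * 1 by rewrite -exprSr prednK // mulr1.
rewrite fUM (_ : fU 1 = 1) ?mulr1 //.
by apply: fpsP => n; rewrite /= !fcoef1 muln_eq0 eqn0Ngt p0.
Qed.

(** The argument is q^(pk) j^(e-1) theta j, freed of its pole. If p does not divide e it is theta of
    a series divided by e, which U(p) kills; if e = lp, the p-th powers come out and [fU_jder]
    treats j^(p-1) theta j. *)
Lemma fU_term e k : (0 < e)%N -> (e <= p * k)%N ->
  fU (fX ^+ (p * k - e) * J ^+ e.-1 * jder) =
  if (p %| e)%N then fX ^+ (k - e %/ p) * J ^+ (e %/ p).-1 * jder else 0.
Proof.
move=> e0 ek; case: ifP => [|pe].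
  move=> /dvdnP[l el]; rewrite el mulnK //; rewrite el in e0 ek.
  have l0 : (0 < l)%N by case: (l) e0.
  have -> : (p * k - l * p = (k - l) * p)%N by rewrite mulnBl mulnC.
  have -> : (l * p).-1 = (l.-1 * p + p.-1)%N by case: (l) l0 => // l' _; rewrite mulSn; lia.
  rewrite exprD !exprM -!mulrA fUM fUM fU_jder; ring.
have th : theta (fX ^+ (p * k - e) * J ^+ e) = e%:R * (fX ^+ (p * k - e) * J ^+ e.-1 * jder).
  rewrite thetaM theta_fXn natrB // natrM (pcharf0 pA) mul0r sub0r thetaX /jder.
  have -> : J ^+ e = J * J ^+ e.-1 by rewrite -exprS prednK.
  ring.
have := fU_theta (fX ^+ (p * k - e) * J ^+ e); rewrite th mulr_natl raddfMn /= => /eqP E.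
have en : (e%:R : R) != 0 by rewrite -(dvdn_pcharf pR) pe.
apply: fpsP => n; have := congr1 (fun x => fcoef x n) (eqP E).
by rewrite !fcoef0 fcoefMn -mulr_natl => /eqP; rewrite mulf_eq0 (negPf en) /= => /eqP ->.
Qed.

(** The argument is q^(pm) F(j). Multiplied by the p-th power of q theta j, it becomes a combination
    of the terms of [fU_term] with e = m + p - j. The bound on [Bs] keeps e positive, and those with
    e = p(l+1) survive, with coefficient of index m - pl. The factor q theta j is cancelled at the
    end. *)
Lemma fU_poly_j (Fs Bs : {poly R}) m : (size Bs <= m + p)%N ->
  fps_eval t Fs * (S * i) ^+ p.-1 = fps_eval t Bs ->
  fU (fX ^+ (p * m - m) * J ^+ m * fps_eval t Fs) =
  \sum_(l < m.+1 | (p * l <= m)%N) fps_const Bs`_(m - p * l) * (fX ^+ (m - l) * J ^+ l).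
Proof.
move=> sB E; set f := _ * fps_eval t Fs.
have Kreg : GRing.lreg (fcoef jder 0) by rewrite jder0; apply: lregN; apply: lreg1.
apply: (fps_mulI Kreg); rewrite -fUM.
have KE : jder ^+ p = - (J ^+ p * (S * i) ^+ p).
  rewrite jderE -(pFrobenius_autE pA) rmorphN /= pFrobenius_autE -exprMn.
  by congr (- (_ ^+ _)); ring.
have -> : jder ^+ p * f = fX ^+ (p * m - m) * J ^+ (m + p.-1) * fps_eval t Bs * jder.
  rewrite KE /f -E jderE exprD -[p in J ^+ p]prednK // -[p in (S * i) ^+ p]prednK //.
  by rewrite !exprS; ring.
rewrite (fps_eval_coef _ sB) big_distrr big_distrl raddf_sum /=.
pose H (l : nat) := fps_const Bs`_(m - p * l) * (fX ^+ (m - l) * J ^+ l) * jder.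
(* For each j the inner sum has at most one term, the l with m - pl = j; exchanging the sums then
   indexes the result by l. *)
rewrite (eq_bigr (fun j : 'I_(m + p) =>
   \sum_(l < m.+1 | (p * l <= m)%N && (m - p * l == j)%N) H l)); last first.
  move=> j _; have jlt := ltn_ord j.
  have jt : J ^+ (m + p.-1) * t ^+ j = J ^+ (m + p - j).-1 * fX ^+ j.
    rewrite -(jtR R) exprMn mulrA -exprD; congr (_ ^+ _ * _); lia.
  have -> : fX ^+ (p * m - m) * J ^+ (m + p.-1) * (fps_const Bs`_j * t ^+ j) * jder =
     fps_const Bs`_j ^+ p * (fX ^+ (p * m.+1 - (m + p - j)) * J ^+ (m + p - j).-1 * jder).
    have -> : (p * m.+1 - (m + p - j) = (p * m - m) + j)%N.
      by rewrite mulnS; have : (m <= p * m)%N by [rewrite leq_pmull]; lia.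
    rewrite const_expp (exprD fX); move: (fps_const Bs`_j : A) => b.
    move: (jder) (fX ^+ (p * m - m)) (fX ^+ j) (J ^+ (m + p - j).-1) jt => d x y z.
    move: (J ^+ _) (t ^+ j) => u v uv.
    apply: (lin_comb (c := x * b * d) uv); ring.
  rewrite fUM fU_term; first last.
  - by rewrite mulnS; have : (m <= p * m)%N by [rewrite leq_pmull]; lia.
  - by lia.
  case: ifP => [/dvdnP[l el]|/negP ndv]; last first.
    rewrite mulr0 big1 // => l /andP[pl /eqP lj]; case: ndv.
    by rewrite -lj (_ : m + p - (m - p * l) = p * l.+1)%N ?dvdn_mulr // mulnS; lia.
  have l0 : (0 < l)%N by case: (l) el => // el; lia.
  have jm : (j <= m)%N.
    have : (p <= m + p - j)%N by rewrite el leq_pmull.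
    lia.
  have pl1 : (p * l.-1 <= m)%N by rewrite -subn1 mulnBr muln1 mulnC -el; lia.
  have lm : (l.-1 < m.+1)%N by rewrite ltnS (leq_trans _ pl1) // leq_pmull.
  have lj : (m - p * l.-1 = j)%N by rewrite -subn1 mulnBr muln1 mulnC -el; lia.
  rewrite (bigD1 (Ordinal lm)) /= ?pl1 ?lj ?eqxx // big1 ?addr0 => [|l' /andP[/andP[pl' /eqP l'j]]].
    rewrite /H lj el mulnK // (_ : m.+1 - l = m - l.-1)%N; [ring | lia].
  rewrite -val_eqE /= => /eqP ne; case: ne.
  have : (p * l' = p * l.-1)%N by lia.
  by move/eqP; rewrite eqn_pmul2l // => /eqP.
rewrite (exchange_big_dep (fun l : 'I_m.+1 => (p * l <= m)%N)) /=; last by move=> ? ? _ /andP[].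
rewrite big_distrr /=; apply: eq_bigr => l pl.
have lt : (m - p * l < m + p)%N by lia.
rewrite (big_pred1 (Ordinal lt)) => [|j]; first by rewrite /H; ring.
by rewrite pl eq_sym.
Qed.

End UOperator.

(** * Reduction of the coefficients of F(j) modulo p *)

Lemma lcoef_j i M k : (i <= M)%N ->
  lcoef (lexp j_series i) (k%:Z - M%:Z) = fcoef (fX ^+ (M - i) * jtail ^+ i) k.
Proof.
move=> iM; rewrite fcoefXM -fps_tail_j -fps_exp /lcoef /= muln1.
case: leqP => le; last first.
  have -> : k%:Z - M%:Z + i%:Z = Negz (M - i - k).-1 by lia.
  by [].
by have -> : k%:Z - M%:Z + i%:Z = Posz (k - (M - i)) by lia.
Qed.

Lemma j_coefE (F : {poly int}) M k : (size F <= M.+1)%N ->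
  j_coef F (k%:Z - M%:Z) =
  fcoef (\sum_(i < M.+1) (F`_i)%:~R * (fX ^+ (M - i) * jtail ^+ i)) k.
Proof.
move=> sF; rewrite /j_coef /poly_coef fcoef_sum.
pose f i := F`_i * lcoef (lexp j_series i) (k%:Z - M%:Z).
transitivity (\sum_(i < M.+1) f i); last first.
  apply: eq_bigr => i _; have iM : (i <= M)%N by rewrite -ltnS.
  rewrite (fcoef_intM (F`_i)).
  rewrite -(lcoef_j k iM).
  rewrite intz.
  exact: erefl.
rewrite (big_ord_widen _ f sF) [LHS]big_mkcond; apply: eq_bigr => i _.
by case: ltnP => // le; rewrite /f nth_default ?mul0r.
Qed.

Lemma j_coef_pole (F : {poly int}) M (n : int) :
  (size F <= M.+1)%N -> n < - M%:Z -> j_coef F n = 0.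
Proof.
move=> sF nM; rewrite /j_coef /poly_coef big1 // => i _; rewrite /lcoef /= muln1.
have := ltn_ord i; case e: (n + i%:Z) => [l|l]; rewrite ?mulr0 //; lia.
Qed.

Lemma j_coef_const (G : {poly int}) n : (size G <= 1)%N -> j_coef G n = q_const (G`_0) n.
Proof.
move=> sG; rewrite /q_const; case: (ltP n 0) => n0.
  by rewrite (@j_coef_pole G 0) ?oppr0 // lt_eqF.
case: n n0 => // n _; rewrite -[Posz n]subr0 (j_coefE n (M := 0)) // big_ord1 subn0 !expr0 mul1r.
by rewrite fcoef_intM intz subr0 fcoef1; case: n => [|n]; rewrite ?mulr1 ?mulr0.
Qed.

(** The polynomial x^m f(1/x), so that f(j) is j^m times its value at 1/j. *)
Definition rev_poly (R : nzRingType) m (f : {poly R}) : {poly R} :=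
  \poly_(i < m.+1) f`_(m - i).

Section Reduction.
Variables (p : nat) (pp : prime p).
Local Notation R := ('F_p).
Local Notation A := (fps R).
Local Notation J := (jtailR R).
Local Notation t := (tserR R).

Lemma Fp_eqz (a b : int) : a%:~R = b%:~R :> R -> (a = b %[mod p%:Z])%Z.
Proof.
move=> ab; apply/eqP; rewrite eqz_mod_dvd.
have : (a - b)%:~R = 0 :> R by rewrite intrB ab subrr.
rewrite dvdzE absz_nat (dvdn_pcharf (pchar_Fp pp)).
by case: (a - b) => k; rewrite /= ?NegzE ?mulrNz => /eqP; rewrite ?oppr_eq0.
Qed.

Definition jpoly (f : {poly R}) M : A :=
  \sum_(i < M.+1) fps_const f`_i * (fX ^+ (M - i) * J ^+ i).

Lemma j_coef_mod (F : {poly int}) M k : (size F <= M.+1)%N ->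
  (j_coef F (k%:Z - M%:Z))%:~R = fcoef (jpoly (poly_mod p F) M) k.
Proof.
move=> sF; rewrite j_coefE // !fcoef_sum rmorph_sum; apply: eq_bigr => i _ /=.
rewrite fcoef_intM intz fcoef_constM intrM coef_map; congr (_ * _).
rewrite -[LHS]/(fcoef (fps_map intr (fX ^+ (M - i) * jtail ^+ i) : A) k).
by rewrite rmorphM !rmorphXn /= (fps_map_fX intr).
Qed.

Lemma jpoly_rev f m : jpoly f m = J ^+ m * fps_eval t (rev_poly m f).
Proof.
rewrite (@fps_eval_coef _ _ _ m.+1 (size_poly _ _)) big_distrr /= /jpoly.
rewrite (reindex_inj rev_ord_inj); apply: eq_bigr => i _ /=.
have im : (i <= m)%N by rewrite -ltnS.
rewrite coef_poly ltn_ord subSS subKn // -(jtR R) exprMn.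
have -> : J ^+ m = J ^+ i * J ^+ (m - i) by rewrite -exprD subnKC.
move: (fps_const _ : A) (J ^+ i) (J ^+ (m - i)) (t ^+ i) => x y z w; ring.
Qed.

Lemma jpoly_shift (f : {poly R}) m M : (size f <= m.+1)%N -> (m <= M)%N ->
  jpoly f M = fX ^+ (M - m) * jpoly f m.
Proof.
move=> sf mM; rewrite /jpoly big_distrr /=.
rewrite (big_ord_widen M.+1 (fun i => fX ^+ (M - m) * (fps_const f`_i * (fX ^+ (m - i) * J ^+ i)))) //.
rewrite [RHS]big_mkcond; apply: eq_bigr => i _; case: ltnP => im; last first.
  by rewrite nth_default ?raddf0 ?mul0r // (leq_trans sf).
have -> : fX ^+ (M - i) = fX ^+ (M - m) * fX ^+ (m - i) :> A by rewrite -exprD; congr (_ ^+ _); lia.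
move: (fps_const _ : A) (J ^+ i) (fX ^+ _) (fX ^+ _) => x y z w; ring.
Qed.

(** As theta j = -j E6/E4, the last hypothesis says that F(j) (theta j)^(p-1) = j^(m+p-1) Bs(1/j);
    the degree bound makes this a polynomial in j. *)
Lemma U_congr (F : {poly int}) (Bs : {poly R}) m : (size F <= m.+1)%N -> (size Bs <= m + p)%N ->
  fps_eval t (rev_poly m (poly_mod p F)) * (eisRR R * eisQV R) ^+ p.-1 = fps_eval t Bs ->
  exists G : {poly int},
    (p * (size G).-1 <= m)%N /\ q_congr p (Uop p (j_coef F)) (j_coef G).
Proof.
move=> sF sB E; have p0 := prime_gt0 pp.
(* The coefficients found in [fU_poly_j], lifted to their least nonnegative representatives. *)
pose G : {poly int} := \poly_(l < (m %/ p).+1) (nat_of_ord (Bs`_(m - p * l)%N))%:Z.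
have sG : (size G <= (m %/ p).+1)%N by apply: size_poly.
have sGm : (size G <= m.+1)%N by apply: leq_trans sG _; rewrite ltnS leq_div.
exists G; split.
  apply: (leq_trans _ (leq_trunc_div m p)); rewrite mulnC leq_mul2r.
  by move: sG; case: (size G) => [|s]; rewrite ?orbT //= ltnS => ->; rewrite orbT.
move=> n; apply: Fp_eqz; rewrite /Uop; case: (ltP n (- m%:Z)) => nm.
  by rewrite (j_coef_pole sF) ?(j_coef_pole sGm) //; nia.
have [k ->] : exists k : nat, n = k%:Z - m%:Z by exists (absz (n + m%:Z)); lia.
have -> : p%:Z * (k%:Z - m%:Z) = (p * k)%:Z - (p * m)%:Z by lia.
have mpm : (m <= p * m)%N by rewrite leq_pmull.
rewrite j_coef_mod ?(leq_trans sF) // j_coef_mod //.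
rewrite (@jpoly_shift _ m) //; last by apply: leq_trans (size_poly _ _) sF.
rewrite jpoly_rev mulrA.
have := congr1 (fun s => fcoef s k) (fU_poly_j pp sB E); rewrite [LHS]/= => ->.
congr (fcoef _ k); rewrite /jpoly big_mkcond; apply: eq_bigr => l _.
rewrite coef_map coef_poly ltnS leq_divRL // mulnC; case: ifP => _.
  by congr (fps_const _ * _); rewrite -[RHS]/(_%:R) natr_Zp.
by rewrite /= raddf0 mul0r.
Qed.

Lemma U_congr_const (F G : {poly int}) m : (m < p)%N -> (p * (size G).-1 <= m)%N ->
  q_congr p (Uop p (j_coef F)) (j_coef G) ->
  q_congr p (Uop p (j_coef F)) (q_const (j_coef F 0)).
Proof.
move=> mp sG FG n; have sG1 : (size G <= 1)%N.
  by move: sG; case: (size G) => [|[|s]] //=; nia.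
have := FG 0; have := FG n; rewrite !(j_coef_const _ sG1) /q_const eqxx /Uop mulr0 => -> e0.
by case: (n == 0); rewrite ?e0.
Qed.

End Reduction.

(** * Explicit Hasse invariants for p = 5, 7 and 11 *)

Section SmallHasse.
Variables (R : comNzRingType) (al be : R).

Lemma hasse2 : hasse al be 2 = 72 * al.
Proof. by rewrite /hasse /= !coef_cop !coefX /=; ring. Qed.

Lemma hasse3 : hasse al be 3 = 2880 * be.
Proof. by rewrite /hasse /= !(coef_cop, coefX) /=; ring. Qed.

Lemma hasse5 : hasse al be 5 = 2880 * 72 * 57 * al * be.
Proof. by rewrite /hasse /= !(coef_cop, coefX) /=; ring. Qed.

End SmallHasse.

Section SmallHassePolynomial.
Variable R : fieldType.
Local Notation c := (cusp_poly R).

Lemma hpoly2 : hpoly R 2 = (72 * - 3)%:P * c ^+ 1.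
Proof. by rewrite /hpoly hasse2 polyCM polyCN !polyC_natr; ring. Qed.

Lemma hpoly3 : hpoly R 3 = (2880 * 2)%:P * c ^+ 2.
Proof. by rewrite /hpoly hasse3 polyCM !polyC_natr; ring. Qed.

Lemma hpoly5 : hpoly R 5 = (2880 * 72 * 57 * (- 3) * 2)%:P * c ^+ 3.
Proof. by rewrite /hpoly hasse5 !polyCM polyCN !polyC_natr; ring. Qed.

End SmallHassePolynomial.

Lemma U_congr_23 p (F : {poly int}) m : prime p -> (p <= 3)%N -> (size F <= m.+1)%N ->
  exists G : {poly int},
    (p * (size G).-1 <= m)%N /\ q_congr p (Uop p (j_coef F)) (j_coef G).
Proof.
move=> pp p3 sF; have pR := fps_pchar (pchar_Fp pp).
have zero k : (p %| k)%N -> k%:R = 0 :> fps 'F_p.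
  by case/dvdnP=> l ->; rewrite natrM (pcharf0 pR) mulr0.
have [d240 d504] : (p %| 240)%N /\ (p %| 504)%N.
  by case: p pp p3 {pR zero} => [|[|[|[|p]]]].
have Q1 : eisQR 'F_p = 1.
  rewrite /eisQR /eisQ rmorphD rmorph1 (rmorphM _ 240) (rmorph_nat _ 240).
  by rewrite zero // mul0r addr0.
have S1 : eisRR 'F_p = 1.
  rewrite /eisRR /eisR rmorphB rmorph1 (rmorphM _ 504) (rmorph_nat _ 504).
  by rewrite zero // mul0r subr0.
have i1 : eisQV 'F_p = 1 by rewrite -[LHS]mul1r -Q1 eisQRV.
apply: (U_congr pp sF (Bs := rev_poly m (poly_mod p F))).
  by apply: leq_trans (size_poly _ _) _; have := prime_gt0 pp; lia.
by rewrite S1 i1 mulr1 expr1n mulr1.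
Qed.

Section Divisibility.
Variables (p N : nat).
Hypotheses (pp : prime p) (pN : p = N.*2.+1) (p3 : (3 < p)%N).
Local Notation R := ('F_p).
Local Notation c := (cusp_poly R).
Local Notation H := (hpoly R N).

Let pR : p \in [pchar R]. Proof. exact: pchar_Fp. Qed.

Lemma size_cusp_poly : (size c <= 2)%N.
Proof.
rewrite /cusp_poly mulr_natl -scaler_nat -scaleNr addrC.
by apply: leq_trans (size_polyD _ _) _; rewrite geq_max size_poly1 (leq_trans (size_scale_leq _ _)) ?size_polyX.
Qed.

(** The quotient by H^2 serves as [Bs]: [hpoly_sqr] trades (E6/E4)^(p-1) for c^(p-1) / H^2, and
    H(1/j) can be cancelled since H(0) is nonzero. The degree of [Bs] is at most m + (p-1), which is
    the condition at j = 0. *)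
Lemma U_congr_dvd (F : {poly int}) m : (size F <= m.+1)%N ->
  H ^+ 2 %| rev_poly m (poly_mod p F) * c ^+ p.-1 ->
  exists G : {poly int},
    (p * (size G).-1 <= m)%N /\ q_congr p (Uop p (j_coef F)) (j_coef G).
Proof.
move=> sF /dvdpP[Bs]; set Fs := rev_poly _ _ => E.
have H0 : H != 0.
  by apply/eqP => e; have := hpoly0 pR pN p3; rewrite e horner0 eqxx.
have sB : (size Bs <= m + p)%N.
  have sFs : (size Fs <= m.+1)%N by apply: size_poly.
  have sc : (size (c ^+ p.-1) <= p)%N.
    apply: leq_trans (size_poly_exp_leq _ _) _.
    have : ((size c).-1 <= 1)%N by have := size_cusp_poly; lia.
    by move: (size c).-1 => -[|[|s]] //= _; have := prime_gt0 pp; lia.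
  have : (size (Bs * H ^+ 2)%R <= m + p)%N.
    rewrite -E; apply: leq_trans (size_polyMleq _ _) _.
    by move: (size Fs) (size (c ^+ p.-1)) sFs sc => a b; have := prime_gt0 pp; lia.
  have [->|B0] := eqVneq Bs 0; first by rewrite size_poly0.
  rewrite size_mul ?expf_neq0 //; have : (0 < size (H ^+ 2))%N by rewrite size_poly_gt0 expf_neq0.
  by move: (size (H ^+ 2)) (size Bs) => a b; lia.
apply: (U_congr pp sF sB); rewrite -/Fs.
have E2 := congr1 (fps_eval (tserR R)) E; rewrite !rmorphM !rmorphXn /= in E2.
have sq := hpoly_sqr pR pN p3.
have reg : GRing.lreg (fcoef (fps_eval (tserR R) H ^+ 2) 0).
  rewrite fcoefX0 fps_eval0; apply: lregX; apply/mulfI; exact: hpoly0 pR pN p3.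
apply: (fps_mulI reg); rewrite [RHS]mulrC -E2 -sq; ring.
Qed.

Lemma dvd_cusp_small (C : R) e (g : {poly R}) : H = C%:P * c ^+ e -> (2 * e <= p.-1)%N ->
  H ^+ 2 %| g * c ^+ p.-1.
Proof.
move=> HE le; apply: dvdp_mull.
have C0 : C != 0.
  apply/eqP => C0; have := hpoly0 pR pN p3.
  by rewrite HE C0 mul0r horner0 eqxx.
rewrite HE exprMn -rmorphXn /= mul_polyC dvdpZl ?expf_neq0 // -exprM mulnC.
exact: dvdp_exp2l.
Qed.

End Divisibility.

Lemma U_congr_small p (F : {poly int}) m : prime p -> (p <= 11)%N -> (size F <= m.+1)%N ->
  exists G : {poly int},
    (p * (size G).-1 <= m)%N /\ q_congr p (Uop p (j_coef F)) (j_coef G).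
Proof.
move=> pp p11 sF; have [p3|p3] := leqP p 3; first exact: U_congr_23.
have [pE|[pE|pE]] : p = 5 \/ p = 7 \/ p = 11.
  by case: p pp p11 p3 => [|[|[|[|[|[|[|[|[|[|[|[|p]]]]]]]]]]]] //; auto.
- apply: (@U_congr_dvd p 2) => //; rewrite ?pE //.
  by apply: (@dvd_cusp_small 5 2 _ _ _ (72 * - 3) 1) => //; apply: hpoly2.
- apply: (@U_congr_dvd p 3) => //; rewrite ?pE //.
  by apply: (@dvd_cusp_small 7 3 _ _ _ (2880 * 2) 2) => //; apply: hpoly3.
apply: (@U_congr_dvd p 5) => //; rewrite ?pE //.
by apply: (@dvd_cusp_small 11 5 _ _ _ (2880 * 72 * 57 * (- 3) * 2) 3) => //; apply: hpoly5.
Qed.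

(** * Points of order p and the Hasse invariant *)

Section QuadEval.
Variables (L : fieldType) (f : {poly L}).
Local Notation K := (quad f).
Implicit Types (x y : L) (z w e : K).

Definition qev x y z : L := z.1.[x] + z.2.[x] * y.

Lemma qevM x y z w : y ^+ 2 = f.[x] -> qev x y (z * w) = qev x y z * qev x y w.
Proof. by move=> yf; rewrite /qev !quadE !hornerE -yf; ring. Qed.

Lemma qev_c x y g : qev x y (qc f g) = g.[x].
Proof. by rewrite /qev /= horner0; ring. Qed.

Lemma qev_conj x y z : qev x y (qconj z) = qev x (- y) z.
Proof. by rewrite /qev /= hornerN; ring. Qed.

Lemma qc_mulI g z w : g != 0 -> qc f g * z = qc f g * w -> z = w.
Proof.
move=> g0 e; have := congr1 fst e; have := congr1 snd e; rewrite !quadE /=.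
rewrite !mul0r !addr0 => /(mulfI g0) e2 /(mulfI g0) e1; exact: quadP.
Qed.

Lemma quad_dvd g z : g %| z.1 -> g %| z.2 -> exists w, z = qc f g * w.
Proof.
move=> /dvdpP[a ea] /dvdpP[b eb]; exists (a, b).
by apply: quadP; rewrite !quadE /= ?ea ?eb; ring.
Qed.

Lemma qev_dvd x y z : 2 * y != 0 -> qev x y z = 0 -> qev x (- y) z = 0 ->
  exists w, z = qc f ('X - x%:P) * w.
Proof.
rewrite /qev => y2 e1 e2.
have b0 : z.2.[x] = 0.
  by apply: (mulfI y2); rewrite mulr0; apply: (lin_comb (c := 1) (etrans e1 (esym e2))); ring.
by apply: quad_dvd; rewrite dvdp_XsubCl rootE ?b0 // -e1 b0; apply/eqP; ring.
Qed.

(** At a ramification point the two conjugate points coincide, so double vanishing is read off the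
    norm; as f has a simple root there, the coefficient of y must vanish too. *)
Lemma qev_dvd_branch x z : f.[x] = 0 -> f^`().[x] != 0 -> qev x 0 z = 0 ->
  ('X - x%:P) ^+ 2 %| qnorm z -> exists w, z = qc f ('X - x%:P) * w.
Proof.
rewrite /qev mulr0 addr0 => fx f'x a0 d2.
have /factor_theorem[a1 ea] : root z.1 x by apply/eqP.
have /factor_theorem[f1 ef] : root f x by apply/eqP.
have f1x : f1.[x] != 0.
  move: f'x; rewrite ef derivM derivB derivX derivC subr0 mulr1 hornerD hornerM.
  by rewrite hornerXsubC subrr mulr0 add0r.
apply: quad_dvd; first by rewrite ea dvdp_mull.
have : ('X - x%:P) ^+ 2 %| z.2 ^+ 2 * f.
  have -> : z.2 ^+ 2 * f = z.1 ^+ 2 - qnorm z by rewrite /qnorm; ring.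
  by rewrite dvdp_subr // ea exprMn dvdp_mull.
rewrite ef expr2 mulrA dvdp_mul2r ?polyXsubC_eq0 // dvdp_XsubCl rootE hornerM.
by rewrite mulf_eq0 (negPf f1x) orbF horner_exp expf_eq0 /= dvdp_XsubCl rootE.
Qed.

Lemma qev_dvdn x y n z e1 e2 g1 g2 : 2 * y != 0 -> y ^+ 2 = f.[x] ->
  qev x y e1 != 0 -> qev x (- y) e2 != 0 ->
  e1 * z = qc f (('X - x%:P) ^+ n) * g1 -> e2 * z = qc f (('X - x%:P) ^+ n) * g2 ->
  exists w, z = qc f (('X - x%:P) ^+ n) * w.
Proof.
move=> y2 yf e1P e2P; have yf' : (- y) ^+ 2 = f.[x] by rewrite sqrrN.
elim: n z => [|n IH] z E1 E2; first by exists z; rewrite expr0 rmorph1 mul1r.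
have u0 : 'X - x%:P != 0 :> {poly L} by rewrite polyXsubC_eq0.
have E (e g : K) : e * z = qc f (('X - x%:P) ^+ n.+1) * g ->
    e * z = qc f ('X - x%:P) * (qc f (('X - x%:P) ^+ n) * g).
  by rewrite exprS (rmorphM _ ('X - _)) mulrA.
have V (e g : K) t : t ^+ 2 = f.[x] -> qev x t e != 0 ->
    e * z = qc f (('X - x%:P) ^+ n.+1) * g -> qev x t z = 0.
  move=> tf et /E/(congr1 (qev x t)); rewrite !qevM // qev_c hornerXsubC subrr mul0r.
  by move/eqP; rewrite mulf_eq0 (negPf et) => /eqP.
have [w zw] := qev_dvd y2 (V _ _ _ yf e1P E1) (V _ _ _ yf' e2P E2).
have C (e g : K) : e * z = qc f (('X - x%:P) ^+ n.+1) * g -> e * w = qc f (('X - x%:P) ^+ n) * g.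
  by move/E => e'; apply: (qc_mulI u0); rewrite -e' zw; ring.
have [w' ww'] := IH _ (C _ _ E1) (C _ _ E2).
by exists w'; rewrite zw ww' exprS (rmorphM _ ('X - _)) mulrA.
Qed.

Section Size.
Hypothesis sf : size f = 4.

Let size_sqr (b : {poly L}) : size (b ^+ 2) = ((size b).*2.-1)%N.
Proof.
have [->|b0] := eqVneq b 0; first by rewrite expr0n size_poly0.
by rewrite expr2 size_mul // addnn.
Qed.

Let size_b2f (b : {poly L}) : b != 0 -> size (b ^+ 2 * f) = ((size b).*2 + 2)%N.
Proof.
move=> b0; have f0 : f != 0 by rewrite -size_poly_eq0 sf.
rewrite size_mul ?expf_neq0 // sf size_sqr.
by move: b0; rewrite -size_poly_gt0; case: (size b) => // s _ /=; lia.
Qed.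

(** In the norm a^2 - b^2 f the two terms have degrees of opposite parity, so their leading terms
    cannot cancel. *)
Lemma size_qnorm z :
  ((size z.1).*2 <= (size (qnorm z)).+1)%N /\
  (z.2 != 0 -> ((size z.2).*2 + 2 <= size (qnorm z))%N).
Proof.
have sa : z.1 != 0 -> size (z.1 ^+ 2) = ((size z.1).*2.-1)%N.
  by rewrite size_sqr.
have [b0|b0] := eqVneq z.2 0.
  rewrite /qnorm b0 expr0n mul0r subr0; split => //.
  have [->|/sa ->] := eqVneq z.1 0; first by rewrite size_poly0.
  lia.
have sb := size_b2f b0.
have [a0|a0] := eqVneq z.1 0.
  by rewrite /qnorm a0 expr0n sub0r size_polyN size_poly0 sb.
rewrite /qnorm; move: (sa a0) => {}sa.
have := a0; rewrite -size_poly_gt0 => pa.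
have := ltngtP (size (z.1 ^+ 2)) (size (z.2 ^+ 2 * f)).
case=> [lt|lt|eq]; last by move: eq; rewrite sa sb; lia.
  rewrite addrC size_polyDl ?size_polyN // sb; move: lt; rewrite sa sb.
  by move: pa; move: (size z.1) (size z.2) => s1 s2 pa lt; split=> [|_]; lia.
rewrite size_polyDl ?size_polyN // sa; move: lt; rewrite sa sb.
by move: pa; move: (size z.1) (size z.2) => s1 s2 pa lt; split=> [|_]; lia.
Qed.

Lemma size_qnorm_le3 z : (size (qnorm z) <= 3)%N -> z.2 = 0.
Proof.
move=> s3; have [//|b0] := eqVneq z.2 0; have := (size_qnorm z).2 b0.
by move: b0; rewrite -size_poly_gt0; lia.
Qed.

Lemma size_qnorm_neq2 z : size (qnorm z) <> 2.
Proof.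
move=> s2; have z2 : z.2 = 0 by apply: size_qnorm_le3; rewrite s2.
move: s2; rewrite /qnorm z2 expr0n mul0r subr0 size_sqr.
by case: (size z.1) => [|[|s]] //=; lia.
Qed.

End Size.

Lemma qconj_qder z : qder (qconj z) = - qconj (qder z).
Proof. by apply: quadP; rewrite /= ?derivN; ring. Qed.

End QuadEval.

Definition short_w (L : fieldType) (al be : L) : weierstrass L := Weierstrass 0 0 0 al be.

(** * Miller's algorithm on short Weierstrass curves *)

Section Miller.
Variables (L : fieldType) (al be : L).
Local Notation f := (cubic al be).
Local Notation K := (quad f).
Local Notation E := (short_w al be).
Implicit Types (x y : L) (g h z : K).

Hypothesis two : (2 : L) != 0.
Hypothesis sep : forall r, f.[r] = 0 -> f^`().[r] != 0.

Lemma horner_cubic x : f.[x] = x ^+ 3 + al * x + be.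
Proof. by rewrite /cubic !hornerE. Qed.

Lemma on_short_curve x y : on_curve E (Affine x y) = (y ^+ 2 == f.[x]).
Proof. by rewrite /= horner_cubic !(mul0r, addr0). Qed.

Lemma line_through x1 y1 x2 y2 x3 y3 :
  y1 ^+ 2 = f.[x1] -> y2 ^+ 2 = f.[x2] ->
  pt_add E (Affine x1 y1) (Affine x2 y2) = Affine x3 y3 ->
  exists l nu, [/\ y1 = l * x1 + nu, y2 = l * x2 + nu, y3 = - (l * x3 + nu) &
    (l%:P * 'X + nu%:P) ^+ 2 - f = - (('X - x1%:P) * ('X - x2%:P) * ('X - x3%:P))].
Proof.
rewrite !horner_cubic /= !(mul0r, mulr0, addr0, subr0) => c1 c2.
case: ifP => // /negbT nO [].
set l := if _ then _ else _ => ex3 ey3; pose nu := y1 - l * x1.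
have e1 : y1 = l * x1 + nu by rewrite /nu; ring.
have e3 : y3 = - (l * x3 + nu) by rewrite -ey3 -ex3 /nu; ring.
have ex : x3 = l ^+ 2 - x1 - x2 by rewrite -ex3.
(* A X + B is the difference of the two sides of the wanted identity, whose X^2 coefficient vanishes
   by the formula for x3. It has the root x1; A vanishes because x2 is a second root for a chord,
   and by the slope equation for a tangent. *)
pose A := 2 * l * nu - al + x1 * x2 + (x1 + x2) * x3.
pose B := nu ^+ 2 - be - x1 * x2 * x3.
have AB1 : A * x1 + B = 0.
  apply: (lin_comb (c := 1) (_ : y1 ^+ 2 = x1 ^+ 3 + al * x1 + be)) => //.
  by rewrite e1 /A /B ex; ring.
have [e2 A0] : y2 = l * x2 + nu /\ A = 0.
  have [ex12|nx] := eqVneq x1 x2.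
    move: nO; rewrite ex12 eqxx /= => nO; have y12 : y1 = y2.
      apply/eqP; rewrite -subr_eq0; apply/eqP; apply: (mulIf nO); rewrite mul0r.
      by apply: (lin_comb (c := 1) (_ : y1 ^+ 2 = y2 ^+ 2)); [rewrite c1 c2 ex12|ring].
    have ly : 2 * y1 * l = 3 * x1 ^+ 2 + al.
      have y10 : 2 * y1 != 0 by move: nO; rewrite -y12; congr (_ != 0); ring.
      have -> : l = (3 * x1 ^+ 2 + al) / (2 * y1) by rewrite /l ex12 eqxx.
      by rewrite mulrC divfK.
    split; first by rewrite -y12 -ex12.
    by apply: (lin_comb (c := 1) ly); rewrite /A ex -ex12 e1; ring.
  have dx : x2 - x1 != 0 by rewrite subr_eq0 eq_sym.
  have ly : l * (x2 - x1) = y2 - y1 by rewrite /l (negPf nx) divfK.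
  have e2 : y2 = l * x2 + nu by apply: (lin_comb (c := -1) ly); rewrite e1; ring.
  split=> //; apply: (mulIf dx); rewrite mul0r.
  have AB2 : A * x2 + B = 0.
    apply: (lin_comb (c := 1) (_ : y2 ^+ 2 = x2 ^+ 3 + al * x2 + be)) => //.
    by rewrite e2 /A /B ex; ring.
  by apply: (lin_comb (c := 1) (etrans AB2 (esym AB1))); ring.
have B0 : B = 0 by rewrite -AB1 A0 mul0r add0r.
exists l, nu; split=> //; apply/eqP; rewrite -subr_eq0 opprK; apply/eqP.
have -> : 0 = A%:P * 'X + B%:P :> {poly L} by rewrite A0 B0; ring.
rewrite /A /B ex /cubic !(polyCB, polyCD, polyCM, polyC_exp, polyC_natr); ring.
Qed.

Definition line_fun (l nu : L) : K := (- (l%:P * 'X + nu%:P), 1).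

Lemma qev_line l nu x y : qev x y (line_fun l nu) = y - (l * x + nu).
Proof. by rewrite /qev /line_fun /= !hornerE; ring. Qed.

Variables (x0 y0 : L).
Hypothesis P_on : y0 ^+ 2 = f.[x0].
Hypothesis y0_neq0 : y0 != 0.
Local Notation P := (Affine x0 y0).
Local Notation u := ('X - x0%:P).

Let y2_neq0 y : y != 0 -> 2 * y != 0. Proof. exact: mulf_neq0. Qed.
Let sqN x y : y ^+ 2 = f.[x] -> (- y) ^+ 2 = f.[x]. Proof. by rewrite sqrrN. Qed.
Let P_on' : (- y0) ^+ 2 = f.[x0]. Proof. exact: sqN. Qed.

(* A function with divisor n P - n O. *)
Definition tors_fun n g := exists2 k : L, k != 0 &
  qnorm g = k%:P * u ^+ n /\ qev x0 (- y0) g != 0.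

(* A function with divisor i P + (- Q) - (i + 1) O, where Q = (x, y). *)
Definition miller_fun i x y h := exists2 k : L, k != 0 &
  [/\ qnorm h = k%:P * (u ^+ i * ('X - x%:P)), qev x (- y) h = 0 & qev x0 (- y0) h != 0].

Lemma pt_add_on x1 y1 x2 y2 x3 y3 : y1 ^+ 2 = f.[x1] -> y2 ^+ 2 = f.[x2] ->
  pt_add E (Affine x1 y1) (Affine x2 y2) = Affine x3 y3 -> y3 ^+ 2 = f.[x3].
Proof.
move=> c1 c2 /(line_through c1 c2)[l [nu [_ _ -> /(congr1 (horner^~ x3))]]].
rewrite /= hornerN !hornerM !hornerXsubC subrr mulr0 oppr0 hornerD hornerN => /eqP.
by rewrite subr_eq0 => /eqP <-; rewrite !hornerE; ring.
Qed.

(** The line through P and Q has divisor P + Q + (-(P + Q)) - 3 O. Multiplying h by it creates zeros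
    at both Q and -Q, which are removed by dividing by the vertical line at x. *)
Lemma miller_step i x y h x' y' : y ^+ 2 = f.[x] -> miller_fun i x y h ->
  pt_add E P (Affine x y) = Affine x' y' -> exists h', miller_fun i.+1 x' y' h'.
Proof.
move=> Q_on [k k0 [Nh hQ hP]] PQ.
have Q'_on := pt_add_on P_on Q_on PQ.
have [l [nu [ey0 ey ey' Nl]]] := line_through P_on Q_on PQ.
pose ell := line_fun l nu; have v0 : 'X - x%:P != 0 :> {poly L} by rewrite polyXsubC_eq0.
have {}Nl : qnorm ell = - (u * ('X - x%:P) * ('X - x'%:P)) by rewrite -Nl /qnorm /=; ring.
have Nhl : qnorm (h * ell) = ('X - x%:P) ^+ 2 * ((- k)%:P * (u ^+ i.+1 * ('X - x'%:P))).
  by rewrite qnormM Nh Nl (exprS u) polyCN; ring.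
have [h' hh'] : exists h', h * ell = qc f ('X - x%:P) * h'.
  have [yE0|yN0] := eqVneq y 0; last first.
    apply: (qev_dvd (y2_neq0 yN0)); last by rewrite (qevM _ _ (sqN Q_on)) hQ mul0r.
    by rewrite qevM // qev_line ey subrr mulr0.
  have fx : f.[x] = 0 by rewrite -Q_on yE0 expr0n.
  have d2 : ('X - x%:P) ^+ 2 %| qnorm (h * ell) by rewrite Nhl dvdp_mulr.
  apply: qev_dvd_branch fx (sep fx) _ d2.
  have : qev x y (h * ell) = 0 by rewrite qevM // qev_line ey subrr mulr0.
  by rewrite yE0.
have Nh' : qnorm h' = (- k)%:P * (u ^+ i.+1 * ('X - x'%:P)).
  apply: (mulfI (expf_neq0 2 v0)); rewrite -Nhl hh' qnormM qnorm_c; ring.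
exists h', (- k); rewrite ?oppr_eq0 //; split=> //.
- have [y'0|y'0] := eqVneq y' 0.
    have := congr1 (horner^~ x') Nh'; rewrite /= !hornerM hornerXsubC subrr !mulr0 /qnorm.
    rewrite hornerD hornerN !hornerM -Q'_on y'0 expr0n mulr0 subr0 => /eqP.
    by rewrite mulf_eq0 orbb /qev oppr0 mulr0 addr0 => /eqP.
  (* The conjugate line does not vanish at (x', -y') when y' is nonzero, so this identity transfers
     the zero of the right side to h'. *)
  have lh : qconj ell * h' = qc f ('X - x'%:P) * (- qc f u * h).
    apply: (qc_mulI v0); transitivity (h * ell * qconj ell); first by rewrite hh'; ring.
    by rewrite -mulrA mul_qconj Nl rmorphN !rmorphM /=; ring.
  have := congr1 (qev x' (- y')) lh; rewrite !(qevM _ _ (sqN Q'_on)) qev_c hornerXsubC subrr mul0r.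
  move=> /eqP; rewrite mulf_eq0 => /orP[|/eqP//].
  rewrite qev_conj opprK qev_line.
  have -> : y' - (l * x' + nu) = 2 * y' by rewrite ey'; ring.
  by rewrite (negPf (y2_neq0 y'0)).
- have := congr1 (qev x0 (- y0)) hh'; rewrite !(qevM _ _ P_on') => e; apply/eqP => h'0.
  move/eqP: e; rewrite h'0 mulr0 mulf_eq0 (negPf hP) /= qev_line.
  have -> : - y0 - (l * x0 + nu) = - (2 * y0) by rewrite -ey0; ring.
  by rewrite oppr_eq0 (negPf (y2_neq0 y0_neq0)).
Qed.

Lemma miller_start : exists x y h, pt_add E P P = Affine x y /\ miller_fun 2 x y h.
Proof.
case PP : (pt_add E P P) => [|x y].
  move: PP; rewrite /= eqxx /= !mul0r !addr0; case: ifP => //.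
  have -> : y0 + y0 = 2 * y0 by ring.
  by rewrite (negPf (y2_neq0 y0_neq0)).
have [l [nu [ey0 _ ey Nl]]] := line_through P_on P_on PP.
exists x, y, (line_fun l nu); split=> //; exists (- 1); first by rewrite oppr_eq0 oner_eq0.
split.
- have -> : qnorm (line_fun l nu) = (l%:P * 'X + nu%:P) ^+ 2 - f by rewrite /qnorm /=; ring.
  by rewrite Nl polyCN polyC1; ring.
- by rewrite qev_line ey; ring.
rewrite qev_line; have -> : - y0 - (l * x0 + nu) = - (2 * y0) by rewrite -ey0; ring.
by rewrite oppr_eq0 y2_neq0.
Qed.

Lemma pt_muln2 : pt_muln E 2 P = pt_add E P P. Proof. by []. Qed.

Lemma miller_muln i : (forall j, (0 < j <= i.+2)%N -> pt_muln E j P <> Infinity) ->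
  exists x y h, [/\ pt_muln E i.+2 P = Affine x y, y ^+ 2 = f.[x] & miller_fun i.+2 x y h].
Proof.
elim: i => [|i IH] nO.
  have [x [y [h [PP mh]]]] := miller_start.
  by exists x, y, h; split=> //; apply: pt_add_on PP.
have [|x [y [h [Pi c mh]]]] := IH; first by move=> j ji; apply: nO; lia.
have := nO i.+3; rewrite -[pt_muln E i.+3 P]/(pt_add E P (pt_muln E i.+2 P)) Pi.
case PQ : (pt_add E P (Affine x y)) => [|x' y'] => [/(_ _)[]|_]; rewrite ?leqnn //.
have [h' mh'] := miller_step c mh PQ.
by exists x', y', h'; split=> //; apply: pt_add_on PQ.
Qed.

Lemma miller_neq i x y h : y ^+ 2 = f.[x] -> miller_fun i x y h -> ~ (x = x0 /\ y = y0).
Proof. by move=> _ [k k0 [_ h0 hP]] [ex ey]; move: hP; rewrite -ex -ey h0 eqxx. Qed.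

(** If nP = O then (n-1)P = -P, so the last factor of the norm of the Miller function is one more X
    - x0. *)
Lemma tors_muln n : (2 < n)%N -> pt_muln E n P = Infinity ->
  (forall j, (0 < j < n)%N -> pt_muln E j P <> Infinity) -> exists g, tors_fun n g.
Proof.
case: n => [|[|[|i]]] // _ Pn nO.
have [|x [y [h [Pi c [k k0 [Nh hQ hP]]]]]] := @miller_muln i; first by move=> j ji; apply: nO; lia.
move: Pn; rewrite -[pt_muln E i.+3 P]/(pt_add E P (pt_muln E i.+2 P)) Pi /=.
case: ifP => // /andP[/eqP ex _] _; exists h, k => //; split=> //.
by rewrite Nh -ex -exprSr.
Qed.

(** The quotient g / h is g times the conjugate of h, divided by the norm of h; the two nonvanishing
    conditions supply the local units for [qev_dvdn]. *)
Lemma tors_sub m n g h : (n <= m)%N -> tors_fun m g -> tors_fun n h ->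
  exists g', tors_fun (m - n) g'.
Proof.
move=> nm [k k0 [Ng gP]] [k' k'0 [Nh hP]].
have [w gw] : exists w, g * qconj h = qc f (u ^+ n) * w.
  apply: (@qev_dvdn _ _ x0 y0 n _ (qconj g) h (qc f (k%:P * u ^+ (m - n)) * qconj h) (qc f k'%:P * g)).
  - exact: y2_neq0.
  - exact: P_on.
  - by rewrite qev_conj.
  - by [].
  - transitivity (g * qconj g * qconj h); first by ring.
    rewrite mul_qconj Ng -(subnK nm) exprD addnK !rmorphM /=.
    move: (qc f k%:P) (qc f (u ^+ (m - n))) (qc f (u ^+ n)) (qconj h) => a b c d; ring.
  - transitivity (g * (h * qconj h)); first by ring.
    by rewrite mul_qconj Nh (rmorphM (qc f) k'%:P) /=; ring.
have u0 n' : u ^+ n' != 0 by rewrite expf_neq0 // polyXsubC_eq0.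
exists w, (k * k'); first exact: mulf_neq0.
split.
  apply: (mulfI (mulf_neq0 (u0 n) (u0 n))).
  transitivity (qnorm (g * qconj h)); first by rewrite gw qnormM qnorm_c; ring.
  rewrite qnormM qnorm_conj Ng Nh -{1}(subnK nm) exprD polyCM.
  by move: (u ^+ (m - n)) (u ^+ n) => a b; ring.
have hw : h * w = qc f k'%:P * g.
  apply: (qc_mulI (u0 n)).
  transitivity (h * (g * qconj h)); first by rewrite gw; ring.
  transitivity (g * (h * qconj h)); first by ring.
  by rewrite mul_qconj Nh (rmorphM (qc f) k'%:P) /=; ring.
have := congr1 (qev x0 (- y0)) hw; rewrite !(qevM _ _ P_on') qev_c hornerC => e2.
apply/eqP => w0; move/eqP: e2; rewrite w0 mulr0 eq_sym mulf_eq0 (negPf k'0) /=.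
by rewrite (negPf gP).
Qed.

Lemma tors_gcd m n g h : tors_fun m g -> tors_fun n h -> exists g', tors_fun (gcdn m n) g'.
Proof.
have [s] := ubnP (m + n); elim: s m n g h => // s IH m n g h mns tm tn.
have [m0|m0] := posnP m; first by rewrite m0 gcd0n; exists h.
have [n0|n0] := posnP n; first by rewrite n0 gcdn0; exists g.
have [nm|mn] := leqP n m.
  have [g' tg'] := tors_sub nm tm tn.
  by rewrite -(subnK nm) gcdnC gcdnDr gcdnC; apply: (IH _ _ _ _ _ tg' tn); lia.
have [g' tg'] := tors_sub (ltnW mn) tn tm.
by rewrite -(subnK (ltnW mn)) gcdnDr; apply: (IH _ _ _ _ _ tm tg'); lia.
Qed.

Lemma tors1 g : ~ tors_fun 1 g.
Proof.
move=> [k k0 [Ng _]]; apply: (@size_qnorm_neq2 _ _ (size_cubic al be) g).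
by rewrite Ng expr1 mul_polyC size_scale // size_XsubC.
Qed.

End Miller.

(** * Vanishing Hasse invariant excludes p-torsion *)

Section NoTorsion.
Variables (L : closedFieldType) (p N : nat).
Hypotheses (pL : p \in [pchar L]) (pN : p = N.*2.+1) (p3 : (3 < p)%N).
Variables al be : L.
Local Notation f := (cubic al be).
Hypothesis sep : forall r, f.[r] = 0 -> f^`().[r] != 0.

Lemma pchar_natr_neq0 k : (0 < k < p)%N -> (k%:R : L) != 0.
Proof. by move=> kp; rewrite -(dvdn_pcharf pL) gtnNdvd //; case/andP: kp. Qed.

Let two : (2 : L) != 0. Proof. by apply: pchar_natr_neq0; lia. Qed.

Lemma size_qder_le (z : quad f) s t : (size z.1 <= s)%N -> (size z.2 <= t)%N ->
  (size (qder z).1 <= t.+2)%N /\ (size (qder z).2 <= s.-1)%N.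
Proof.
have s2 (g : {poly L}) : (size (2 * g)%R <= size g)%N.
  by rewrite mulr_natl -scaler_nat size_scale_leq.
have sd (g : {poly L}) m : (size g <= m)%N -> (size g^`() <= m.-1)%N.
  by move=> gm; apply: leq_trans (size_poly _ _) _; rewrite -!subn1 leq_sub2r.
move=> zs zt; split; last by apply: leq_trans (s2 _) (sd _ _ zs).
have [b0|] := eqVneq z.2 0; first by rewrite /= b0 deriv0; rewrite (_ : _ + _ = 0) ?size_poly0 //; ring.
rewrite -size_poly_gt0 => b0; have sf := size_cubic al be.
have t0 : (0 < t)%N by apply: leq_trans zt.
apply: leq_trans (size_polyD _ _) _; rewrite geq_max; apply/andP; split.
  apply: leq_trans (size_polyMleq _ _) _; rewrite sf.
  by have := leq_trans (s2 _) (sd _ _ zt); move: (size _) => x; lia.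
apply: leq_trans (size_polyMleq _ _) _.
have := sd _ 4%N (eq_leq sf); rewrite /=.
by move: zt; move: (size z.2) (size f^`()) => x y; lia.
Qed.

Lemma deriv_eq0_const (g : {poly L}) : (size g <= p)%N -> g^`() = 0 -> g = (g`_0)%:P.
Proof.
move=> gp g0; apply/polyP => -[|i]; rewrite coefC //=.
have := congr1 (fun q : {poly L} => q`_i) g0; rewrite /= coef_deriv coef0 -mulr_natl.
move/eqP; rewrite mulf_eq0; case: (ltnP i.+1 p) => ip.
  by rewrite (negPf (pchar_natr_neq0 _)) ?ip // => /eqP.
by rewrite nth_default // (leq_trans gp).
Qed.

Lemma frobenius_inj (x y : L) : x ^+ p = y ^+ p -> x = y.
Proof.
move=> e; apply/eqP; rewrite -subr_eq0; apply/eqP.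
have : (x - y) ^+ p = 0 by rewrite -(pFrobenius_autE pL) rmorphB /= !pFrobenius_autE e subrr.
by move/eqP; rewrite expf_eq0 => /andP[_ /eqP].
Qed.

(* [D g * conj g] is self-conjugate, and divisible by [('X - x0) ^ p] because
   [g] vanishes to order p at the point and [D] kills p-th powers. *)
Lemma tors_qder_eigen x0 y0 g : y0 ^+ 2 = f.[x0] -> y0 != 0 ->
  tors_fun x0 y0 p (g : quad f) -> exists c, qder g = qc f c%:P * g.
Proof.
move=> P_on y00 [k k0 [Ng gP]]; set u := 'X - x0%:P in Ng.
have up0 : u ^+ p != 0 by rewrite expf_neq0 // polyXsubC_eq0.
have Dk : qder (qc f (k%:P * u ^+ p)) = 0.
  rewrite qder_qc derivM derivC mul0r add0r deriv_exp (poly_pchar_mulrn pL).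
  by rewrite !mulr0 rmorph0 mul0r.
have zc : qder g * qconj g = g * qconj (qder g).
  move: Dk; rewrite -Ng -mul_qconj qderM qconj_qder mulrN => /eqP.
  by rewrite subr_eq0 => /eqP.
pose z := qder g * qconj g.
have z2 : z.2 = 0.
  have : z.2 = - z.2 by rewrite {1}/z zc -[g in g * _]qconjK -qconjM mulrC.
  move/eqP; rewrite -subr_eq0 opprK -mulr2n -mulr_natl => /eqP/(congr1 (fun q : {poly L} => q)) e.
  apply/eqP; move/eqP: e; rewrite mulf_eq0 => /orP[|//].
  by rewrite -polyC_natr polyC_eq0 (negPf two).
have zE : z = qc f z.1 by apply: quadP; rewrite ?z2.
have [w zw] : exists w, z = qc f (u ^+ p) * w.
  apply: (@qev_dvdn _ _ x0 y0 p _ (qconj g) g (qc f k%:P * qconj (qder g)) (qc f k%:P * qder g)).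
  - exact: mulf_neq0.
  - exact: P_on.
  - by rewrite qev_conj.
  - by [].
  - rewrite /z zc; transitivity (g * qconj g * qconj (qder g)); first by ring.
    by rewrite mul_qconj Ng (rmorphM (qc f) k%:P) /=; ring.
  - rewrite /z; transitivity (g * qconj g * qder g); first by ring.
    by rewrite mul_qconj Ng (rmorphM (qc f) k%:P) /=; ring.
have w2 : w.2 = 0.
  apply: (mulfI up0); rewrite mulr0 -z2 zw !quadE /=; ring.
have wE : w = qc f w.1 by apply: quadP; rewrite ?w2.
have kDg : qc f k%:P * qder g = g * w.
  apply: (qc_mulI up0); transitivity (g * z); last by rewrite zw; ring.
  rewrite /z; transitivity (g * qconj g * qder g); last by ring.
  by rewrite mul_qconj Ng (rmorphM (qc f) k%:P) /=; ring.
have sf := size_cubic al be.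
have k0' : (k%:P : {poly L}) != 0 by rewrite polyC_eq0.
have Nkg : k%:P ^+ 2 * qnorm (qder g) = k%:P * u ^+ p * w.1 ^+ 2.
  by have := congr1 (@qnorm _ _) kDg; rewrite !qnormM Ng qnorm_c {1}wE qnorm_c.
(* D raises the order of the pole at infinity by at most one, so comparing norms gives p + 2 deg w
   <= p + 1. *)
have sw : (size w.1 <= 1)%N.
  have sNg : size (qnorm g) = p.+1 by rewrite Ng mul_polyC size_scale // size_exp_XsubC.
  have [g1 g2] := size_qnorm sf g; rewrite sNg in g1 g2.
  have [w0|w0] := eqVneq w.1 0; first by rewrite w0 size_poly0.
  have sR : size (k%:P * u ^+ p * w.1 ^+ 2) = (p + (size w.1).*2 - 1)%N.
    rewrite -mulrA mul_polyC size_scale // (size_mul up0) ?expf_neq0 // size_exp_XsubC.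
    rewrite expr2 size_mul //.
    by move: w0; rewrite -size_poly_gt0; move: (size w.1) => x; clear; lia.
  have sL : (size (k%:P ^+ 2 * qnorm (qder g))%R <= p.+2)%N.
    rewrite -polyC_exp mul_polyC size_scale ?expf_neq0 //.
    have hg2 : (size g.2 <= N)%N.
      have [->|/g2] := eqVneq g.2 0; first by rewrite size_poly0.
      by move: (size g.2) => x; clear -pN; lia.
    have hg1 : (size g.1 <= N.+1)%N by move: (size g.1) g1 => x; clear -pN; lia.
    have [d1 d2] := size_qder_le hg1 hg2.
    rewrite /qnorm; apply: leq_trans (size_polyD _ _) _; rewrite geq_max size_polyN.
    apply/andP; split.
      apply: leq_trans (size_polyMleq _ _) _.
      by move: (size (qder g).1) d1 => x; clear -pN; lia.
    apply: leq_trans (size_polyMleq _ _) _; rewrite sf.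
    have := size_polyMleq (qder g).2 (qder g).2; rewrite -expr2.
    by move: (size _) (size _) d2 => x y; clear -pN p3; lia.
  move: sL; rewrite Nkg sR; move: (size w.1) => x; clear -p3; lia.
have [c wc] : exists c, w.1 = c%:P by exists w.1`_0; apply: size1_polyC.
exists (c / k); apply: (qc_mulI k0').
have kc : k * (c / k) = c by rewrite mulrC divfK.
by rewrite kDg wE wc mulrA -rmorphM /= -polyCM kc mulrC.
Qed.

Lemma iter_qder_eigen c (g : quad f) n : qder g = qc f c%:P * g ->
  iter n (@qder L f) g = qc f (c ^+ n)%:P * g.
Proof.
move=> e; elim: n => [|n IH]; first by rewrite expr0 rmorph1 mul1r.
by rewrite iterS IH qderM qder_c mul0r add0r e mulrA -rmorphM /= -polyCM -exprSr.
Qed.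

(* If [D g = c g] then [c ^ p g = D ^ p g = 0], so the first component of [g] is
   constant and its norm forces all roots of the cubic to coincide. *)
Lemma hasse0_no_tors x0 y0 (g : quad f) : y0 ^+ 2 = f.[x0] -> y0 != 0 ->
  hasse al be N = 0 -> ~ tors_fun x0 y0 p g.
Proof.
move=> P_on y00 A0 tg; have [c gc] := tors_qder_eigen P_on y00 tg.
have g0 : g != 0.
  by apply/eqP => g0; case: tg => k _ [_]; rewrite g0 /qev /= !horner0 mul0r addr0 eqxx.
have := iter_qder_pchar pL pN g; rewrite (iter_qder_eigen p gc) A0 rmorph0 mul0r => e.
have c0 : c = 0.
  apply/eqP; have : c ^+ p == 0.
    apply/negP => /negP cp; case/negP: g0; apply/eqP.
    by apply: (@qc_mulI _ _ (c ^+ p)%:P); rewrite ?polyC_eq0 // e mulr0.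
  by rewrite expf_eq0 => /andP[].
case: tg => k k0 [Ng _]; have sf := size_cubic al be.
have [c1 g1c] : exists c1, g.1 = c1%:P.
  exists g.1`_0; apply: deriv_eq0_const.
    have := (size_qnorm sf g).1; rewrite Ng mul_polyC size_scale // size_exp_XsubC.
    by move: (size g.1) => x; clear -p3; lia.
  have := congr1 snd gc; rewrite c0 rmorph0 mul0r /= => /eqP.
  by rewrite mulf_eq0 -polyC_natr polyC_eq0 (negPf two) => /eqP.
have fr r : f.[r] = 0 -> k * (r - x0) ^+ p = c1 ^+ 2.
  move=> fr; have := congr1 (horner^~ r) Ng.
  by rewrite /= /qnorm hornerD hornerN !hornerM fr mulr0 subr0 g1c !hornerC horner_exp hornerXsubC => <-; rewrite expr2.
have roots_eq r s : f.[r] = 0 -> f.[s] = 0 -> r = s.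
  move=> /fr er /fr es; have : (r - x0) ^+ p = (s - x0) ^+ p by apply: (mulfI k0); rewrite er es.
  by move/frobenius_inj/(congr1 (+%R^~ x0)); rewrite !subrK.
have /closed_rootP[r] : size f != 1 by rewrite sf.
move=> /[dup] fr0 /factor_theorem[q fq].
have q0 : q != 0 by apply/eqP => q0; have := sf; rewrite fq q0 mul0r size_poly0.
have /closed_rootP[s qs] : size q != 1.
  by have := sf; rewrite fq size_mul ?polyXsubC_eq0 // size_XsubC; case: (size q) => [|[|x]].
have rs : r = s.
  by apply: roots_eq; [apply/eqP | rewrite fq hornerM (eqP qs) mul0r].
have := sep (eqP fr0); rewrite fq derivM derivB derivX derivC subr0 mulr1.
by rewrite hornerD hornerM hornerXsubC subrr mulr0 add0r rs (eqP qs) eqxx.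
Qed.

End NoTorsion.

(** * Eigenfunctions of the derivation *)

Section Torsion.
Variables (L : closedFieldType) (p N : nat).
Hypotheses (pL : p \in [pchar L]) (pN : p = N.*2.+1) (p3 : (3 < p)%N).
Variables al be : L.
Local Notation f := (cubic al be).
Local Notation T := (cop al be).
Hypothesis sep : forall r, f.[r] = 0 -> f^`().[r] != 0.

Let nat_neq0 := pchar_natr_neq0 pL.
Let two : (2 : L) != 0. Proof. by apply: nat_neq0; lia. Qed.

Local Notation shifted_op rs w := (foldr (fun l v => T v - l%:P * v) w rs).

Lemma shifted_opE (rs : seq L) w : shifted_op rs w =
  \sum_(i < (size rs).+1) ((\prod_(l <- rs) ('X - l%:P))`_i)%:P * iter i T w.
Proof.
elim: rs => [|l rs IH] /=.
  by rewrite big_ord1 big_nil coef1 eqxx mul1r.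
rewrite IH big_cons; set q := \prod_(_ <- rs) _; set n := (size rs).+1.
have qn : q`_n = 0 by rewrite nth_default // size_prod_XsubC.
have TE := raddf_sum (@qder2 L f : {additive {poly L} -> {poly L}}).
rewrite [T _]TE [LHS]addrC.
rewrite (eq_bigr (fun i : 'I_n.+1 => (('X * q)`_i)%:P * iter i T w - l%:P * ((q`_i)%:P * iter i T w))); last first.
  by move=> i _; rewrite mulrBl coefB coefCM polyCB polyCM; ring.
rewrite sumrB [X in X - _]big_ord_recl coefXM /= mul0r add0r.
rewrite [X in _ - X]big_ord_recr /= qn mul0r mulr0 addr0 addrC -big_distrr /=.
congr (_ - _); apply: eq_bigr => i _.
by rewrite coefXM /bump /= add0n qder2Z.
Qed.

(** T multiplies the leading coefficient in degree N by 2N(2N+1), and 2N + 1 = p vanishes, so the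
    polynomials of degree at most N form a stable space. *)
Lemma cop_stable (v : {poly L}) : (size v <= N.+1)%N -> (size (T v) <= N.+1)%N.
Proof.
move=> sv; have := @size_cop _ al be v _ sv => sTv.
apply/leq_sizeP => j Nj; have [{Nj}->|ne] := eqVneq j N.+1; last first.
  by rewrite nth_default // (leq_trans sTv) //; lia.
have v0 i : (N < i)%N -> v`_i = 0 by move=> Ni; rewrite nth_default // (leq_trans sv).
rewrite coef_cop (v0 N.+2) // (v0 N.+3) //; last by lia.
have -> : 2 * N%:R + 1 = p%:R :> L by rewrite -natrM natr1 mul2n pN.
by rewrite (pcharf0 pL) !mulr0 mul0r !addr0.
Qed.

(** When the product of the operators T - l kills w, the last nonzero partial result is an
    eigenvector. *)
Lemma shifted_op_eigen rs (w : {poly L}) : w != 0 -> (size w <= N.+1)%N ->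
  shifted_op rs w = 0 ->
  exists (l : L) (v : {poly L}), [/\ l \in rs, v != 0, (size v <= N.+1)%N & T v = l%:P * v].
Proof.
move=> w0 sw; have sB rs' : (size (shifted_op rs' w)%R <= N.+1)%N.
  elim: rs' => //= l rs' IH; apply: leq_trans (size_polyD _ _) _.
  by rewrite geq_max cop_stable // size_polyN mul_polyC (leq_trans (size_scale_leq _ _)).
elim: rs => [/eqP|l rs IH] /=; first by rewrite (negPf w0).
have [/IH[l' [v [lrs v0 sv Tv]]] _|B0 /eqP] := eqVneq (shifted_op rs w) 0.
  by exists l', v; rewrite inE lrs orbT.
by rewrite subr_eq0 => /eqP e; exists l, (shifted_op rs w); rewrite inE eqxx; split.
Qed.

(* Since [T ^ N 'X = A 'X + e], the vector [w = T 'X] satisfies [T ^ N w = A w],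
   so the product of the [T - l] over the N-th roots [l] of [A] kills it. *)
Lemma cop_eigen : hasse al be N != 0 ->
  exists (l : L) (v : {poly L}), [/\ l != 0, v != 0, (size v <= N.+1)%N & T v = l%:P * v].
Proof.
set A := hasse _ _ _ => A0; have N2 : (1 < N)%N by move: p3; rewrite pN; lia.
have [e TX] := iter_cop_X pL pN al be.
pose w := T 'X; have Tw : iter N T w = A%:P * w.
  by rewrite /w -iterSr iterS TX /cop raddfD /= qder2Z qder2C addr0.
have w2 : w`_2 != 0.
  rewrite /w coef_cop !coefX /= !mulr0 !addr0 mulr1.
  have three : (3 : L) != 0 by apply: nat_neq0; lia.
  by have := mulf_neq0 two three; congr (_ != 0); ring.
have w0 : w != 0 by apply: contraNneq w2 => ->; rewrite coef0.
have sw : (size w <= N.+1)%N.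
  by apply: leq_trans (size_cop (n := 2) al be _) _; rewrite ?size_polyX.
pose q : {poly L} := 'X^N - A%:P.
have sq : size q = N.+1 by rewrite size_XnsubC // ltnW.
have mq : q \is monic by rewrite monicXnsubC // ltnW.
have [rs qE] := closed_field_poly_normal q.
rewrite (monicP mq) scale1r in qE.
have srs : size rs = N by have := sq; rewrite qE size_prod_XsubC => -[].
have B0 : shifted_op rs w = 0.
  have qc i : q`_i = (i == N)%:R - (if i == 0%N then A else 0) by rewrite coefB coefXn coefC.
  rewrite shifted_opE -qE srs big_ord_recr /=.
  have -> : (q`_N)%:P * iter N T w = A%:P * w.
    by rewrite qc eqxx; case: eqP => [N0|_]; [move: N2; rewrite N0 | rewrite subr0 mul1r].
  case: N N2 qc {sw sq mq srs Tw TX A0} => // n _ qc.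
  rewrite big_ord_recl /= qc /= sub0r polyCN big1 => [|i _]; first by ring.
  by rewrite qc /bump /= add1n eqSS ltn_eqF // subrr mul0r.
have [l [v [lrs v0 sv Tv]]] := shifted_op_eigen w0 sw B0.
exists l, v; split=> //; apply: contraNneq A0 => l0.
have : root q l by rewrite qE root_prod_XsubC.
rewrite l0 rootE hornerD hornerN hornerC hornerXn expr0n gtn_eqF ?sub0r ?oppr_eq0 //.
exact: ltnW.
Qed.

(** At a root of multiplicity m + 2 the lowest-order term contains 4(m+2)(m+1) f(x), which forces
    f(x) = 0. At a simple root of f the next order contains 2(m+2)(2m+3) f1(x), and all these
    integers lie below p. *)
Lemma cop_eigen_simple_root l (v : {poly L}) x : v != 0 -> (size v <= N.+1)%N ->
  T v = l%:P * v -> v.[x] = 0 -> v^`().[x] != 0.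
Proof.
move=> v0 sv Tv vx; apply/eqP => v'x.
have [k [q]] := multiplicity_XsubC v x; rewrite v0 /= rootE => qx vE.
have sq : (0 < size q)%N by rewrite size_poly_gt0; apply: contraNneq qx => ->; rewrite horner0.
have kN : (k <= N)%N.
  move: sv; rewrite vE size_mul ?expf_neq0 ?polyXsubC_eq0 -?size_poly_gt0 // size_exp_XsubC.
  by move: (size q) sq => s; clear; lia.
set y := 'X - x%:P in vE; have y0 : y != 0 by rewrite polyXsubC_eq0.
have yx : y.[x] = 0 by rewrite hornerXsubC subrr.
have dy : y^`() = 1 by rewrite derivXsubC.
case: k kN vE => [|[|m]] mN vE.
- by move: qx; rewrite -vx vE expr0 mulr1 eqxx.
- move: qx; rewrite -v'x vE expr1 derivM dy hornerD !hornerM yx hornerC.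
  by rewrite mulr0 add0r mulr1 eqxx.
have [v1 v2] := deriv2_mul_exp q m dy; rewrite -vE in v1 v2.
have E1 : 4 * f * (q^`()^`() * y ^+ 2 + 2 * m.+2%:R * q^`() * y + m.+2%:R * m.+1%:R * q)
    + 2 * f^`() * (q^`() * y ^+ 2 + m.+2%:R * q * y) = l%:P * q * y ^+ 2.
  apply: (mulfI (expf_neq0 m y0)); transitivity (T v); last by rewrite Tv vE !exprS; ring.
  by rewrite /cop /qder2 v2 v1 !exprS; ring.
pose c1 : L := 4 * (m.+2%:R * m.+1%:R); pose c2 : L := 2 * m.+2%:R * (2 * m%:R + 3).
have c1_neq0 : c1 != 0 by rewrite !mulf_neq0 ?nat_neq0 //; lia.
have c2E : c2 = 2 * m.+2%:R * (2 * m + 3)%N%:R by rewrite natrD natrM.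
have c2_neq0 : c2 != 0.
  rewrite c2E.
  by rewrite !mulf_neq0 ?nat_neq0 //; lia.
have fx : f.[x] = 0.
  have : c1%:P * f * q = y * (l%:P * q * y - 2 * f^`() * (q^`() * y + m.+2%:R * q)
      - 4 * f * (q^`()^`() * y + 2 * m.+2%:R * q^`())).
    rewrite /c1 !polyCM !polyC_natr; move: (m.+2%:R : {poly L}) (m.+1%:R : {poly L}) E1 => m2 m1 E1.
    by apply: (lin_comb (c := 1) E1); ring.
  move/(congr1 (horner^~ x)); rewrite /= hornerM hornerM (hornerM y) yx mul0r hornerC => /eqP.
  by rewrite mulf_eq0 (negPf qx) orbF mulf_eq0 (negPf c1_neq0) => /eqP.
have /factor_theorem[f1 fE] : root f x by apply/eqP.
have f'E : f^`() = f1 + y * f1^`() by rewrite fE derivM -/y dy; ring.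
have f1x : f1.[x] != 0 by have := sep fx; rewrite f'E hornerD (hornerM y) yx mul0r addr0.
have : c2%:P * f1 * q = y * (l%:P * q - 4 * f1 * (q^`()^`() * y + 2 * m.+2%:R * q^`())
    - 2 * (f1 * q^`() + f1^`() * (q^`() * y + m.+2%:R * q))).
  apply: (mulfI y0).
  rewrite c2E polyCM polyCM !polyC_natr natrD natrM.
  have m1E : m.+1%:R = m%:R + 1 :> {poly L} by rewrite natr1.
  have m2E : m.+2%:R = m%:R + 2 :> {poly L} by rewrite -addn2 natrD.
  rewrite f'E [f in 4 * f]fE m1E m2E -/y in E1 *; move: (m%:R : {poly L}) E1 => m0 E1.
  by apply: (lin_comb (c := 1) E1); ring.
move/(congr1 (horner^~ x)); rewrite /= hornerM hornerM (hornerM y) yx mul0r hornerC => /eqP.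
by rewrite mulf_eq0 (negPf qx) orbF mulf_eq0 (negPf c2_neq0) (negPf f1x).
Qed.
End Torsion.

Section SupersingularShort.
Variables (L : closedFieldType) (p N : nat).
Hypotheses (pL : p \in [pchar L]) (pN : p = N.*2.+1) (p3 : (3 < p)%N).
Variables al be : L.
Local Notation f := (cubic al be).
Hypothesis sep : forall r, f.[r] = 0 -> f^`().[r] != 0.

Let pp : prime p. Proof. exact: pcharf_prime pL. Qed.
Let nat_neq0 := pchar_natr_neq0 pL.
Let two : (2 : L) != 0. Proof. by apply: nat_neq0; lia. Qed.

Lemma deriv_eq0_pchar (g : {poly L}) : (size g <= p.+1)%N -> g^`() = 0 ->
  g = (g`_0)%:P + (g`_p)%:P * 'X^p.
Proof.
move=> gp g0; have p0 := prime_gt0 pp; apply/polyP => i; rewrite coefD coefC coefCM coefXn.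
have [->|ip] := eqVneq i p; first by rewrite gtn_eqF // add0r mulr1.
rewrite mulr0 addr0; case: i ip => //= i ip.
have := congr1 (fun q : {poly L} => q`_i) g0; rewrite /= coef_deriv coef0 -mulr_natl.
move/eqP; rewrite mulf_eq0; case: (ltnP i.+1 p) => ip'.
  by rewrite (negPf (nat_neq0 _)) ?ip' // => /eqP.
by rewrite nth_default // (leq_trans gp) // ltn_neqAle eq_sym ip.
Qed.

Lemma Xn_pchar_root (a b : L) : b != 0 ->
  exists x, a%:P + b%:P * 'X^p = b%:P * ('X - x%:P) ^+ p :> {poly L}.
Proof.
move=> b0; have p0 := prime_gt0 pp.
have /closed_rootP[x] : size ('X^p - (- (a / b))%:P : {poly L}) != 1.
  by rewrite size_XnsubC // eqSS -lt0n.
rewrite rootE hornerD hornerN hornerC hornerXn opprK => /eqP xp.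
exists x; have pP : p \in [pchar {poly L}] by rewrite pchar_poly.
rewrite -(pFrobenius_autE pP ('X - _)) rmorphB /= !pFrobenius_autE -polyC_exp.
have -> : x ^+ p = - (a / b) by apply/eqP; rewrite -addr_eq0 xp.
have -> : a%:P = b%:P * (a / b)%:P by rewrite -polyCM mulrC divfK.
by rewrite polyCN; ring.
Qed.

Lemma qnorm_deriv_root (z : quad f) x : z.1.[x] = 0 -> f.[x] = 0 ->
  (qnorm z)^`().[x] = - (z.2.[x] ^+ 2 * f^`().[x]).
Proof.
case: z => a b /= ax fx; rewrite /qnorm /=.
have -> : (a ^+ 2 - b ^+ 2 * f)^`() = a * (2 * a^`()) - f * (2 * b * b^`()) - b * b * f^`().
  by rewrite derivB (derivM _ f) !expr2 !derivM; ring.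
by rewrite !hornerD !hornerN (hornerM a) (hornerM f) ax fx !mul0r subr0 add0r (hornerM _ f^`()) hornerM expr2.
Qed.

(* From [T v = c ^ 2 v] one gets an eigenfunction [h] of the derivation; its norm
   is killed by the derivation, hence is of the form [k ('X - x0) ^ p]. *)
Lemma exists_tors_fun : hasse al be N != 0 ->
  exists x0 y0 g, [/\ y0 ^+ 2 = f.[x0], y0 != 0 & tors_fun x0 y0 p (g : quad f)].
Proof.
move=> A0; have [l [v [l0 v0 sv Tv]]] := cop_eigen pL pN p3 A0.
have simple x := @cop_eigen_simple_root _ _ _ pL pN p3 _ _ sep l v x v0 sv Tv.
have [c cl] : exists c, c ^+ 2 = l.
  have /closed_rootP[c] : size ('X^2 - l%:P : {poly L}) != 1 by rewrite size_XnsubC.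
  by rewrite rootE hornerD hornerN hornerC hornerXn subr_eq0 => /eqP; exists c.
have c0 : c != 0 by apply: contraNneq l0 => c0; rewrite -cl c0 expr0n.
(* Since D v = 2v'y, the function h is v + (D v)/c, and D^2 v = c^2 v makes it an eigenfunction for
   c. *)
pose d : {poly L} := (2 / c)%:P; have d0 : 2 / c != 0 by rewrite mulf_neq0 ?invr_eq0.
pose h : quad f := (v, d * v^`()).
have cd : c%:P * d = 2 by rewrite /d -polyCM mulrC divfK // polyC_natr.
have dd : d^`() = 0 by rewrite derivC.
have Dh : qder h = qc f c%:P * h.
  apply: quadP; rewrite !quadE /= !mul0r addr0; last by rewrite mulrA cd.
  have cP : c%:P != 0 :> {poly L} by rewrite polyC_eq0.
  apply: (mulfI cP); transitivity (l%:P * v); last by rewrite -cl polyC_exp; ring.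
  rewrite -Tv /cop /qder2 derivM dd; have := cd; move: (v^`()) (v^`()^`()) (f : {poly L}) (f^`()) => a b g f' cd'.
  by apply: (lin_comb (c := 2 * b * g + a * f') cd'); ring.
have N' : (qnorm h)^`() = 0.
  have : qder (h * qconj h) = 0.
    by rewrite qderM qconj_qder Dh qconjM; apply: quadP; rewrite !quadE /= ?oppr0; ring.
  rewrite mul_qconj qder_qc => /(congr1 snd); rewrite !quadE /= => e.
  have {e} : 2 * (qnorm h)^`() = 0 by rewrite -[RHS]e; ring.
  by move/eqP; rewrite mulf_eq0 -polyC_natr polyC_eq0 (negPf two) => /eqP.
have sf := size_cubic al be.
have sN : (size (qnorm h) <= p.+1)%N.
  have sh2 : (size h.2 <= N)%N.
    rewrite /h /= mul_polyC; apply: leq_trans (size_scale_leq _ _) _.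
    by apply: leq_trans (size_poly _ _) _; rewrite -subn1 leq_subLR add1n.
  rewrite /qnorm; apply: leq_trans (size_polyD _ _) _; rewrite geq_max size_polyN.
  apply/andP; split.
    rewrite expr2; apply: leq_trans (size_polyMleq _ _) _.
    by rewrite /h /=; move: (size v) sv => s; clear -pN; lia.
  apply: leq_trans (size_polyMleq _ _) _; rewrite sf.
  have := size_polyMleq h.2 h.2; rewrite -expr2.
  by move: (size _) (size _) sh2 => s t; clear -pN p3; lia.
have NE := deriv_eq0_pchar sN N'.
(* Otherwise the norm is constant, which forces v' = 0 and then l v = T v = 0. *)
have n1 : (qnorm h)`_p != 0.
  apply/eqP => n1; have h2 : h.2 = 0.
    apply: (size_qnorm_le3 sf); rewrite NE n1 mul0r addr0.
    exact: leq_trans (size_polyC_leq1 _) _.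
  have v'0 : v^`() = 0.
    by move/eqP: h2; rewrite /h /= mulf_eq0 polyC_eq0 (negPf d0) => /eqP.
  move: Tv; rewrite /cop /qder2 v'0 deriv0 !mulr0 addr0 => /esym/eqP.
  by rewrite mulf_eq0 polyC_eq0 (negPf l0) (negPf v0).
have [x0 xE] := Xn_pchar_root (qnorm h)`_0 n1; rewrite -NE in xE.
have p1 : (1 < p)%N by lia.
have Nx : v.[x0] ^+ 2 = h.2.[x0] ^+ 2 * f.[x0].
  have := congr1 (horner^~ x0) xE; rewrite /= hornerM horner_exp hornerXsubC subrr.
  rewrite expr0n gtn_eqF ?(ltnW p1) // mulr0 /qnorm hornerD hornerN (hornerM _ f) !horner_exp.
  by move/eqP; rewrite subr_eq0 => /eqP.
have bx : h.2.[x0] != 0.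
  apply/eqP => bx; move: Nx; rewrite bx expr0n mul0r => /eqP; rewrite expf_eq0 /= => /eqP vx.
  by move/eqP: bx; rewrite /h /= hornerM hornerC mulf_eq0 (negPf d0) (negPf (simple _ vx)).
have vx : v.[x0] != 0.
  apply/eqP => vx; move: Nx; rewrite vx expr0n => /esym/eqP; rewrite mulf_eq0 expf_eq0 /= (negPf bx) /= => /eqP fx.
  have := congr1 (horner^~ x0) N'; rewrite /= qnorm_deriv_root //.
  by move/eqP; rewrite horner0 oppr_eq0 mulf_eq0 expf_eq0 (negPf bx) (negPf (sep fx)).
(* The sign of y0 makes h vanish at (x0, y0), with value 2 v(x0) at the opposite point. *)
exists x0, (- (v.[x0] / h.2.[x0])), h; split.
- by rewrite sqrrN expr_div_n Nx mulrC mulKf // expf_neq0.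
- by rewrite oppr_eq0 mulf_neq0 ?invr_eq0.
exists (qnorm h)`_p => //; split=> //.
rewrite /qev opprK mulrC divfK // -mulr2n -mulr_natl mulf_neq0 //.
Qed.

End SupersingularShort.

(** * Supersingularity and the vanishing of the Hasse invariant *)

Section SupersingularHasse.
Variables (L : closedFieldType) (p N : nat).
Hypotheses (pL : p \in [pchar L]) (pN : p = N.*2.+1) (p3 : (3 < p)%N).
Variables al be : L.
Local Notation f := (cubic al be).
Local Notation E := (short_w al be).
Hypothesis sep : forall r, f.[r] = 0 -> f^`().[r] != 0.

Let pp : prime p. Proof. exact: pcharf_prime pL. Qed.
Let two : (2 : L) != 0. Proof. by apply: (pchar_natr_neq0 pL); lia. Qed.

(** The multiples of P are the orbit of O under Q -> P + Q, so a return to O makes them periodic. *)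
Lemma pt_muln_add P i j : pt_muln E j P = Infinity ->
  pt_muln E (i + j) P = pt_muln E i P.
Proof. by rewrite /pt_muln iterD => ->. Qed.

Lemma pt_muln_period P i j : pt_muln E j P = Infinity ->
  pt_muln E i P = pt_muln E (i %% j) P.
Proof.
move=> Pj; rewrite {1}(divn_eq i j); elim: (i %/ j)%N => [|k IH]; first by rewrite mul0n.
by rewrite mulSn -addnA addnC pt_muln_add.
Qed.

Lemma pt_muln_double0 x : pt_muln E 2 (Affine x 0) = Infinity.
Proof. by rewrite /pt_muln /= eqxx !(mul0r, addr0) eqxx. Qed.

Lemma pt_muln_order P n : (0 < n)%N -> pt_muln E n P = Infinity ->
  exists2 d, (0 < d)%N && (d %| n)%N &
    pt_muln E d P = Infinity /\ forall j, (0 < j < d)%N -> pt_muln E j P <> Infinity.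
Proof.
move=> n0 Pn; pose Q d := (0 < d)%N && (if pt_muln E d P is Infinity then true else false).
have QP d : reflect (0 < d /\ pt_muln E d P = Infinity)%N (Q d).
  by apply: (iffP andP) => -[d0]; case: (pt_muln E d P).
have ex : exists d, Q d by exists n; apply/QP.
case: (ex_minnP ex) => d /QP[d0 Pd] dmin.
have lt j : (0 < j < d)%N -> pt_muln E j P <> Infinity.
  move=> /andP[j0 jd] Pj; have /dmin : Q j by apply/QP.
  by rewrite leqNgt jd.
exists d => //; rewrite d0 /= /dvdn; case: posnP => // r0; exfalso.
by apply: (lt (n %% d)%N); [rewrite r0 ltn_pmod | rewrite -pt_muln_period].
Qed.

(** If P had an order d < p, then gcd(p,d) = 1 would give a function with divisor P - O, excluded by
    [tors1]. Hence Q = (p-1)P is finite, and g divided by its Miller function has divisor P + Q - 2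
    O. A norm of degree 2 leaves only functions of x, so x = x0, and Q = P being excluded, Q =
    -P. *)
Lemma tors_muln_pchar x0 y0 (g : quad f) : y0 ^+ 2 = f.[x0] -> y0 != 0 ->
  tors_fun x0 y0 p g -> pt_muln E p (Affine x0 y0) = Infinity.
Proof.
move=> P_on y00 tg; set P := Affine x0 y0.
have nO j : (0 < j < p)%N -> pt_muln E j P <> Infinity.
  move=> /andP[j0 jp] Pj; have [d /andP[d0 dj] [Pd dmin]] := pt_muln_order j0 Pj.
  have dp : (d < p)%N by apply: leq_ltn_trans (dvdn_leq j0 dj) jp.
  have cd : gcdn p d = 1%N by apply/eqP; rewrite -/(coprime p d) prime_coprime // gtnNdvd.
  case: d d0 dp cd Pd dmin {dj} => [|[|[|d]]] // _ dp cd Pd dmin.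
    have [x [y [h [PP _]]]] := miller_start two P_on y00.
    by move: Pd; rewrite /P pt_muln2 PP.
  have [h th] := tors_muln two sep P_on y00 (isT : (2 < d.+3)%N) Pd dmin.
  have [h' th'] := tors_gcd two P_on y00 tg th.
  by rewrite cd in th'; apply: tors1 th'.
have [i pE] : exists i, p = i.+3 by exists (p - 3)%N; lia.
have [|x [y [h [Pi c mh]]]] := miller_muln two sep P_on y00 (i := i).
  by move=> j ji; apply: nO; rewrite pE; lia.
rewrite pE -[pt_muln E i.+3 P]/(pt_add E P (pt_muln E i.+2 P)) Pi.
have yneq := miller_neq c mh; case: mh => k k0 [Nh hQ hP].
case: tg => k' k'0 [Ng gP]; set u := 'X - x0%:P in Nh Ng.
have u0 : u != 0 by rewrite polyXsubC_eq0.
have [w gw] : exists w, g * qconj h = qc f (u ^+ i.+2) * w.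
  apply: (@qev_dvdn _ _ x0 y0 i.+2 _ (qconj g) h (qc f (k'%:P * u) * qconj h)
           (qc f (k%:P * ('X - x%:P)) * g)).
  - exact: mulf_neq0.
  - exact: P_on.
  - by rewrite qev_conj.
  - by [].
  - transitivity (g * qconj g * qconj h); first by ring.
    rewrite mul_qconj Ng pE (exprS u i.+2) !(rmorphM (qc f) k'%:P) (rmorphM (qc f) u) /=.
    move: (qc f k'%:P) (qc f (u ^+ i.+2)) (qc f u) (qconj h) => a b c' d; ring.
  - transitivity (g * (h * qconj h)); first by ring.
    rewrite mul_qconj Nh !(rmorphM (qc f) k%:P) (rmorphM (qc f) (u ^+ i.+2)) /=.
    move: (qc f k%:P) (qc f (u ^+ i.+2)) (qc f ('X - x%:P)) => a b c'; ring.
have Nw : qnorm w = (k * k')%:P * (u * ('X - x%:P)).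
  have ui : u ^+ i.+2 != 0 by rewrite expf_neq0.
  apply: (mulfI (mulf_neq0 ui ui)); transitivity (qnorm (g * qconj h)).
    by rewrite gw qnormM qnorm_c; ring.
  rewrite qnormM qnorm_conj Ng Nh pE (exprS u i.+2) polyCM; move: (u ^+ i.+2) => a; ring.
have kk : k * k' != 0 by rewrite mulf_neq0.
have w2 : w.2 = 0.
  apply: (size_qnorm_le3 (size_cubic al be)).
  rewrite Nw mul_polyC size_scale // size_mul ?polyXsubC_eq0 // !size_XsubC //.
have ex : x = x0.
  move: Nw; rewrite /qnorm w2 expr0n mul0r subr0 => Nw.
  have /factor_theorem[q wq] : root w.1 x0.
    have := congr1 (horner^~ x0) Nw; rewrite /= expr2 !hornerM hornerXsubC subrr mul0r mulr0.
    by move/eqP; rewrite mulf_eq0 orbb.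
  have : q ^+ 2 * u = (k * k')%:P * ('X - x%:P).
    by apply: (mulfI u0); transitivity (w.1 ^+ 2); [rewrite wq -/u | rewrite Nw]; ring.
  move/(congr1 (horner^~ x0)); rewrite /= hornerM hornerXsubC subrr mulr0 hornerM hornerXsubC hornerC.
  by move/esym/eqP; rewrite mulf_eq0 (negPf kk) subr_eq0 => /eqP.
have ey : y = - y0.
  have : (y - y0) * (y + y0) = 0.
    by apply: (lin_comb (c := 1) (_ : y ^+ 2 = y0 ^+ 2)); [rewrite c P_on ex | ring].
  move/eqP; rewrite mulf_eq0 subr_eq0 addr_eq0 => /orP[/eqP ey|/eqP //].
  by case: yneq.
by rewrite /= ex ey eqxx subrr !(mul0r, addr0) eqxx.
Qed.

Lemma supersingular_short : supersingular p E <-> hasse al be N = 0.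
Proof.
split=> [ss|A0 P PE Pp].
  apply/eqP/negPn/negP => A0; have [x0 [y0 [g [c y00 tg]]]] := exists_tors_fun pL pN p3 sep A0.
  have := ss (Affine x0 y0); rewrite on_short_curve c eqxx => /(_ isT).
  by move/(_ (tors_muln_pchar c y00 tg)).
case: P PE Pp => // x0 y0; rewrite on_short_curve => /eqP c Pp.
have [d /andP[d0 dp] [Pd dmin]] := pt_muln_order (prime_gt0 pp) Pp.
have p_odd : (p %% 2)%N = 1%N by rewrite modn2 pN oddS odd_double.
have y00 : y0 != 0.
  apply/eqP => y00; rewrite y00 in Pp; have P2 := pt_muln_double0 x0.
  by have := pt_muln_period p P2; rewrite p_odd Pp.
case/primeP: pp => _ /(_ d dp) /orP[/eqP d1|/eqP dE]; first by move: Pd; rewrite d1.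
rewrite dE in dmin; have p2 : (2 < p)%N by apply: ltnW.
have [g tg] := tors_muln two sep c y00 p2 Pp dmin.
by case: (hasse0_no_tors pL pN p3 sep c y00 A0 tg).
Qed.

End SupersingularHasse.

(** * The supersingular polynomial *)

Section ChangeOfVariables.
Variable K : fieldType.
Implicit Types E : weierstrass K.
Variables u r s t : K.
Hypothesis u0 : u != 0.
Local Notation change := (w_change u r s t).

Lemma w_b2_change E : w_b2 (change E) = (w_b2 E + 12 * r) / u ^+ 2.
Proof. by rewrite /w_b2 /=; field. Qed.

Lemma w_b4_change E : w_b4 (change E) = (w_b4 E + r * w_b2 E + 6 * r ^+ 2) / u ^+ 4.
Proof. by rewrite /w_b4 /w_b2 /=; field. Qed.

Lemma w_b6_change E :
  w_b6 (change E) = (w_b6 E + 2 * r * w_b4 E + r ^+ 2 * w_b2 E + 4 * r ^+ 3) / u ^+ 6.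
Proof. by rewrite /w_b6 /w_b4 /w_b2 /=; field. Qed.

Lemma w_b8_change E :
  w_b8 (change E) = (w_b8 E + 3 * r * w_b6 E + 3 * r ^+ 2 * w_b4 E + r ^+ 3 * w_b2 E
                     + 3 * r ^+ 4) / u ^+ 8.
Proof. by rewrite /w_b8 /w_b6 /w_b4 /w_b2 /=; field. Qed.

Lemma w_b_rel E : 4 * w_b8 E = w_b2 E * w_b6 E - w_b4 E ^+ 2.
Proof. by rewrite /w_b8 /w_b6 /w_b4 /w_b2; ring. Qed.

Lemma w_c4_change E : w_c4 (change E) = w_c4 E / u ^+ 4.
Proof. by rewrite /w_c4 w_b2_change w_b4_change; field. Qed.

Lemma w_disc_change E : w_disc (change E) = w_disc E / u ^+ 12.
Proof.
rewrite /w_disc w_b2_change w_b4_change w_b6_change w_b8_change.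
have := w_b_rel E; move: (w_b2 E) (w_b4 E) (w_b6 E) (w_b8 E) => b2 b4 b6 b8 rel.
apply: (lin_comb (c := (- 6 * r * b2 - 36 * r ^+ 2) / u ^+ 12) rel).
by field.
Qed.

Lemma j_inv_change E : j_inv (change E) = j_inv E.
Proof.
rewrite /j_inv w_c4_change w_disc_change.
have [->|d0] := eqVneq (w_disc E) 0; first by rewrite mul0r !invr0 !mulr0.
by field; rewrite u0 d0.
Qed.

Lemma elliptic_change E : elliptic (change E) = elliptic E.
Proof. by rewrite /elliptic w_disc_change mulf_eq0 invr_eq0 expf_eq0 (negPf u0) andbF orbF. Qed.

Definition w_map (P : Defs.point K) : Defs.point K :=
  if P is Affine x y then
    Affine ((x - r) / u ^+ 2) ((y - s * (x - r) - t) / u ^+ 3)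
  else Infinity.

Lemma on_curve_change E P : on_curve (change E) (w_map P) = on_curve E P.
Proof.
case: P => // x y /=; have u6 : u ^+ 6 != 0 by rewrite expf_neq0.
rewrite -subr_eq0 -[RHS]subr_eq0 -[RHS](mulrI_eq0 _ (mulfI (invr_neq0 u6))).
by congr (_ == 0); field.
Qed.

Lemma w_map_inf P : w_map P = Infinity -> P = Infinity. Proof. by case: P. Qed.

Lemma pt_add_change E P Q : on_curve E P -> on_curve E Q ->
  pt_add (change E) (w_map P) (w_map Q) = w_map (pt_add E P Q).
Proof.
case: P Q => [|x1 y1] [|x2 y2] // c1 c2; rewrite [LHS]/= [pt_add E _ _]/=.
have u2 : u ^+ 2 != 0 by rewrite expf_neq0.
have xE : ((x1 - r) / u ^+ 2 == (x2 - r) / u ^+ 2) = (x1 == x2).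
  by rewrite (inj_eq (mulIf (invr_neq0 u2))) (inj_eq (addIr _)).
rewrite xE; have [ex|nx] /= := eqVneq x1 x2.
  have u3 : u ^+ 3 != 0 by rewrite expf_neq0.
  have dE : (y1 - s * (x1 - r) - t) / u ^+ 3 + (y2 - s * (x2 - r) - t) / u ^+ 3 +
      (a1 E + 2 * s) / u * ((x2 - r) / u ^+ 2) + (a3 E + r * a1 E + 2 * t) / u ^+ 3
      = (y1 + y2 + a1 E * x2 + a3 E) / u ^+ 3 by rewrite ex; field.
  rewrite dE mulf_eq0 invr_eq0 (negPf u3) orbF; case: eqP => // /eqP d0.
  (* With equal abscissae the points are equal or opposite on the curve, and the opposite case gave
     Infinity. *)
  have yy : y1 = y2.
    apply/eqP; rewrite -subr_eq0; apply/eqP; apply: (mulIf d0); rewrite mul0r.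
    move: c1 c2; rewrite /= ex => /eqP c1 /eqP c2.
    by apply: (lin_comb (c := 1) (etrans c1 (esym c2))); ring.
  have d1 : 2 * y1 + a1 E * x1 + a3 E != 0 by move: d0; rewrite -yy -ex; congr (_ != 0); ring.
  have dE' : 2 * ((y1 - s * (x1 - r) - t) / u ^+ 3) + (a1 E + 2 * s) / u * ((x1 - r) / u ^+ 2)
     + (a3 E + r * a1 E + 2 * t) / u ^+ 3 = (2 * y1 + a1 E * x1 + a3 E) / u ^+ 3 by field.
  rewrite dE' -ex; congr Affine; field; rewrite ?u0 ?d1 //.
have dx : x2 - x1 != 0 by rewrite subr_eq0 eq_sym.
have dxE : (x2 - r) / u ^+ 2 - (x1 - r) / u ^+ 2 = (x2 - x1) / u ^+ 2 by field.
by rewrite dxE; congr Affine; field; rewrite ?u0 ?dx.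
Qed.

End ChangeOfVariables.

(** * Short Weierstrass forms and twists *)

Section ShortForm.
Variable L : fieldType.
Hypotheses (two : (2 : L) != 0) (three : (3 : L) != 0).

Lemma short_form (E : weierstrass L) :
  exists r s t al be, w_change 1 r s t E = short_w al be.
Proof.
pose s := - a1 E / 2; pose r := - (a2 E - s * a1 E - s ^+ 2) / 3.
pose t := - (a3 E + r * a1 E) / 2.
exists r, s, t; do 2 eexists; rewrite /w_change /short_w; congr Weierstrass.
- by rewrite /s; field; rewrite ?two ?oner_neq0.
- by rewrite /r /s; field; rewrite ?two ?three ?oner_neq0.
- by rewrite /t; field; rewrite ?two ?oner_neq0.
Qed.

Lemma supersingular_change p u r s t (E : weierstrass L) al be : u != 0 ->
  w_change u r s t E = short_w al be ->
  supersingular p E <-> supersingular p (short_w al be).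
Proof.
move=> u0 eE; pose phi := w_map u r s t.
have on P : on_curve (short_w al be) (phi P) = on_curve E P by rewrite -eE on_curve_change.
have short_add P Q : on_curve (short_w al be) P -> on_curve (short_w al be) Q ->
    on_curve (short_w al be) (pt_add (short_w al be) P Q).
  case: P Q => [|x1 y1] [|x2 y2] //; case PQ : (pt_add _ _ _) => [|x y] //.
  rewrite !on_short_curve => /eqP c1 /eqP c2; apply/eqP; exact: pt_add_on PQ.
have mulE P n : on_curve E P ->
    on_curve E (pt_muln E n P) /\ phi (pt_muln E n P) = pt_muln (short_w al be) n (phi P).
  move=> c; elim: n => // n [IH1 IH2].
  have -> : pt_muln E n.+1 P = pt_add E P (pt_muln E n P) by [].
  have e : phi (pt_add E P (pt_muln E n P)) = pt_muln (short_w al be) n.+1 (phi P).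
    by rewrite /phi -pt_add_change // eE -/phi IH2.
  by split=> //; rewrite -on e /= short_add // ?on // -IH2 on.
split=> ss P c Pp.
  case: P c Pp => // x y c Pp.
  pose Q := Affine (u ^+ 2 * x + r) (u ^+ 3 * y + u ^+ 2 * s * x + t).
  have QE : phi Q = Affine x y by congr Affine; field.
  have cQ : on_curve E Q by rewrite -on QE.
  suff : Q = Infinity by [].
  by apply: ss => //; apply: (@w_map_inf _ u r s t); rewrite -/phi (mulE Q p cQ).2 QE.
apply: (@w_map_inf _ u r s t); apply: ss; first by rewrite on.
by rewrite -/phi -(mulE P p c).2 Pp.
Qed.

Lemma w_c4_short (al be : L) : w_c4 (short_w al be) = - 48 * al.
Proof. by rewrite /w_c4 /w_b2 /w_b4 /=; ring. Qed.

Lemma w_disc_short (al be : L) : w_disc (short_w al be) = - 16 * (4 * al ^+ 3 + 27 * be ^+ 2).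
Proof. by rewrite /w_disc /w_b8 /w_b2 /w_b4 /w_b6 /=; ring. Qed.

Lemma short_sep (al be : L) : elliptic (short_w al be) ->
  forall r, (cubic al be).[r] = 0 -> (cubic al be)^`().[r] != 0.
Proof.
rewrite /elliptic w_disc_short => d r; rewrite horner_cubic => fr; apply/eqP.
rewrite cubic_deriv hornerD hornerC -polyC_natr hornerM hornerC hornerXn => f'r.
have eal : al = - 3 * r ^+ 2 by apply: (lin_comb (c := 1) f'r); ring.
have ebe : be = 2 * r ^+ 3 by apply: (lin_comb (c := 1) fr); rewrite eal; ring.
by case/eqP: d; rewrite eal ebe; ring.
Qed.

(* With [c := 1 - 1728 / j], the curve with coefficients [- 3 c] and [2 c ^ 2]
   is the twist of [y ^ 2 = x ^ 3 + al x + be] by [nu = 9 be / (2 al ^ 2)]. *)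
Lemma short_twist (al be : L) (j := j_inv (short_w al be)) :
  elliptic (short_w al be) -> j != 0 -> j != 1728%:R ->
  exists2 nu, nu != 0 & nu ^+ 2 * al = - 3 * (1 - 1728 / j) /\
                        nu ^+ 3 * be = 2 * (1 - 1728 / j) ^+ 2.
Proof.
rewrite /j /elliptic /j_inv w_disc_short w_c4_short => d j0 j1.
have al0 : al != 0 by apply: contraNneq j0 => ->; rewrite mulr0 expr0n mul0r.
have d1 : 4 * al ^+ 3 + 27 * be ^+ 2 != 0 by apply: contraNneq d => ->; rewrite mulr0.
have n16 : - 16 != 0 :> L.
  have -> : - 16 = - 2 ^+ 4 :> L by ring.
  by rewrite oppr_eq0 expf_neq0.
have be0 : be != 0.
  apply: contraNneq j1 => be0; rewrite be0 expr0n mulr0 addr0 in d1 *.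
  apply/eqP; apply: (mulIf d); rewrite be0 expr0n mulr0 addr0 divfK; last by rewrite mulf_neq0.
  by rewrite -[1728%:R]/(1728 : L); ring.
have cE : 1 - 1728 / ((- 48 * al) ^+ 3 / (- 16 * (4 * al ^+ 3 + 27 * be ^+ 2)))
    = - 27 * be ^+ 2 / (2 ^+ 2 * al ^+ 3).
  have gen (m n X D : L) : m != 0 -> n != 0 -> X != 0 -> D != 0 ->
      1 - m / (n * (m * X) / (n * D)) = (X - D) / X.
    by move=> m0 n0 X0 D0; field; rewrite m0 n0 X0 D0.
  have -> : (- 48 * al) ^+ 3 = - 16 * (1728 * (2 ^+ 2 * al ^+ 3)) by ring.
  have n1728 : 1728 != 0 :> L.
    have -> : 1728 = 2 ^+ 6 * 3 ^+ 3 :> L by ring.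
    by rewrite mulf_neq0 ?expf_neq0.
  rewrite gen ?mulf_neq0 ?expf_neq0 //; congr (_ / _); ring.
exists (9 * be / (2 * al ^+ 2)).
  have -> : 9 = 3 ^+ 2 :> L by ring.
  by rewrite !mulf_neq0 ?invr_neq0 ?mulf_neq0 ?expf_neq0.
have four : (4 : L) != 0.
  have -> : 4 = 2 ^+ 2 :> L by ring.
  by rewrite expf_neq0.
by rewrite cE; split; field; rewrite ?al0 ?two ?four.
Qed.

(** The curve with coefficients -3c and 2c^2, c = 1 - 1728/x, twisted by x to clear denominators. *)
Lemma j_inv_surj (x : L) : x != 0 -> x != 1728%:R ->
  exists2 E : weierstrass L, elliptic E & j_inv E = x.
Proof.
move=> x0 x1; have n1728 : 1728 != 0 :> L.
  have -> : 1728 = 2 ^+ 6 * 3 ^+ 3 :> L by ring.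
  by rewrite mulf_neq0 ?expf_neq0.
have [y yE] : exists y, y = x - 1728 by exists (x - 1728).
have y0 : y != 0 by rewrite yE subr_eq0.
have dE : w_disc (short_w (- 3 * (x * y)) (2 * (x * y ^+ 2))) = 1728 * (1728 * (x ^+ 2 * y ^+ 3)).
  by rewrite w_disc_short {}yE; ring.
exists (short_w (- 3 * (x * y)) (2 * (x * y ^+ 2))).
  by rewrite /elliptic dE !mulf_neq0 ?expf_neq0.
rewrite /j_inv dE w_c4_short.
have -> : (- 48 * (- 3 * (x * y))) ^+ 3 = x * (1728 * (1728 * (x ^+ 2 * y ^+ 3))) by ring.
by rewrite mulfK // !mulf_neq0 ?expf_neq0.
Qed.

End ShortForm.

(** * Supersingular j-invariants as inverse roots of H *)

Section SupersingularRoots.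
Variables (L : closedFieldType) (p N : nat).
Hypotheses (pL : p \in [pchar L]) (pN : p = N.*2.+1) (p3 : (3 < p)%N).

Let two : (2 : L) != 0. Proof. by apply: (pchar_natr_neq0 pL); lia. Qed.
Let three : (3 : L) != 0. Proof. by apply: (pchar_natr_neq0 pL); lia. Qed.

Lemma horner_cusp_poly (x : L) : (cusp_poly L).[x] = 1 - 1728 * x.
Proof.
by rewrite /cusp_poly hornerD hornerN hornerM hornerX -polyC_natr !hornerC.
Qed.

Lemma horner_hpoly (x : L) :
  (hpoly L N).[x] = hasse (- 3 * (1 - 1728 * x)) (2 * (1 - 1728 * x) ^+ 2) N.
Proof.
rewrite -horner_cusp_poly -[LHS]/(horner_eval x _) /hpoly -hasse_map; congr hasse.
  by rewrite rmorphM rmorphN rmorph_nat.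
by rewrite (rmorphM _ 2) rmorphXn rmorph_nat.
Qed.

Lemma short_formP (E : weierstrass L) : elliptic E -> exists r s t al be,
  [/\ w_change 1 r s t E = short_w al be, elliptic (short_w al be) &
      j_inv (short_w al be) = j_inv E].
Proof.
move=> eE; have [r [s [t [al [be e]]]]] := short_form two three E.
have o1 := oner_neq0 L.
by exists r, s, t, al, be; split=> //; rewrite -e ?elliptic_change ?j_inv_change.
Qed.

Lemma supersingular_hpoly (E : weierstrass L) :
  elliptic E -> j_inv E != 0 -> j_inv E != 1728%:R ->
  supersingular p E <-> root (hpoly L N) (j_inv E)^-1.
Proof.
move=> eE; have [r [s [t [al [be [sE es <-]]]]]] := short_formP eE => j0 j1.
have [nu nu0 [nal nbe]] := short_twist two three es j0 j1.
apply: iff_trans (supersingular_change p (oner_neq0 L) sE) _.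
apply: iff_trans (supersingular_short pL pN p3 (short_sep es)) _.
rewrite rootE horner_hpoly -nal -nbe.
have e := hasse_scale nu al be N; split=> [A0|/eqP A0].
  by move/eqP: e; rewrite A0 mulr0 mulf_eq0 (negPf nu0).
by move/esym/eqP: e; rewrite A0 mulr0 mulf_eq0 expf_eq0 (negPf nu0) andbF => /eqP.
Qed.

(** Both short forms are twists of one curve depending only on j, and the ratio of the twisting
    factors is a square in L. *)
Lemma w_iso_j_inv (E E' : weierstrass L) :
  elliptic E -> elliptic E' -> j_inv E != 0 -> j_inv E != 1728%:R ->
  j_inv E = j_inv E' -> w_iso E E'.
Proof.
move=> eE eE'; have [r [s [t [al [be [sE es jE]]]]]] := short_formP eE.
have [r' [s' [t' [al' [be' [sE' es' jE']]]]]] := short_formP eE'.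
rewrite -jE -jE' => j0 j1 jj; have o1 := oner_neq0 L.
have iso (F F' : weierstrass L) u r0 s0 t0 : u != 0 -> w_change u r0 s0 t0 F = F' -> w_iso F F'.
  by move=> u0 <-; apply/asboolP; exists u, r0, s0, t0.
have isoE := iso _ _ _ _ _ _ o1 sE; have isoE' := iso _ _ _ _ _ _ o1 sE'.
apply: w_iso_trans isoE _; apply: (w_iso_trans _ (_ : w_iso (short_w al' be') E')); last by rewrite w_iso_sym.
have [nu nu0 [nal nbe]] := short_twist two three es j0 j1.
rewrite jj in j0 j1 nal nbe; have [nu' nu'0 [nal' nbe']] := short_twist two three es' j0 j1.
have [u uE] : exists u, u ^+ 2 = nu' / nu.
  have /closed_rootP[u] : size ('X^2 - (nu' / nu)%:P : {poly L}) != 1 by rewrite size_XnsubC.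
  by rewrite rootE hornerD hornerN hornerC hornerXn subr_eq0 => /eqP; exists u.
have u0 : u != 0.
  by apply/eqP => u0; move/eqP: uE; rewrite u0 expr0n eq_sym mulf_eq0 invr_eq0 (negPf nu0) (negPf nu'0).
apply: (iso _ _ u 0 0 0) => //; rewrite /w_change /short_w /=.
have e4 : u ^+ 4 = (nu' / nu) ^+ 2 by rewrite -uE -exprM.
have e6 : u ^+ 6 = (nu' / nu) ^+ 3 by rewrite -uE -exprM.
have ale : nu ^+ 2 * al = nu' ^+ 2 * al' by rewrite nal nal'.
have bee : nu ^+ 3 * be = nu' ^+ 3 * be' by rewrite nbe nbe'.
have n2 : nu' ^+ 2 != 0 by rewrite expf_neq0.
have n3 : nu' ^+ 3 != 0 by rewrite expf_neq0.
congr Weierstrass; try by field.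
  apply: (mulfI n2); rewrite -ale e4 !(mul0r, mulr0, subr0, addr0); field.
  by rewrite nu'0 nu0.
apply: (mulfI n3); rewrite -bee e6 !(mul0r, mulr0, subr0, addr0, expr0n); field.
by rewrite nu'0 nu0.
Qed.

End SupersingularRoots.

(** * The supersingular polynomial and its descent to F_p *)

Section SupersingularPolynomial.
Variables (p N : nat) (pp : prime p) (pN : p = N.*2.+1) (p3 : (3 < p)%N).
Local Notation L := (Fpbar p).
Local Notation embed := (Fp_embed p).
Local Notation HL := (hpoly L N).

Lemma pchar_Fpbar : p \in [pchar L].
Proof. exact: rmorph_pchar embed _ (pchar_Fp pp). Qed.
Let pL := pchar_Fpbar.
Let two : (2 : L) != 0. Proof. by apply: (pchar_natr_neq0 pL); lia. Qed.
Let three : (3 : L) != 0. Proof. by apply: (pchar_natr_neq0 pL); lia. Qed.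

Lemma hpoly_map (R S : fieldType) (phi : {rmorphism R -> S}) n :
  map_poly phi (hpoly R n) = hpoly S n.
Proof.
have cE : map_poly phi (cusp_poly R) = cusp_poly S.
  by rewrite /cusp_poly rmorphB rmorph1 (rmorphM _ 1728) rmorph_nat /= map_polyX.
have gen (A B : comNzRingType) (psi : {rmorphism A -> B}) c :
    psi (hasse (- 3 * c) (2 * c ^+ 2) n) = hasse (- 3 * psi c) (2 * psi c ^+ 2) n.
  rewrite -(hasse_map psi); congr hasse; first by rewrite rmorphM rmorphN rmorph_nat.
  by rewrite (rmorphM _ 2) rmorphXn rmorph_nat.
by rewrite /hpoly (gen _ _ (map_poly phi)) /= cE.
Qed.

Lemma hpolyL_neq0 : HL != 0.
Proof. by apply/eqP => e; have := hpoly0 pL pN p3; rewrite e horner0 eqxx. Qed.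

Lemma ss_classesP (c : iso_class L) : ss_classes p c <->
  [/\ elliptic (repr c), j_inv (repr c) != 0, j_inv (repr c) != 1728%:R &
      root HL (j_inv (repr c))^-1].
Proof.
rewrite /ss_classes /=; split=> [[e s j0 j1]|[e j0 j1 r]]; split=> //.
  exact/(supersingular_hpoly pL pN p3).
exact/(supersingular_hpoly pL pN p3).
Qed.

Lemma ss_classes_inj (c d : iso_class L) : ss_classes p c -> ss_classes p d ->
  j_inv (repr c) = j_inv (repr d) -> c = d.
Proof.
move=> /ss_classesP[ec j0 j1 _] /ss_classesP[ed _ _ _] jj.
have iso := w_iso_j_inv pL pN p3 ec ed j0 j1 jj.
by rewrite -[c]reprK -[d]reprK; apply/eqquotP.
Qed.

(** The j-invariant embeds the classes into the inverses of the roots of H; finiteness is what makes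
    [ss_poly_bar] a genuine product. *)
Lemma ss_classes_finite : exists2 cs : seq (iso_class L),
  uniq cs & ss_classes p = [set` cs]%classic.
Proof.
have inj : {in ss_classes p &, injective (fun c => j_inv (repr c))}.
  by move=> c d; rewrite !inE; apply: ss_classes_inj.
have [zs HE] := closed_field_poly_normal HL.
have : finite_set (ss_classes p).
  rewrite -(eq_finite_set (inj_card_eq inj)).
  apply: sub_finite_set (finite_seq [seq z^-1 | z <- zs]) => x [c /ss_classesP[_ j0 _ r] <-] /=.
  apply/mapP; exists (j_inv (repr c))^-1; last by rewrite invrK.
  by move: r; rewrite HE rootZ ?lead_coef_eq0 ?hpolyL_neq0 // root_prod_XsubC.
move=> /finite_seqP[s sE]; exists (undup s); first exact: undup_uniq.
by rewrite sE; apply/seteqP; split=> x /=; rewrite mem_undup.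
Qed.

Lemma ss_roots : exists2 rs : seq L, uniq rs &
  ss_poly_bar p = \prod_(x <- rs) ('X - x%:P) /\
  forall x, (x \in rs) = [&& x != 0, x != 1728%:R & root HL x^-1].
Proof.
have [cs ucs csE] := ss_classes_finite.
have mem c : c \in cs -> ss_classes p c by rewrite csE.
exists [seq j_inv (repr c) | c <- cs].
  rewrite map_inj_in_uniq // => c d /mem sc /mem sd; exact: ss_classes_inj.
split; first by rewrite /ss_poly_bar csE -fsbig_seq // big_map.
move=> x; apply/mapP/and3P => [[c /mem/ss_classesP[_ j0 j1 r] ->] //|[x0 x1 r]].
have [E eE jE] := j_inv_surj two three x0 x1.
pose c : iso_class L := (\pi_(iso_class L) E)%qT.
have [u [ur [us [ut [u0 eq]]]]] : exists u r s t : L, u != 0 /\ E = w_change u r s t (repr c).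
  apply/asboolP; have /eqquotP : (repr c = E %[mod iso_class L])%qT by rewrite reprK.
  by [].
have jc : j_inv (repr c) = x by rewrite -jE eq j_inv_change.
have ec : elliptic (repr c) by move: eE; rewrite eq elliptic_change.
have sc : ss_classes p c by apply/ss_classesP; rewrite jc; split.
by exists c; rewrite ?jc //; rewrite csE in sc.
Qed.

Lemma frobenius_fixed (x : L) : x ^+ p = x -> exists a, x = embed a.
Proof.
move=> xp; have := congr1 (map_poly embed) (finField_genPoly 'F_p).
rewrite card_Fp // rmorphB rmorphXn /= map_polyX rmorph_prod => /(congr1 (horner^~ x)).
rewrite /= hornerD hornerN hornerXn hornerX xp subrr horner_prod => /esym/eqP.
rewrite prodf_seq_eq0 => /hasP[a _]; rewrite rmorphB /= map_polyX map_polyC hornerXsubC subr_eq0.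
by move=> /eqP ->; exists a.
Qed.

(** The roots are inverses of roots of H, whose coefficients lie in the prime field, so Frobenius
    permutes them and fixes the coefficients of their product. *)
Lemma map_ss_poly : map_poly embed (ss_poly p) = ss_poly_bar p.
Proof.
have [rs urs [sE rsE]] := ss_roots.
have fix_coef i : exists a, (ss_poly_bar p)`_i = embed a.
  apply: frobenius_fixed; pose phi : {rmorphism L -> L} := pFrobenius_aut pL.
  rewrite -[LHS]/(phi _) -(coef_map phi).
  suff -> : map_poly phi (ss_poly_bar p) = ss_poly_bar p by [].
  rewrite sE rmorph_prod /=.
  have -> : \prod_(x <- rs) map_poly phi ('X - x%:P) = \prod_(x <- map phi rs) ('X - x%:P).
    by rewrite big_map; apply: eq_bigr => x _; rewrite rmorphB /= map_polyX map_polyC.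
  have phi_inj : injective phi by apply: fmorph_inj.
  apply: perm_big; have u' : uniq (map phi rs) by rewrite map_inj_uniq.
  have sub : {subset map phi rs <= rs}.
    move=> _ /mapP[x xrs ->]; move: xrs; rewrite !rsE => /and3P[x0 x1 r].
    rewrite fmorph_eq0 x0 -(rmorph_nat phi 1728) (inj_eq phi_inj) x1 -fmorphV.
    have -> : HL = map_poly phi HL by rewrite hpoly_map.
    by rewrite fmorph_root.
  apply: uniq_perm => //.
  exact: (uniq_min_size u' sub (eq_leq (esym (size_map _ _)))).2.
have descendK a : Fp_descend (embed a) = a.
  rewrite /Fp_descend; case: pickP => [b /eqP/fmorph_inj //|/(_ a)].
  by rewrite eqxx.
apply/polyP => i; rewrite coef_map /ss_poly coef_map_id0; last by rewrite -(rmorph0 embed) descendK.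
by have [a ->] := fix_coef i; rewrite descendK.
Qed.

End SupersingularPolynomial.

Lemma rev_poly_map (R S : nzRingType) (phi : {rmorphism R -> S}) m (f : {poly R}) :
  map_poly phi (rev_poly m f) = rev_poly m (map_poly phi f).
Proof.
apply/polyP => i; rewrite coef_map [in LHS]coef_poly [RHS]coef_poly coef_map.
case: (i < m.+1)%N => //; exact: raddf0.
Qed.

Lemma rev_poly_mulXsub (R : comNzRingType) (x : R) (g : {poly R}) m : (size g <= m.+1)%N ->
  rev_poly m.+1 (('X - x%:P) * g) = (1 - x%:P * 'X) * rev_poly m g.
Proof.
move=> sg; apply/polyP => i.
rewrite [(1 - _) * _]mulrBl mul1r coefB -mulrA coefCM coefXM !coef_poly.
rewrite [('X - _) * _]mulrBl coefB coefXM coefCM.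
case: i => [|i]; first by rewrite !subn0 /= (nth_default _ sg) mulr0.
rewrite !ltnS !subSS /=; case: (ltngtP i m) => [im|im|->].
- by rewrite subn_eq0 leqNgt im /= subnS.
- by rewrite mulr0 subr0.
- by rewrite subnn eqxx.
Qed.

(** Reversal turns each factor X - x into 1 - xX, whose root is 1/x. *)
Lemma rev_poly_dvd (R : fieldType) (x : R) (f : {poly R}) m : x != 0 -> (size f <= m.+1)%N ->
  ('X - x%:P) ^+ 2 %| f -> ('X - x^-1%:P) ^+ 2 %| rev_poly m f.
Proof.
move=> x0 sf /dvdpP[g fE].
have [g0|g0] := eqVneq g 0.
  suff -> : rev_poly m f = 0 by rewrite dvdp0.
  by apply/polyP => i; rewrite coef_poly fE g0 mul0r !coef0 if_same.
have szE : size f = (size g).+2.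
  by rewrite fE size_mul ?expf_neq0 ?polyXsubC_eq0 // size_exp_XsubC addnS addn2.
have fE' : f = ('X - x%:P) * (('X - x%:P) * g) by rewrite fE; ring.
rewrite szE in sf; have := g0; rewrite -size_poly_gt0 => pg.
have [m' mE] : exists m', m = m'.+2.
  by exists m.-2; move: (size g) sf pg => s; lia.
have sg : (size g <= m'.+1)%N by move: sf; rewrite mE.
rewrite mE fE' rev_poly_mulXsub; last first.
  by rewrite size_mul ?polyXsubC_eq0 // size_XsubC.
rewrite rev_poly_mulXsub //.
have -> : 1 - x%:P * 'X = - x%:P * ('X - x^-1%:P).
  rewrite -[1 in LHS]polyC1 -(mulfV x0) polyCM; ring.
by apply/dvdpP; exists (x%:P ^+ 2 * rev_poly m' g); ring.
Qed.

Lemma uniq_prod_XsubC (R : fieldType) (zs : seq R) :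
  (forall z, z \in zs -> ~~ (('X - z%:P) ^+ 2 %| \prod_(w <- zs) ('X - w%:P))) -> uniq zs.
Proof.
elim: zs => //= z zs IH nd; apply/andP; split.
  apply/negP => zin; have := nd z (mem_head _ _); rewrite big_cons expr2 dvdp_mul2l ?polyXsubC_eq0 //.
  by rewrite dvdp_XsubCl root_prod_XsubC zin.
apply: IH => w win; have := nd w; rewrite inE win orbT => /(_ isT).
by apply: contra => d; rewrite big_cons dvdp_mull.
Qed.

Lemma prod_XsubC_sqr_dvd (R : fieldType) (zs : seq R) (g : {poly R}) : uniq zs ->
  (forall z, z \in zs -> ('X - z%:P) ^+ 2 %| g) -> (\prod_(z <- zs) ('X - z%:P)) ^+ 2 %| g.
Proof.
elim: zs => [|z zs IH] /=; first by rewrite big_nil expr1n dvd1p.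
move=> /andP[nz uz] d; rewrite big_cons exprMn Gauss_dvdp.
  by rewrite d ?mem_head // IH // => w win; apply: d; rewrite inE win orbT.
by rewrite coprimep_expl // coprimep_expr // coprimep_sym coprimep_XsubC root_prod_XsubC.
Qed.

(** * Divisibility by H^2 for p > 3 *)

Section LargePrime.
Variables (p N : nat) (pp : prime p) (pN : p = N.*2.+1) (p3 : (3 < p)%N).
Local Notation R := ('F_p).
Local Notation L := (Fpbar p).
Local Notation embed := (Fp_embed p).
Local Notation HL := (hpoly L N).
Local Notation cL := (cusp_poly L).

Let pL : p \in [pchar L] := pchar_Fpbar pp.
Let two : (2 : L) != 0. Proof. by apply: (pchar_natr_neq0 pL); lia. Qed.
Let three : (3 : L) != 0. Proof. by apply: (pchar_natr_neq0 pL); lia. Qed.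
Let Np : (N < p)%N. Proof. by rewrite pN ltnS -addnn leq_addr. Qed.
Let pN1 : p.-1 = (N * 2)%N. Proof. by rewrite pN muln2. Qed.
Let n1728 : (1728 : L) != 0.
Proof.
have -> : 1728 = 2 ^+ 6 * 3 ^+ 3 :> L by ring.
by rewrite mulf_neq0 ?expf_neq0.
Qed.

Lemma root_cusp_poly (z : L) : root cL z = (z == 1728^-1).
Proof.
rewrite rootE horner_cusp_poly subr_eq0; apply/eqP/eqP => [e|->]; last by rewrite mulfV.
by apply: (mulfI n1728); rewrite -e mulfV.
Qed.

(** The root 1/1728 is set apart because the differential equation degenerates there; every other
    root is nonzero as H(0) is, and simple by [ode_simple_root]. *)
Lemma hpoly_factor : exists e zs, [/\ (e <= N)%N, uniq zs,
  forall z, z \in zs -> [/\ z != 0, z != 1728^-1 & root HL z] &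
  HL %= ('X - (1728^-1)%:P) ^+ e * \prod_(z <- zs) ('X - z%:P)].
Proof.
have H0 := hpolyL_neq0 pp pN p3; have [zs HE] := closed_field_poly_normal HL.
have l0 : lead_coef HL != 0 by rewrite lead_coef_eq0.
have Hp : HL %= \prod_(z <- zs) ('X - z%:P) by rewrite HE eqp_scale.
have szs : (size zs <= N)%N.
  by have := size_hpoly L N; rewrite (eqp_size Hp) size_prod_XsubC.
have rootH z : root HL z = (z \in zs) by rewrite (eqp_root Hp) root_prod_XsubC.
set y0 := 1728^-1.
have prodE : \prod_(z <- zs) ('X - z%:P) =
    ('X - y0%:P) ^+ count_mem y0 zs * \prod_(z <- [seq z <- zs | z != y0]) ('X - z%:P).
  rewrite (bigID (pred1 y0)) /= big_filter; congr (_ * _).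
  rewrite (eq_bigr (fun=> 'X - y0%:P)) => [|z /eqP -> //].
  by rewrite big_const_seq iter_mulr_1.
exists (count_mem y0 zs), [seq z <- zs | z != y0].
have mem z : z \in [seq z <- zs | z != y0] -> [/\ z != 0, z != y0 & root HL z].
  rewrite mem_filter => /andP[zy zz]; rewrite rootH; split=> //.
  by apply/eqP => z0; have := hpoly0 pL pN p3; rewrite -[_ == 0]/(root HL 0) rootH -z0 zz.
split=> //; [by apply: leq_trans (count_size _ _) szs | | by rewrite -prodE].
apply: uniq_prod_XsubC => z /mem[z0 zy rz]; apply/negP => d.
have := ode_simple_root pL Np (size_hpoly L N) H0 z0 (hpoly_ode pL pN p3).
rewrite root_cusp_poly zy => /(_ isT)/negP; apply.
by rewrite (eqp_dvdr _ Hp) prodE dvdp_mull.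
Qed.

(** The factor at 1/1728 enters H^2 with exponent 2e <= 2N = p - 1 and is absorbed by c^(p-1). The
    other roots are inverses of supersingular j-invariants, at which the reversed F vanishes
    doubly. *)
Lemma hpoly_sqr_dvd (F : {poly int}) m : (size F <= m.+1)%N ->
  ss_poly p ^+ 2 %| poly_mod p F ->
  hpoly R N ^+ 2 %| rev_poly m (poly_mod p F) * cusp_poly R ^+ p.-1.
Proof.
move=> sF dF; have [rs urs [sE rsE]] := ss_roots pp pN p3.
have [e [zs [eN uzs zsP Hp]]] := hpoly_factor.
rewrite -(dvdp_map embed) rmorphXn rmorphM rmorphXn /= hpoly_map rev_poly_map.
have cE : map_poly embed (cusp_poly R) = cL.
  by rewrite /cusp_poly rmorphB rmorph1 (rmorphM _ 1728) rmorph_nat /= map_polyX.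
rewrite cE (eqp_dvdl _ (eqp_exp 2 Hp)) exprMn [X in _ %| X]mulrC dvdp_mul //.
  have dc : ('X - (1728^-1)%:P) %| cL by rewrite dvdp_XsubCl root_cusp_poly.
  rewrite -exprM; apply: dvdp_trans (dvdp_exp2r _ dc) _; apply: dvdp_exp2l.
  by rewrite pN1 leq_mul2r eN orbT.
apply: prod_XsubC_sqr_dvd => // z /zsP[z0 zy rz]; rewrite -[z]invrK.
apply: rev_poly_dvd; first by rewrite invr_eq0.
  by rewrite size_map_poly; apply: leq_trans (size_poly _ _) sF.
apply: dvdp_trans (_ : ss_poly_bar p ^+ 2 %| _).
  apply: dvdp_exp2r; rewrite sE dvdp_XsubCl root_prod_XsubC rsE invr_eq0 z0 invrK rz andbT /=.
  by apply: contraNneq zy => zE; rewrite -zE invrK.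
by rewrite -(map_ss_poly pp pN p3) -rmorphXn /= dvdp_map.
Qed.

End LargePrime.

Theorem theorem2p3 (F : {poly int}) (m : nat)
    (F_monic : F \is monic) (F_deg : size F = m.+1) :
  (forall p : nat, prime p ->
     ss_poly p ^+ 2 %| poly_mod p F ->
     exists G : {poly int},
       (p * (size G).-1 <= m)%N /\
       q_congr p (Uop p (j_coef F)) (j_coef G)) /\
  (forall p : nat, prime p -> (p <= 11)%N -> (m < p)%N ->
     q_congr p (Uop p (j_coef F)) (q_const (j_coef F 0))).
Proof.
have sF : (size F <= m.+1)%N by rewrite F_deg.
split=> p pp.
  move=> dF; have [p3|p3] := leqP p 3; first exact: U_congr_23.
  have pN : p = p./2.*2.+1.
    by rewrite -[LHS]odd_double_half; case: (even_prime pp) p3 => [->|->].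
  by apply: (U_congr_dvd pp pN p3 sF); apply: hpoly_sqr_dvd.
move=> p11 mp; have [G [sG FG]] := U_congr_small pp p11 sF.
exact: U_congr_const mp sG FG.
Qed.
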